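(* Let $(E,\mathcal{E})$ be a measurable space, let $w:E\to[1,+\infty[$ be measurable and let $Q\in\mathcal{T}(E,\mathcal{E})$ be such that $w^{-1}(Qw)$ is bounded. Assume that there exist an integer $\ell\ge1$, a probability measure $\nu$ on $(E,\mathcal{E})$ and $\alpha\in\mathcal{H}^{(w)}_\nu$ such that $S=Q^\ell-T_{\nu,\alpha}\ge0$ and $r^w(S)^{1/\ell}<r^w(Q)$. Then: (i) the operator $Q$ is quasi-compact on $\mathcal{B}_w$ and $r_e^w(Q)\le r^w(S)^{1/\ell}$; (ii) assume moreover that either $\ell=1$, or $\mathcal{E}$ is countably generated; then, if $\chi\in\mathcal{X}$ is such that $\|\chi\|\,r^w(S)^{1/\ell}<r^w(Q_\chi)$, the operator $Q_\chi$ is quasi-compact on $\mathcal{B}_w$ and $r_e^w(Q_\chi)\le\|\chi\|\,r^w(S)^{1/\ell}$.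
   Context: A bounded positive kernel on $(E,\mathcal{E})$ is a function $Q:E\times\mathcal{E}\to\mathbb{R}_+$ such that $Q(\cdot,A)$ is $\mathcal{E}$-measurable for every $A\in\mathcal{E}$, $Q(x,\cdot)$ is a positive measure for every $x\in E$, and $\sup_{x}Q(x,E)<+\infty$; $\mathcal{T}(E,\mathcal{E})$ is the set of these. Write $Qf(x)=\int_E f(y)\,Q(x,dy)$; $Q^\ell$ is the $\ell$-th power. $K_1-K_2\ge0$ means $K_1(x,A)\ge K_2(x,A)$ for all $(x,A)\in E\times\mathcal{E}$. $\mathcal{B}_w$ is the Banach space of complex measurable functions $f$ on $E$ with $\|f\|_w=\sup_E w^{-1}|f|<+\infty$; a kernel $Q$ defines a bounded operator on $\mathcal{B}_w$ exactly when $w^{-1}(Qw)$ is bounded. For a bounded operator $T$ on $\mathcal{B}_w$, $r^w(T)$ and $r_e^w(T)$ are its spectral radius and essential spectral radius on $\mathcal{B}_w$; $T$ is quasi-compact on $\mathcal{B}_w$ if $r_e^w(T)<r^w(T)$. Here the essential spectral radius of a bounded operator $T$ on a Banach space $B$ with spectral radius $r(T)$ is the infimum of $r(T)$ and of the real numbers $\rho\ge0$ such that $B=F_\rho\oplus H_\rho$ where $F_\rho,H_\rho$ are $T$-invariant subspaces, $H_\rho$ is closed, $r(T_{|H_\rho})<\rho$, $\dim F_\rho<+\infty$ and all eigenvalues of $T_{|F_\rho}$ have modulus $\ge\rho$. For a probability measure $\nu$ on $(E,\mathcal{E})$, $\mathcal{H}^{(w)}_\nu$ is the set of nonnegative measurable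 functions $\alpha$ on $E\times E$ such that the functions $\alpha^{(w)}(x,\cdot)=w(x)^{-1}\alpha(x,\cdot)w(\cdot)$, $x\in E$, are uniformly $\nu$-integrable, i.e. $\lim_{m\to+\infty}\sup_{x\in E}\int_{\{y:\alpha^{(w)}(x,y)\ge m\}}\alpha^{(w)}(x,y)\,d\nu(y)=0$; and $T_{\nu,\alpha}(x,A)=\int_A\alpha(x,y)\,d\nu(y)$. $\mathcal{X}$ is the space of bounded measurable complex functions on $E\times E$, with $\|\chi\|=\sup_{E\times E}|\chi|$, and $Q_\chi f(x)=\int_E f(y)\chi(x,y)\,Q(x,dy)$. *)

(* Defs.v *)
From HB Require Import structures.
From mathcomp Require Import all_boot all_order all_algebra.
From mathcomp Require Import all_classical all_reals all_analysis.
From mathcomp Require Import complex.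

Set Implicit Arguments.
Unset Strict Implicit.
Unset Printing Implicit Defensive.

Import Order.TTheory GRing.Theory Num.Theory.
Import numFieldNormedType.Exports.

Local Open Scope classical_set_scope.
Local Open Scope ring_scope.
Local Open Scope complex_scope.

(* A complex normed space is presented here as a subspace B of an ambient
   complex vector space V, with a norm N : V -> R that is meaningful on B; an
   operator on B is a map V -> V of which only the values on B matter.
   Restricting an operator to an invariant subspace then amounts to replacing B
   by that subspace. *)
Section SpectralTheory.
Context {R : realType} {V : lmodType R[i]}.
Implicit Types (N : V -> R) (B F H : set V) (T : V -> V).

Definition is_subspace H := submod_closed (fun f : V => f \in H).

(* lam - T is invertible among the bounded operators on B; the inverse U is
   automatically linear on B. *)
Definition resolvent_set N B T : set R[i] :=
  [set lam | exists U : V -> V,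
    [/\ forall f, B f -> B (U f),
        exists C : R, forall f, B f -> N (U f) <= C * N f,
        forall f, B f -> U (lam *: f - T f) = f &
        forall f, B f -> lam *: U f - T (U f) = f]].

Definition spectrum N B T : set R[i] := ~` resolvent_set N B T.

(* sup set0 = 0: the spectral radius of an operator on the null space is 0. *)
Definition spectral_radius N B T : R :=
  sup [set Normc.normc lam | lam in spectrum N B T].

Definition finite_dimensional F :=
  exists (n : nat) (e : 'I_n -> V),
    forall f, F f -> exists c : 'I_n -> R[i], f = \sum_(k < n) c k *: e k.

Definition closed_in N B H :=
  forall f, B f ->
    (forall eps : R, 0 < eps -> exists2 h, H h & N (f - h) < eps) -> H f.

Definition invariant_by T H := forall f, H f -> H (T f).

Definition direct_sum B F H :=
  [/\ F `<=` B, H `<=` B, F `&` H = [set 0] &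
      forall f, B f -> exists g h, [/\ F g, H h & f = g + h]].

Definition spectral_splitting N B T (rho : R) F H :=
  [/\ is_subspace F /\ is_subspace H,
      direct_sum B F H,
      invariant_by T F /\ invariant_by T H,
      closed_in N B H /\ spectral_radius N H T < rho &
      finite_dimensional F /\
      forall (lam : R[i]) f, F f -> f <> 0 -> T f = lam *: f ->
        rho <= Normc.normc lam].

Definition ess_spectral_radius N B T : R :=
  inf [set rho | rho = spectral_radius N B T \/
                 0 <= rho /\ exists F H, spectral_splitting N B T rho F H].

Definition quasi_compact N B T : Prop :=
  ess_spectral_radius N B T < spectral_radius N B T.

End SpectralTheory.

(* Complex-valued functions: R[i] carries no sigma-algebra in the library, so
   measurability and integrals are taken on real and imaginary parts. *)
Definition cmeasurable {d} {X : measurableType d} {R : realType}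
    (f : X -> R[i]) :=
  measurable_fun setT (fun x => complex.Re (f x)) /\
  measurable_fun setT (fun x => complex.Im (f x)).

Definition cintegral {d} {X : measurableType d} {R : realType}
    (mu : {measure set X -> \bar R}) (f : X -> R[i]) : R[i] :=
  Rintegral mu setT (fun x => complex.Re (f x)) +i*
  Rintegral mu setT (fun x => complex.Im (f x)).

Section WeightedKernels.
Context {d : measure_display} {E : measurableType d} {R : realType}.
Implicit Types (w : E -> R) (Q : E -> {measure set E -> \bar R}).

Definition wnorm w (f : E -> R[i]^o) : R :=
  sup [set (w x)^-1 * Normc.normc (f x) | x in setT].

(* B_w consists of genuine functions, not of classes modulo a measure. *)
Definition wspace w : set (E -> R[i]^o) :=
  [set f | cmeasurable f /\
           exists M : R, forall x, (w x)^-1 * Normc.normc (f x) <= M].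

Definition kernel_op Q (f : E -> R[i]^o) : E -> R[i]^o :=
  fun x => cintegral (Q x) f.

Definition kernel_op_weight Q (chi : E * E -> R[i]) (f : E -> R[i]^o) :
    E -> R[i]^o :=
  fun x => cintegral (Q x) (fun y => f y * chi (x, y)).

Definition weight_bounded w Q :=
  exists M : R,
    forall x, (((w x)^-1)%:E * \int[Q x]_y (w y)%:E <= M%:E)%E.

(* Pointwise set function of the iterated kernel: Q^0(x, A) = dirac x A and
   Q^(m+1)(x, A) = int Q^m(y, A) Q(x, dy). *)
Fixpoint kernel_pow Q (n : nat) (x : E) (A : set E) : \bar R :=
  if n is m.+1 then (\int[Q x]_y kernel_pow Q m y A)%E else \d_x A.

Definition kernel_density (nu : {measure set E -> \bar R})
    (alpha : E * E -> R) (x : E) (A : set E) : \bar R :=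
  (\int[nu]_(y in A) (alpha (x, y))%:E)%E.

Definition weighted_density w (alpha : E * E -> R) (x y : E) : R :=
  (w x)^-1 * alpha (x, y) * w y.

(* The class H_nu^(w): the functions weighted_density w alpha x, indexed by x,
   are uniformly nu-integrable. *)
Definition unif_int_density w (nu : {measure set E -> \bar R})
    (alpha : E * E -> R) :=
  [/\ forall z, 0 <= alpha z,
      measurable_fun setT alpha &
      ereal_sup [set (\int[nu]_(y in [set y | (m <= weighted_density w alpha x y)%R])
                        (weighted_density w alpha x y)%:E)%E | x in setT]
        @[m --> +oo%R] --> 0%E].

Definition bounded_cmeasurable (chi : E * E -> R[i]) :=
  cmeasurable chi /\ exists M : R, forall z, Normc.normc (chi z) <= M.

Definition sup_norm (chi : E * E -> R[i]) : R :=
  sup [set Normc.normc (chi z) | z in setT].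

Definition countably_generated :=
  exists2 G : set (set E), countable G & @measurable d E = <<s G >>.

Definition wradius w Q : R := spectral_radius (wnorm w) (wspace w) (kernel_op Q).

End WeightedKernels.

Arguments countably_generated {d} E.

(* Main.v *)
Require Import Defs.
From HB Require Import structures.
From mathcomp Require Import all_boot all_order all_algebra.
From mathcomp Require Import all_classical all_reals all_analysis.
From mathcomp Require Import measurable_realfun.
From mathcomp Require Import complex ring lra.

Set Implicit Arguments.
Unset Strict Implicit.
Unset Printing Implicit Defensive.

Import Order.TTheory GRing.Theory Num.Theory.
Import numFieldNormedType.Exports.

Local Open Scope classical_set_scope.
Local Open Scope ring_scope.

(** Write Q^l = S + T with T the operator of density alpha. By uniform
    integrability T is, up to a small error, the integral operator of a bounded
    density, and bounded densities are L1(nu x nu)-limits of rectangle sums; hence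
    every word T S^a T is a norm limit of finite-rank operators, and for large n
    all words of (S + T)^n except those with at most one letter T are finite-rank
    up to small error. Since S is positive, its iterates on w grow at the rate
    r(S) (a resolvent argument), so (Q^l)^n is a finite-rank operator plus one of
    norm at most b^(l n) / 8 for any b > r(S)^(1/l).

    The splitting for such operators is obtained by linear algebra instead of
    holomorphic calculus: lam^N - Q^N = W (1 - K) with W invertible and K of
    finite rank, so kernels and images of products of these factors are described
    by a finite square matrix, and Riesz's lemma bounds the length of a strictly
    increasing chain of kernels.

    For Q_chi, the functional f |-> (Q_chi^l f)(x) is dominated by
    |chi|^l Q^l(x, .), so it has a density theta(x, .). A jointly measurable
    theta is the limit of the L2-martingale of the quotients on the atoms of a
    sequence generating the sigma-algebra, along stopping levels that depend
    measurably on x. Then Q_chi^l = S_theta + T_(theta alpha), and the argument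
    for Q applies. *)

(** * Operators that are invertible up to finite rank *)

(** Neither T nor S^a T need be close to finite rank: approximating a bounded density in L1(nu x nu)
    gives no control of the supremum over x that the norm of B_w asks for. A second factor T on the
    left averages over x against nu and turns L1-smallness into norm-smallness. Hence the words with
    a single T stay in the remainder; there are only n of them of length n, so together they grow
    like n sg^n, which any t^n with t > sg absorbs. The 1/8 is what the Riesz argument consumes: it
    gives unit vectors whose images under Q^N are rho^N / 2 apart, while the remainder separates two
    of them by at most rho^N / 4 and, by pigeonhole, the finite-rank part separates some two by less
    than rho^N / 8. A splitting asks for a strict inequality on H and a weak one on F, so a gap r1 <
    r2 is required; it is found by comparing maximal chain lengths, without isolating any
    eigenvalue. For the growth of S, the resolvent is used at one real point only: it bounds the
    Neumann sums of w uniformly near the critical rate, and positivity then lowers that rate. *)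

Section ComplexModulus.
Variable R : realType.
Implicit Types (x y : R[i]) (a : R).
Local Notation normc := (@Normc.normc R).

Lemma normc_ge0 x : 0 <= normc x.
Proof. by case: x => a b; apply: sqrtr_ge0. Qed.

Lemma normcD x y : normc (x + y) <= normc x + normc y.
Proof. exact: le_normcD. Qed.

Lemma normcNE x : normc (- x) = normc x.
Proof. exact: normcN. Qed.

Lemma ler_normcB x y : normc (x - y) <= normc x + normc y.
Proof. by rewrite (le_trans (normcD _ _))// normcNE. Qed.

Lemma normc_real a : normc (a%:C)%C = `|a|.
Proof. by rewrite /Normc.normc /= expr0n/= addr0 sqrtr_sqr. Qed.

Lemma normcX x n : normc (x ^+ n) = normc x ^+ n.
Proof.
elim: n => [|n IH]; first by rewrite !expr0 Normc.normc1.
by rewrite !exprS Normc.normcM IH.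
Qed.

Lemma normc_sum (I : Type) (r : seq I) (P : pred I) (F : I -> R[i]) :
  normc (\sum_(i <- r | P i) F i) <= \sum_(i <- r | P i) normc (F i).
Proof.
elim/big_ind2 : _ => //; first by rewrite Normc.normc0.
by move=> x a y b xa yb; rewrite (le_trans (normcD _ _))// lerD.
Qed.

Lemma normc_gt0 x : (0 < normc x) = (x != 0).
Proof.
rewrite lt_neqAle normc_ge0 andbT eq_sym; congr negb.
by apply/eqP/eqP => [/Normc.eq0_normc//|->]; rewrite Normc.normc0.
Qed.

Lemma sqr_normcE x : normc x ^+ 2 = complex.Re x ^+ 2 + complex.Im x ^+ 2.
Proof. by case: x => a b /=; rewrite sqr_sqrtr // addr_ge0 ?sqr_ge0. Qed.

Lemma le_Re_normc x : `|complex.Re x| <= normc x.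
Proof.
case: x => a b /=; rewrite -sqrtr_sqr ler_sqrt ?lerDl ?sqr_ge0//.
by rewrite addr_ge0 ?sqr_ge0.
Qed.

Lemma le_Im_normc x : `|complex.Im x| <= normc x.
Proof.
case: x => a b /=; rewrite -sqrtr_sqr ler_sqrt ?lerDr ?sqr_ge0//.
by rewrite addr_ge0 ?sqr_ge0.
Qed.

Lemma normc_le_ReIm x : normc x <= `|complex.Re x| + `|complex.Im x|.
Proof.
case: x => a b /=; rewrite -(ler_pXn2r (n := 2)) ?nnegrE ?sqrtr_ge0 ?addr_ge0//.
rewrite sqr_sqrtr ?addr_ge0 ?sqr_ge0// sqrrD !real_normK ?num_real//.
by rewrite -addrA lerD2l lerDr mulrn_wge0// mulr_ge0.
Qed.

End ComplexModulus.

(** * Bounded, finite-rank and almost invertible operators *)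

Section BoundedOperators.
Variables (R : realType) (X : lmodType R[i]).
Local Notation C := R[i].
Local Notation normc := (@Normc.normc R).

(** Completeness is stated with sequences and weak inequalities, so that no topology has to be put
    on [X]. *)
Definition complete_norm (N : X -> R) :=
  [/\ forall f g, N (f + g) <= N f + N g,
      forall (a : C) f, N (a *: f) = normc a * N f,
      forall f, N f = 0 -> f = 0 &
      forall u : nat -> X,
        (forall e, 0 < e -> exists n0, forall m n,
           (n0 <= m)%N -> (n0 <= n)%N -> N (u m - u n) <= e) ->
        exists l, forall e, 0 < e -> exists n0, forall n,
          (n0 <= n)%N -> N (u n - l) <= e].

Variable (N : X -> R).
Hypothesis cN : complete_norm N.

Lemma cnormD f g : N (f + g) <= N f + N g. Proof. by case: cN. Qed.
Lemma cnormZ a f : N (a *: f) = normc a * N f. Proof. by case: cN. Qed.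
Lemma cnorm_eq0 f : N f = 0 -> f = 0. Proof. by case: cN => _ _ h _; apply: h. Qed.
Lemma cnorm0 : N 0 = 0.
Proof. by rewrite -(scale0r (0 : X)) cnormZ Normc.normc0 mul0r. Qed.
Lemma cnormN f : N (- f) = N f.
Proof. by rewrite -scaleN1r cnormZ normcNE Normc.normc1 mul1r. Qed.
Lemma cnorm_ge0 f : 0 <= N f.
Proof.
have := cnormD f (- f); rewrite subrr cnorm0 cnormN -mulr2n.
by rewrite pmulrn_lge0.
Qed.
Lemma cnormB f g : N (f - g) <= N f + N g.
Proof. by rewrite (le_trans (cnormD _ _))// cnormN. Qed.
Lemma cnorm_dist f g h : N (f - h) <= N (f - g) + N (g - h).
Proof. by rewrite -[f - h](subrKA g) cnormD. Qed.
Lemma cnorm_sub f g : N (f - g) = N (g - f).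
Proof. by rewrite -cnormN opprB. Qed.
Lemma cnorm_sum (I : Type) (r : seq I) (P : pred I) (F : I -> X) :
  N (\sum_(i <- r | P i) F i) <= \sum_(i <- r | P i) N (F i).
Proof.
elim/big_ind2 : _ => //; first by rewrite cnorm0.
by move=> x a y b xa yb; rewrite (le_trans (cnormD _ _))// lerD.
Qed.

Definition lin (Y : lmodType C) (T : X -> Y) := forall a f g, T (a *: f + g) = a *: T f + T g.

Section Lin.
Variables (Y : lmodType C) (T : X -> Y).
Hypothesis lT : lin T.
Lemma lin0 : T 0 = 0.
Proof. by have := lT (-1) 0 0; rewrite !scaleN1r !addNr. Qed.
Lemma linD f g : T (f + g) = T f + T g.
Proof. by have := lT 1 f g; rewrite !scale1r. Qed.
Lemma linZ a f : T (a *: f) = a *: T f.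
Proof. by have := lT a f 0; rewrite lin0 !addr0. Qed.
Lemma linN f : T (- f) = - T f.
Proof. by rewrite -scaleN1r linZ scaleN1r. Qed.
Lemma linB f g : T (f - g) = T f - T g.
Proof. by rewrite linD linN. Qed.
Lemma lin_sum (I : Type) (r : seq I) (P : pred I) (F : I -> X) :
  T (\sum_(i <- r | P i) F i) = \sum_(i <- r | P i) T (F i).
Proof. by elim/big_rec2 : _ => [|i x y _ <-]; rewrite ?lin0 ?linD. Qed.
End Lin.

Definition blin (T : X -> X) :=
  lin T /\ exists2 M, 0 <= M & forall f, N (T f) <= M * N f.

Lemma blin_lin T : blin T -> lin T. Proof. by case. Qed.
#[local] Hint Resolve blin_lin : core.

Lemma blin_id : blin id.
Proof. by split=> //; exists 1 => // f; rewrite mul1r. Qed.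

Lemma blin_comp S T : blin S -> blin T -> blin (S \o T).
Proof.
move=> [lS [M M0 bS]] [lT [M' M'0 bT]]; split.
  by move=> a f g /=; rewrite lT lS.
exists (M * M'); first exact: mulr_ge0.
by move=> f /=; rewrite (le_trans (bS _))// -mulrA ler_wpM2l.
Qed.

Lemma blin_add S T : blin S -> blin T -> blin (fun f => S f + T f).
Proof.
move=> [lS [M M0 bS]] [lT [M' M'0 bT]]; split.
  by move=> a f g /=; rewrite lT lS scalerDr addrACA.
exists (M + M'); first exact: addr_ge0.
by move=> f /=; rewrite (le_trans (cnormD _ _))// mulrDl lerD.
Qed.

Lemma blin_scale a T : blin T -> blin (fun f => a *: T f).
Proof.
move=> [lT [M M0 bT]]; split.
  by move=> b f g /=; rewrite lT scalerDr !scalerA mulrC.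
exists (normc a * M); first by rewrite mulr_ge0// normc_ge0.
by move=> f; rewrite cnormZ -mulrA ler_wpM2l// normc_ge0.
Qed.

Lemma blin_opp T : blin T -> blin (fun f => - T f).
Proof.
by move=> /(blin_scale (-1)); under eq_fun do rewrite scaleN1r.
Qed.

Lemma blin_sub S T : blin S -> blin T -> blin (fun f => S f - T f).
Proof. by move=> bS /blin_opp; apply: blin_add. Qed.

Lemma blin_zero : blin (fun=> 0).
Proof.
split; first by move=> a f g; rewrite scaler0 addr0.
by exists 0 => // f; rewrite cnorm0 mul0r.
Qed.

Lemma blin_iter T n : blin T -> blin (iter n T).
Proof.
move=> bT; elim: n => [|n IH]; first exact: blin_id.
exact: (blin_comp bT IH).
Qed.

Lemma blin_eq S T : S =1 T -> blin S -> blin T.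
Proof. by move=> /funext ->. Qed.

(** The bounded coordinates [c] belong to the data: they confine the coordinates of unit vectors to
    a box, on which [strict_chain_bounded] runs a pigeonhole argument. *)
Definition fin_rank (K : X -> X) := exists r (c : X -> 'rV[C]_r) (e : 'I_r -> X),
  [/\ lin c, exists2 M, 0 <= M & forall f i, normc (c f 0 i) <= M * N f &
      forall f, K f = \sum_i c f 0 i *: e i].

Lemma fin_rank_blin K : fin_rank K -> blin K.
Proof.
move=> [r [c [e [lc [M M0 bc] KE]]]]; split.
  move=> a f g; rewrite !KE scaler_sumr -big_split/=; apply: eq_bigr => i _.
  by rewrite lc !mxE scalerDl scalerA.
exists (\sum_i M * N (e i)).
  by apply: sumr_ge0 => i _; rewrite mulr_ge0// cnorm_ge0.
move=> f; rewrite KE (le_trans (cnorm_sum _ _ _))// mulr_suml.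
apply: ler_sum => i _; rewrite cnormZ mulrAC ler_wpM2r ?cnorm_ge0//.
Qed.

Lemma fin_rank_comp_l A K : blin A -> fin_rank K -> fin_rank (A \o K).
Proof.
move=> [lA _] [r [c [e [lc bc KE]]]]; exists r, c, (A \o e); split => // f /=.
by rewrite KE lin_sum//; apply: eq_bigr => i _; rewrite linZ.
Qed.

Lemma fin_rank_comp_r A K : blin A -> fin_rank K -> fin_rank (K \o A).
Proof.
move=> [lA [M' M'0 bA]] [r [c [e [lc [M M0 bc] KE]]]].
exists r, (c \o A), e; split => //.
- by move=> a f g /=; rewrite lA lc.
- exists (M * M'); first exact: mulr_ge0.
  by move=> f i /=; rewrite (le_trans (bc _ _))// -mulrA ler_wpM2l.
- by move=> f; rewrite -KE.
Qed.

Lemma fin_rank_add K L : fin_rank K -> fin_rank L -> fin_rank (fun f => K f + L f).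
Proof.
move=> [r [c [e [lc [M M0 bc] KE]]]] [s [d [g [ld [P P0 bd] LE]]]].
exists (r + s)%N, (fun f => row_mx (c f) (d f)).
exists (fun i => match fintype.split i with inl a => e a | inr b => g b end); split.
- by move=> a x y; rewrite lc ld scale_row_mx add_row_mx.
- exists (M + P); first exact: addr_ge0.
  move=> f i; rewrite mxE mulrDl; case: fintype.split => j.
    by rewrite (le_trans (bc _ _))// lerDl mulr_ge0// cnorm_ge0.
  by rewrite (le_trans (bd _ _))// lerDr mulr_ge0// cnorm_ge0.
- move=> f; rewrite big_split_ord/= KE LE; congr (_ + _); apply: eq_bigr => i _.
    by rewrite row_mxEl -[lshift s i]/(unsplit (inl i)) unsplitK.
  by rewrite row_mxEr -[rshift r i]/(unsplit (inr i)) unsplitK.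
Qed.

Lemma fin_rank_zero : fin_rank (fun=> 0).
Proof.
exists 0%N, (fun=> 0), (fun=> 0); split.
- by move=> a f g; rewrite scaler0 addr0.
- by exists 0 => // f [].
- by move=> f; rewrite big_ord0.
Qed.

(** Fredholm operators of index zero, written as invertible minus finite rank: this form is stable
    under composition and reduces kernels and images to matrices. *)
Definition almost_inv (G : X -> X) := exists W W' K,
  [/\ blin W, blin W', cancel W W' /\ cancel W' W, fin_rank K &
      forall f, G f = W f - K f].

Lemma almost_inv_blin G : almost_inv G -> blin G.
Proof.
move=> [W [W' [K [bW bW' _ fK GE]]]].
by apply: (blin_eq (fun f => esym (GE f))); apply: blin_sub => //; apply: fin_rank_blin.
Qed.

Lemma almost_inv_id : almost_inv id.
Proof.
exists id, id, (fun=> 0); split; [exact: blin_id..| by split | exact: fin_rank_zero |].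
by move=> f; rewrite subr0.
Qed.

(** (W - K) H = W W2 - (W K2 + K H): leaving the second occurrence of [H] unexpanded collects all
    finite-rank terms in two products. *)
Lemma almost_inv_comp G H : almost_inv G -> almost_inv H -> almost_inv (G \o H).
Proof.
move=> aG [W2 [W2' [K2 [bW2 bW2' [WK2 WK2'] fK2 HE]]]].
have bH : blin H by apply: almost_inv_blin; exists W2, W2', K2.
case: aG => [W [W' [K [bW bW' [WK WK'] fK GE]]]].
exists (W \o W2), (W2' \o W'), (fun f => (W \o K2) f + (K \o H) f); split.
- exact: blin_comp.
- exact: blin_comp.
- by split; apply: can_comp.
- by apply: fin_rank_add; [exact: fin_rank_comp_l | exact: fin_rank_comp_r].
- by move=> f /=; rewrite GE {1}HE linB//= ?opprD ?addrA//; exact: blin_lin.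
Qed.

End BoundedOperators.

(** * Kernel and image of an almost invertible operator *)

Section AlmostInvertible.
Variables (R : realType) (X : lmodType R[i]) (N : X -> R).
Local Notation C := R[i].
Local Notation normc := (@Normc.normc R).
Hypothesis cN : complete_norm N.

(** On the kernel W f = K f, so f = W' (K f) lies in the span of the vectors [W' (e i)]. *)
Lemma almost_inv_ker G : almost_inv N G -> finite_dimensional [set f | G f = 0].
Proof.
move=> [W [W' [K [_ bW' [WK _] [r [c [e [_ _ KE]]]] GE]]]].
exists r, (W' \o e) => f /= Gf0; exists (c f 0).
move: Gf0; rewrite GE => /eqP; rewrite subr_eq0 => /eqP WfE.
rewrite -[LHS]WK WfE KE (lin_sum (blin_lin bW')); apply: eq_bigr => i _.
by rewrite (linZ (blin_lin bW')).
Qed.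

(* Writing [G = W (1 - e c)], the image of [G] is cut out by finitely many
   functionals, and everything is read off the square matrix [1 - c e]. *)
Lemma almost_inv_image G : almost_inv N G ->
  exists r (phi : X -> 'rV[C]_r) (S : X -> X),
  [/\ lin phi /\ exists2 M, 0 <= M & forall f i, normc (phi f 0 i) <= M * N f,
      forall g, phi (G g) = 0,
      blin N S, forall f, phi f = 0 -> G (S f) = f &
      (forall g, G (G g) = 0 -> G g = 0) ->
      forall f, exists2 g, G g = 0 & phi (f - g) = 0].
Proof.
move=> aG; have bG := almost_inv_blin cN aG; have lG := blin_lin bG.
move: aG => [W [W' [K [bW bW' [WK WK'] [r [c [e [lc [M M0 bc] KE]]]] GE]]]].
have lW := blin_lin bW; have [lW' [M' M'0 bM']] := bW'.
pose eb (u : 'rV[C]_r) : X := \sum_i u 0 i *: W' (e i).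
pose L := \matrix_(i, j) c (W' (e i)) 0 j.
pose L2 := \matrix_(i, j) c (W' (W' (e i))) 0 j.
pose Q := 1%:M - L.
have leb : forall a u v, eb (a *: u + v) = a *: eb u + eb v.
  move=> a u v; rewrite /eb scaler_sumr -big_split; apply: eq_bigr => i _ /=.
  by rewrite !mxE scalerDl scalerA.
have ebB u v : eb (u - v) = eb u - eb v.
  by have := leb (-1) v u; rewrite !scaleN1r addrC => ->; rewrite addrC.
have eb0 : eb 0 = 0 by rewrite -(subrr 0) ebB subrr.
have ceb u : c (eb u) = u *m L.
  rewrite (lin_sum lc); apply/rowP => j; rewrite summxE mxE.
  by apply: eq_bigr => i _; rewrite (linZ lc) !mxE.
have cWeb u : c (W' (eb u)) = u *m L2.
  rewrite (lin_sum lW') (lin_sum lc); apply/rowP => j; rewrite summxE mxE.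
  by apply: eq_bigr => i _; rewrite (linZ lW') (linZ lc) !mxE.
have KeW f : K f = W (eb (c f)).
  rewrite KE (lin_sum lW); apply: eq_bigr => i _.
  by rewrite (linZ lW) WK'.
have GWE f : G f = W (f - eb (c f)) by rewrite GE KeW (linB lW).
have QE (u : 'rV_r) : u *m Q = u - u *m L by rewrite mulmxBr mulmx1.
have bphi (A : 'M[C]_r) : let phi := fun f => c (W' f) *m A in lin phi /\
    exists2 M1, 0 <= M1 & forall f i, normc (phi f 0 i) <= M1 * N f.
  split; first by move=> a f g; rewrite lW' lc mulmxDl scalemxAl.
  exists (\sum_j \sum_i (M * M') * normc (A j i)).
    by apply: sumr_ge0 => j _; apply: sumr_ge0 => i _; rewrite !mulr_ge0// normc_ge0.
  move=> f i; rewrite mxE (le_trans (normc_sum _ _ _))// mulr_suml ler_sum// => j _.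
  rewrite Normc.normcM (bigD1 i)//= mulrDl.
  apply: (@le_trans _ _ (M * M' * normc (A j i) * N f)).
    rewrite mulrAC ler_wpM2r ?normc_ge0// (le_trans (bc _ _))// -mulrA ler_wpM2l//.
  rewrite lerDl mulr_ge0 ?(cnorm_ge0 cN)//.
  by apply: sumr_ge0 => k _; rewrite !mulr_ge0// normc_ge0.
(* With row vectors, c (W' (G g)) = (c g) Q, which [cokermx Q] kills. Conversely [phi f = 0] puts
   [c (W' f)] in the row space of [Q], and solving this finite system with [pinvmx Q] yields a
   preimage of [f]. *)
pose phi f := c (W' f) *m cokermx Q.
have phiG g : phi (G g) = 0.
  by rewrite /phi GWE WK (linB lc) ceb -QE -mulmxA mulmx_coker mulmx0.
pose u f := c (W' f) *m pinvmx Q.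
exists r, phi, (fun f => W' f + eb (u f)); split; [exact: bphi | exact: phiG | | |].
- apply: blin_add => //; apply: fin_rank_blin => //.
  have [lu bu] := bphi (pinvmx Q).
  by exists r, u, (W' \o e); split.
- move=> f phif; rewrite GWE.
  have /mulmxKpV uQ : (c (W' f) <= Q)%MS by rewrite submxE; apply/eqP.
  rewrite (linD lc) ceb -addrA.
  have -> : eb (u f) - eb (c (W' f) + u f *m L) = 0.
    by rewrite -ebB opprD addrA addrAC -QE /u uQ subrr eb0.
  by rewrite addr0 WK'.
- move=> kerG f.
  have Gker v : v *m Q = 0 -> G (eb v) = 0.
    move=> vQ; rewrite GWE ceb.
    have -> : v *m L = v by apply/eqP; rewrite eq_sym -subr_eq0 -QE vQ.
    by rewrite subrr (lin0 lW).
  have phieb v : phi (eb v) = v *m L2 *m cokermx Q by rewrite /phi cWeb.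
  (* [eb] maps the left kernel of [Q] into the kernel of [G], and [P] is [phi] read on it. When G^2
     and [G] have the same kernel, a vector in both kernel and image of [G] is 0, so this map is
     injective; [Q] being square, its left kernel and its cokernel have equal rank, so the map is
     also onto the values of [phi]. *)
  pose P := kermx Q *m (L2 *m cokermx Q).
  have rkP : \rank P = \rank (kermx Q).
    apply/mxrank_injP/eqP/eqmx0P; apply/andP; split; rewrite ?sub0mx//.
    apply/rV_subP => v; rewrite sub_capmx => /andP[/sub_kermxP vQ /sub_kermxP vP].
    have vL : v *m L = v by apply/eqP; rewrite eq_sym -subr_eq0 -QE vQ.
    have phiv : phi (eb v) = 0 by rewrite phieb -mulmxA.
    suff -> : v = 0 by rewrite sub0mx.
    rewrite -vL -ceb; suff -> : eb v = 0 by rewrite (lin0 lc).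
    have /mulmxKpV uQ : (c (W' (eb v)) <= Q)%MS by rewrite submxE; apply/eqP.
    have GS : G (W' (eb v) + eb (u (eb v))) = eb v.
      rewrite GWE (linD lc) ceb -addrA.
      have -> : eb (u (eb v)) - eb (c (W' (eb v)) + u (eb v) *m L) = 0.
        by rewrite -ebB opprD addrA addrAC -QE /u uQ subrr eb0.
      by rewrite addr0 WK'.
    by rewrite -GS; apply: kerG; rewrite GS; apply: Gker.
  have sP : (P <= cokermx Q)%MS by rewrite /P mulmxA submxMl.
  have cP : (cokermx Q <= P)%MS.
    by rewrite -(mxrank_leqif_sup sP) rkP mxrank_ker mxrank_coker.
  have /submxP[v vE] : (phi f <= P)%MS by rewrite (submx_trans _ cP)// submxMl.
  exists (eb (v *m kermx Q)); first by apply: Gker; rewrite -mulmxA mulmx_ker mulmx0.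
  have lphi : lin phi := proj1 (bphi (cokermx Q)).
  by rewrite (linB lphi) phieb vE /P !mulmxA subrr.
Qed.

Lemma expr_small (q e : R) : 0 <= q < 1 -> 0 < e ->
  exists n0, forall n, (n0 <= n)%N -> q ^+ n <= e.
Proof.
move=> /andP[q0 q1] e0; have q1' : `|q| < 1 by rewrite ger0_norm.
have /cvgrPdist_le/(_ _ e0)[n0 _ h] := cvg_expr q1'.
by exists n0 => n /h; rewrite /= sub0r normrN ger0_norm// exprn_ge0.
Qed.

Lemma eq0_of_small (f : X) : (forall e, 0 < e -> N f <= e) -> f = 0.
Proof.
move=> h; apply: (cnorm_eq0 cN); apply/eqP; rewrite eq_le (cnorm_ge0 cN) andbT.
by apply/ler_addgt0Pr => e e0; rewrite add0r h.
Qed.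

Lemma cnorm_contraction (T : X -> X) (q : R) : 0 <= q < 1 ->
  (forall f g, N (T f - T g) <= q * N (f - g)) -> exists f, T f = f.
Proof.
move=> q01 Tq; have /andP[q0 q1] := q01.
have q1' : 0 < 1 - q by rewrite subr_gt0.
pose u n := iter n T 0; pose M := N (u 1%N - u 0%N).
have M0 : 0 <= M := cnorm_ge0 cN _.
have u1 n : N (u n.+1 - u n) <= q ^+ n * M.
  elim: n => [|n IH]; first by rewrite expr0 mul1r.
  by rewrite (le_trans (Tq _ _))// exprS -mulrA ler_wpM2l.
have uk k n : N (u (n + k)%N - u n) <= q ^+ n * (M / (1 - q)).
  elim: k n => [|k IH] n.
    by rewrite addn0 subrr (cnorm0 cN) mulr_ge0 ?exprn_ge0// divr_ge0// ltW.
  rewrite addnS -addSn (le_trans (cnorm_dist cN _ (u n.+1) _))//.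
  rewrite (le_trans (lerD (IH _) (u1 n)))// exprSr -mulrA -mulrDr.
  rewrite ler_wpM2l ?exprn_ge0// le_eqVlt; apply/orP; left; apply/eqP.
  by field; rewrite gt_eqF.
have [e e0|l ul] := (let: And4 _ _ _ h := cN in h) u.
  have d0 : 0 < e / (M / (1 - q) + 1).
    by rewrite divr_gt0// ltr_wpDl// divr_ge0// ltW.
  have [n0 qn] := expr_small q01 d0.
  have h m n : (n0 <= n)%N -> (n <= m)%N -> N (u m - u n) <= e.
    move=> n0n /subnKC <-; rewrite (le_trans (uk _ _))//.
    have D0 : 0 < M / (1 - q) + 1 by rewrite ltr_wpDl// divr_ge0// ltW.
    rewrite (@le_trans _ _ (q ^+ n * (M / (1 - q) + 1)))//.
      by rewrite ler_wpM2l ?exprn_ge0// lerDl.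
    by rewrite -ler_pdivlMr//; exact: qn.
  exists n0 => m n mn0 nn0; case/orP: (leq_total m n) => mn; last exact: h.
  by rewrite (cnorm_sub cN); exact: h.
exists l; apply/eqP; rewrite -subr_eq0; apply/eqP/eq0_of_small => e e0.
have [n0 hn] := ul _ (divr_gt0 e0 (ltr0n R 2)).
rewrite (le_trans (cnorm_dist cN _ (u n0.+1) _))//.
rewrite [leRHS](splitr e) lerD ?hn// (cnorm_sub cN) (le_trans (Tq _ _))//.
rewrite (le_trans _ (hn n0 _))// ler_piMl ?(cnorm_ge0 cN)//; exact: ltW.
Qed.

(** The equation mu f - V f = g is the fixed point equation of f |-> (g + V f) / mu, a contraction
    of ratio d / |mu|. Linearity and boundedness of the inverse then follow from the lower bound
    [bel]. *)
Lemma blin_neumann V (d : R) (mu : C) : lin V -> 0 <= d ->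
  (forall f, N (V f) <= d * N f) -> d < normc mu ->
  exists2 U, blin N U &
    cancel (fun f => mu *: f - V f) U /\ cancel U (fun f => mu *: f - V f).
Proof.
move=> lV d0 bV dmu; have mu0 : 0 < normc mu by exact: le_lt_trans dmu.
have muN0 : mu != 0 by rewrite -normc_gt0.
have bel f : (normc mu - d) * N f <= N (mu *: f - V f).
  rewrite mulrBl lerBlDr -(cnormZ cN).
  rewrite (le_trans _ (lerD (lexx _) (bV f)))//.
  by rewrite -[leLHS](congr1 N (subrK (V f) _)) (cnormD cN).
have dm : 0 < normc mu - d by rewrite subr_gt0.
have inj f g : mu *: f - V f = mu *: g - V g -> f = g.
  move=> fg; apply/eqP; rewrite -subr_eq0; apply/eqP; apply: (cnorm_eq0 cN).
  have := bel (f - g).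
  rewrite scalerBr (linB lV) opprD addrACA -opprD fg subrr (cnorm0 cN).
  rewrite pmulr_rle0// => h; apply/eqP; rewrite eq_le h; exact: (cnorm_ge0 cN).
have sur g : {f | mu *: f - V f = g}.
  apply: cid; have [||f fE] := @cnorm_contraction (fun f => mu^-1 *: (g + V f)) (d / normc mu).
  - by rewrite divr_ge0 ?(ltW mu0)//= ltr_pdivrMr// mul1r.
  - move=> f h; rewrite -scalerBr (cnormZ cN) Normc.normcV mulrC mulrAC.
    rewrite opprD addrACA subrr add0r -(linB lV) ler_wpM2r ?invr_ge0 ?(ltW mu0)//.
  by exists f; rewrite -[in mu *: f]fE scalerA divff// scale1r addrK.
pose U g := sval (sur g).
have UE g : mu *: U g - V (U g) = g := svalP (sur g).
exists U; last by split=> g //; apply: (inj); rewrite UE.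
split=> [a f g|].
  apply: (inj); rewrite UE lV.
  by rewrite scalerDr opprD addrACA UE scalerA mulrC -scalerA -scalerBr UE.
exists (normc mu - d)^-1; first by rewrite invr_ge0 ltW.
by move=> f; rewrite mulrC ler_pdivlMr// mulrC (le_trans (bel _))// UE.
Qed.

Lemma almost_inv_sub V K A (d : R) (mu : C) : lin V -> 0 <= d ->
  (forall f, N (V f) <= d * N f) -> fin_rank N K -> (forall f, A f = V f + K f) ->
  d < normc mu -> almost_inv N (fun f => mu *: f - A f).
Proof.
move=> lV d0 bV fK AE dmu; have [U bU UE] := blin_neumann lV d0 bV dmu.
exists (fun f => mu *: f - V f), U, K; split => //.
  apply: blin_sub => //; last by split => //; exists d.
  exact: (blin_scale cN mu (blin_id N)).
by move=> f; rewrite AE opprD addrA.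
Qed.

End AlmostInvertible.

(** * Spectral splitting of an operator with a power close to finite rank *)

Section QuasiCompactSplitting.
Variables (R : realType) (X : lmodType R[i]) (N : X -> R).
Local Notation C := R[i].
Local Notation normc := (@Normc.normc R).
Hypothesis cN : complete_norm N.
Variables (T V K : X -> X) (p : nat) (rho d : R).
Hypotheses (bT : blin N T) (p0 : (0 < p)%N) (rho0 : 0 < rho).
Hypotheses (lV : lin V) (d0 : 0 <= d) (bV : forall f, N (V f) <= d * N f).
Hypotheses (d8 : 8 * d <= rho ^+ p) (fK : fin_rank N K).
Hypothesis TE : forall f, iter p T f = V f + K f.

Local Notation A := (iter p T).

(** Only the power [iter p T] is small up to finite rank, so the factors are l^p - T^p instead of l
    - T; [lin_div_power] leads back from one to the other. *)
Definition pow_factor (l : C) (f : X) := l ^+ p *: f - A f.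
Definition pow_factors (s : seq C) (f : X) := foldr pow_factor f s.

Local Notation D := pow_factor.
Local Notation G := pow_factors.

Let bA : blin N A. Proof. exact: blin_iter. Qed.
Let lT : lin T := blin_lin bT.
Let lA : lin A := blin_lin bA.

Lemma pow_factor_lin l : lin (D l).
Proof.
by move=> a f g; rewrite /D lA scalerDr scalerBr opprD addrACA !scalerA [a * _]mulrC.
Qed.

Lemma pow_factors_lin s : lin (G s).
Proof. by elim: s => [//|l s IH] a f g; rewrite /= IH pow_factor_lin. Qed.

Lemma pow_factor_comm l f : D l (T f) = T (D l f).
Proof. by rewrite /D (linB lT) (linZ lT) -iterSr iterS. Qed.

Lemma pow_factors_comm s f : G s (T f) = T (G s f).
Proof. by elim: s => [//|l s IH]; rewrite /= IH pow_factor_comm. Qed.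

Lemma pow_factors_iter_comm s n f : G s (iter n T f) = iter n T (G s f).
Proof. by elim: n => [//|n IH]; rewrite !iterS pow_factors_comm IH. Qed.

Lemma pow_factor_pow_factors l s f : D l (G s f) = G s (D l f).
Proof.
by rewrite {2}/D (linB (@pow_factors_lin s)) (linZ (@pow_factors_lin s)) pow_factors_iter_comm.
Qed.

Lemma pow_factors_swap s t f : G s (G t f) = G t (G s f).
Proof. by elim: s => [//|l s IH]; rewrite /= IH pow_factor_pow_factors. Qed.

Definition roots_ge (r : R) (s : seq C) := all (fun l => r <= normc l) s.

Lemma roots_geW r r' s : r' <= r -> roots_ge r s -> roots_ge r' s.
Proof. by move=> rr'; apply: sub_all => l; apply: le_trans. Qed.

Lemma pow_factor_almost_inv l : rho <= normc l -> almost_inv N (D l).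
Proof.
move=> rl; apply: (almost_inv_sub cN lV d0 bV fK TE); rewrite normcX.
apply: (@lt_le_trans _ _ (rho ^+ p)); last first.
  by rewrite lerXn2r ?nnegrE ?normc_ge0 ?(ltW rho0).
have r0 : 0 < rho ^+ p by exact: exprn_gt0.
by move: r0 d8 d0; lra.
Qed.

Lemma pow_factors_almost_inv s : roots_ge rho s -> almost_inv N (G s).
Proof.
elim: s => [_|l s IH /= /andP[rl rs]]; first exact: almost_inv_id.
by have := almost_inv_comp cN (pow_factor_almost_inv rl) (IH rs).
Qed.

(** Read from the tail, every new factor strictly enlarges the kernel of the product. The same [l]
    may be repeated, so that generalized eigenvectors count as well. *)
Fixpoint strict_chain (s : seq C) : Prop :=
  if s is l :: s' then strict_chain s' /\ exists f, D l (G s' f) = 0 /\ G s' f <> 0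
  else True.

Definition separated (f g : X) := rho ^+ p / 2 <= N (A f - A g).

(** Riesz's lemma along the chain: the new kernel contains a unit vector [x] at distance at least
    1/2 from the old one. For [z] in the old kernel, both [D l x] and [A z] lie there too, so A x -
    A z is l^p times the difference of [x] and an element of the old kernel. *)
Lemma riesz_sequence s : roots_ge rho s -> strict_chain s ->
  exists xs : seq X, [/\ size xs = size s,
    forall x, x \in xs -> N x = 1 /\ G s x = 0 & pairwise separated xs].
Proof.
elim: s => [_ _|l s IH]; first by exists [::].
move=> /= /andP[rl rs] [/(IH rs)[xs [sxs xsP pxs]] [y [Dy Gy]]].
have bG : blin N (G s) by apply: almost_inv_blin => //; exact: pow_factors_almost_inv.
have [lG [M M0 bM]] := bG.
pose S : set R := [set N (y - u) | u in [set u | G s u = 0]].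
have S0 : S !=set0 by exists (N (y - 0)), 0 => //=; rewrite (lin0 lG).
have Slb u : G s u = 0 -> inf S <= N (y - u).
  move=> Gu; apply: ge_inf; last by exists u.
  by exists 0 => _ [v _ <-]; exact: cnorm_ge0.
have Gy0 : 0 < N (G s y).
  rewrite lt_neqAle (cnorm_ge0 cN) andbT eq_sym; apply/eqP => /(cnorm_eq0 cN).
  exact: Gy.
have M1 : 0 < M.
  rewrite lt_neqAle M0 andbT; apply/eqP => ME; have := bM y.
  by rewrite -ME mul0r leNgt Gy0.
have dS : 0 < inf S.
  apply: (@lt_le_trans _ _ (N (G s y) / M)); first exact: divr_gt0.
  apply: lb_le_inf => // _ [u Gu <-]; rewrite ler_pdivrMr// mulrC.
  by rewrite (le_trans _ (bM _))// (linB lG) Gu subr0.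
(* The constant 1/2 comes from missing the infimum of the distances by a factor less than 2. *)
have [_ [u Gu <-] uS] : exists2 r, S r & r < inf S * 2.
  by apply: inf_lt => //; rewrite ltr_pMr// ltr1n.
pose t := N (y - u); have t0 : 0 < t by rewrite (lt_le_trans dS)// Slb.
pose x := ((t^-1)%:C)%C *: (y - u).
have nt : normc ((t^-1)%:C)%C = t^-1 by rewrite normc_real ger0_norm// invr_ge0 ltW.
have Nx : N x = 1 by rewrite (cnormZ cN) nt -/t mulVf// gt_eqF.
have lD := @pow_factor_lin l.
have Gx : D l (G s x) = 0.
  by rewrite (linZ lG) (linB lG) Gu subr0 (linZ lD) Dy scaler0.
have far v : G s v = 0 -> 1 / 2 <= N (x - v).
  move=> Gv; have -> : x - v = ((t^-1)%:C)%C *: (y - (u + (t%:C)%C *: v)).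
    rewrite opprD addrA scalerBr scalerA -rmorphM/= mulVf ?gt_eqF// rmorph1.
    by rewrite scale1r.
  rewrite (cnormZ cN) nt [t^-1 * _]mulrC ler_pdivlMr//.
  apply: (@le_trans _ _ (inf S)); last first.
    by apply: Slb; rewrite (linD lG) (linZ lG) Gu Gv scaler0 addr0.
  by move: uS; rewrite -/t; lra.
clearbody x.
exists (x :: xs); split => /=; first by rewrite sxs.
- move=> z; rewrite inE => /orP[/eqP->//|/xsP[-> Gz]]; split => //.
  by rewrite Gz (lin0 lD).
- rewrite pxs andbT; apply/allP => z /xsP[_ Gz].
  have lp : rho ^+ p <= normc (l ^+ p).
    by rewrite normcX lerXn2r ?nnegrE ?normc_ge0 ?(ltW rho0).
  have l0 : 0 < normc (l ^+ p) by rewrite (lt_le_trans _ lp)// exprn_gt0.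
  have lN0 : l ^+ p != 0 by rewrite -normc_gt0.
  rewrite /separated; have -> : A x - A z = l ^+ p *: (x - (l ^+ p)^-1 *: (D l x + A z)).
    rewrite scalerBr scalerA divff// scale1r /D opprD opprB addrA.
    by rewrite [l ^+ p *: x + _]addrC subrK.
  rewrite (cnormZ cN).
  apply: (@le_trans _ _ (normc (l ^+ p) * (1 / 2))).
    by rewrite mul1r ler_pM2r ?invr_gt0.
  rewrite ler_wpM2l ?normc_ge0// far// (linZ lG) (linD lG) pow_factors_iter_comm Gz.
  by rewrite (lin0 lA) addr0 -pow_factor_pow_factors Gx scaler0.
Qed.

Lemma pigeonhole_seq (Y : eqType) (W : finType) (F : Y -> W) (rel : rel Y) (xs : seq Y) :
  pairwise rel xs -> (#|W| < size xs)%N ->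
  exists x y, [/\ x \in xs, y \in xs, rel x y & F x = F y].
Proof.
case: xs => [//|x0 xs]; set l := x0 :: xs => /(pairwiseP x0) pw sz.
have [/card_uniqP us|nu] := boolP (uniq (map F l)).
  have := max_card (mem (map F l)); rewrite us size_map leqNgt sz//.
have [i [j [ij jl E]]] : exists i j, [/\ (i < j)%N, (j < size l)%N & nth (F x0) (map F l) i = nth (F x0) (map F l) j].
  move/(uniqPn (F x0)): nu => [i [j [ij jl E]]]; exists i, j; split => //.
  by rewrite size_map in jl.
have il := ltn_trans ij jl.
exists (nth x0 l i), (nth x0 l j); split; rewrite ?mem_nth//; first exact: pw.
by rewrite -(nth_map x0 (F x0))// -(nth_map x0 (F x0) F jl).
Qed.

Definition grid_cell k (M e : R) (t : R) : 'I_k.+1 := inord (Num.trunc ((t + M) / e)).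

Lemma grid_cellP (M e : R) : 0 <= M -> 0 < e -> exists k, forall t u,
  `|t| <= M -> `|u| <= M -> grid_cell k M e t = grid_cell k M e u -> `|t - u| <= e.
Proof.
move=> M0 e0; exists (Num.trunc ((M + M) / e)) => t u tM uM.
have h v : `|v| <= M -> (Num.trunc ((v + M) / e) <= Num.trunc ((M + M) / e))%N.
  by move=> /ler_normlP[v1 v2]; apply: le_truncn; rewrite ler_pM2r ?invr_gt0// lerD2r.
have h0 v : `|v| <= M -> 0 <= (v + M) / e.
  by move=> /ler_normlP[v1 v2]; rewrite divr_ge0 ?(ltW e0)//; lra.
move=> /(congr1 val); rewrite /grid_cell /= !inordK ?ltnS ?h// => tu.
have := trunc_itv (h0 _ tM); have := trunc_itv (h0 _ uM); rewrite tu.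
set n := Num.trunc _; move=> /andP[u1 u2] /andP[t1 t2].
move: u1 u2 t1 t2; rewrite !ler_pdivlMr// !ltr_pdivrMr// => u1 u2 t1 t2.
by rewrite ler_norml; move: u1 u2 t1 t2; rewrite -natr1 mulrDl mul1r; lra.
Qed.

(** If a Riesz sequence were longer than the number of grid cells for the coordinates [c], two of
    its vectors would share a cell. Then [V] would separate them by at most 2 d <= rho^p / 4 and [K]
    by less than rho^p / 8, against the rho^p / 2 between their images under [A]. *)
Lemma strict_chain_bounded : exists n, forall s,
  roots_ge rho s -> strict_chain s -> (size s <= n)%N.
Proof.
have [r [c [e [lc [M M0 bc] KE]]]] := fK.
have rp : 0 < rho ^+ p by exact: exprn_gt0.
pose B := \sum_i N (e i); have B0 : 0 <= B by apply: sumr_ge0 => i _; exact: cnorm_ge0.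
(* Two vectors in one cell have coordinates within 2 [eta] in modulus, so [K] separates them by at
   most 2 [eta] [B] < rho^p / 8; the + 1 covers the case B = 0. *)
pose eta := rho ^+ p / (16 * (B + 1)).
have B1 : 0 < 16 * (B + 1) by rewrite mulr_gt0// ltr_wpDl.
have eta0 : 0 < eta by rewrite divr_gt0.
have [k kP] := grid_cellP M0 eta0.
pose F (x : X) := [ffun i : 'I_r => (grid_cell k M eta (complex.Re (c x 0 i)),
                                    grid_cell k M eta (complex.Im (c x 0 i)))].
exists #|{ffun 'I_r -> 'I_k.+1 * 'I_k.+1}| => s rs ss.
have [xs [<- xsP pxs]] := riesz_sequence rs ss.
rewrite leqNgt; apply/negP => /(pigeonhole_seq F pxs)[x [y [/xsP[Nx _] /xsP[Ny _]]]].
rewrite /separated => sxy Fxy.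
have bc1 z : N z = 1 -> forall i, normc (c z 0 i) <= M.
  by move=> Nz i; rewrite (le_trans (bc _ _))// Nz mulr1.
have cxy i : normc (c x 0 i - c y 0 i) <= 2 * eta.
  rewrite (le_trans (normc_le_ReIm _))// mulr_natl mulr2n lerD//.
    rewrite [complex.Re _]raddfB/=; apply: kP.
    - by rewrite (le_trans (le_Re_normc _)) ?bc1.
    - by rewrite (le_trans (le_Re_normc _)) ?bc1.
    - by have := congr1 (fun f : {ffun _} => (f i).1) Fxy; rewrite !ffunE.
  rewrite [complex.Im _]raddfB/=; apply: kP.
  - by rewrite (le_trans (le_Im_normc _)) ?bc1.
  - by rewrite (le_trans (le_Im_normc _)) ?bc1.
  - by have := congr1 (fun f : {ffun _} => (f i).2) Fxy; rewrite !ffunE.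
have Kxy : N (K x - K y) <= 2 * eta * B.
  rewrite !KE -sumrB (le_trans (cnorm_sum cN _ _ _))// mulr_sumr ler_sum// => i _.
  by rewrite -scalerBl (cnormZ cN) ler_wpM2r// (cnorm_ge0 cN).
have Vxy : N (V x - V y) <= 2 * d.
  rewrite -(linB lV) (le_trans (bV _))// mulrC ler_wpM2r//.
  by rewrite (le_trans (cnormB cN _ _))// Nx Ny.
have etaB : 2 * eta * B < rho ^+ p / 8.
  rewrite /eta; have -> : 2 * (rho ^+ p / (16 * (B + 1))) * B = rho ^+ p / 8 * (B / (B + 1)).
    by field; rewrite gt_eqF// ltr_wpDl.
  by rewrite gtr_pMr ?divr_gt0// ltr_pdivrMr ?mul1r ?ltrDl// ltr_wpDl.
have : N (A x - A y) <= 2 * eta * B + 2 * d.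
  by rewrite !TE opprD addrACA addrC (le_trans (cnormD cN _ _))// lerD.
by move: d8 rp etaB sxy; lra.
Qed.

(** Induction on a bound for the chain lengths, by bisection: either the chains with roots beyond
    the midpoint obey a smaller bound, and the argument moves to the upper half, or a chain of
    maximal length already has all its roots there. The resulting gap replaces the choice of a
    circle avoiding the spectrum. *)
Lemma maximal_strict_chain (b : R) : rho < b -> exists r1 r2 s,
  [/\ rho <= r1, r1 < r2, r2 <= b, roots_ge r2 s & strict_chain s /\
      forall t, roots_ge r1 t -> strict_chain t -> (size t <= size s)%N].
Proof.
have [n hn] := strict_chain_bounded => rb.
suff : forall k a, rho <= a -> a < b ->
    (forall s, roots_ge a s -> strict_chain s -> (size s <= k)%N) ->
    exists r1 r2 s, [/\ rho <= r1, r1 < r2, r2 <= b, roots_ge r2 s & strict_chain s /\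
      forall t, roots_ge r1 t -> strict_chain t -> (size t <= size s)%N].
  by move=> /(_ n rho (lexx _) rb hn).
elim=> [|k IH] a rhoa ab an.
  by exists a, b, [::]; split.
pose m := (a + b) / 2.
have am : a < m by rewrite /m ltr_pdivlMr//; move: ab; lra.
have mb : m < b by rewrite /m ltr_pdivrMr//; move: ab; lra.
have [|/existsNP[s /not_implyP[rs /not_implyP[ss /negP]]]] :=
    pselect (forall s, roots_ge m s -> strict_chain s -> (size s <= k)%N).
  by apply: IH => //; rewrite (le_trans rhoa)// ltW.
rewrite -ltnNge => ks; exists a, m, s; split => //; first exact: ltW.
by split => // t rt st; rewrite (leq_trans (an t rt st)).
Qed.

(** [Z] is the geometric sum of the l^i T^(p-1-i), built by the recursion from [Z] to l^n + T Z. *)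
Lemma lin_div_power (l : C) : exists2 Z, blin N Z &
  (forall f, D l f = l *: Z f - T (Z f)) /\ (forall f, Z (T f) = T (Z f)).
Proof.
rewrite /D; elim: p => [|n [Z bZ [ZE ZT]]].
  exists (fun=> 0); first exact: blin_zero.
  by split=> f; rewrite (lin0 lT)// expr0 scale1r scaler0 !subrr.
exists (fun f => l ^+ n *: f + T (Z f)).
  apply: blin_add => //; first exact: blin_scale (blin_id N).
  exact: blin_comp.
split=> f; last by rewrite (linD lT) (linZ lT) ZT.
have E : iter n T f = l ^+ n *: f - (l *: Z f - T (Z f)).
  by rewrite -ZE opprB addrC subrK.
rewrite iterS E !(linD lT) !(linN lT) !(linB lT) !(linZ lT).
rewrite scalerDr scalerA -exprS !opprD !opprK -!addrA; congr (_ + _).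
by rewrite addrCA.
Qed.

(** [F] is the kernel and [H] the image of [G s] for a maximal chain [s]. By maximality no factor
    with |l| >= r1 enlarges the kernel any more: applied to the roots of [s], this makes the kernels
    of [G s] and of its square equal, hence the direct sum; applied to an eigenvalue with |l| >= r1,
    it puts the eigenvectors into [F], so l - T is injective on [H]. *)
Theorem quasi_compact_splitting (b : R) : rho < b -> exists r1 r2 F H,
  [/\ [/\ 0 <= r1, r1 < r2 & r2 <= b], [/\ is_subspace F, is_subspace H,
      F `&` H = [set 0] & forall f, exists g h, [/\ F g, H h & f = g + h]],
      invariant_by T F /\ invariant_by T H,
      closed_in N setT H /\ (forall l, r1 <= normc l -> resolvent_set N H T l) &
      finite_dimensional F /\ forall l f, F f -> f <> 0 -> T f = l *: f -> r2 <= normc l].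
Proof.
move=> /maximal_strict_chain[r1 [r2 [s [rr1 r12 r2b rs [ss smax]]]]].
have rs1 : roots_ge r1 s by apply: roots_geW rs; exact: ltW.
have kerD l f : r1 <= normc l -> D l (G s f) = 0 -> G s f = 0.
  move=> rl Df; apply: contrapT => Gf.
  have : (size (l :: s) <= size s)%N by apply: smax => /=; [rewrite rl | split=> //; exists f].
  by rewrite ltnn.
have kerG t f : roots_ge r1 t -> G t (G s f) = 0 -> G s f = 0.
  elim: t f => [//|l t IH] f /= /andP[rl rt].
  by rewrite pow_factors_swap => /(kerD _ _ rl); rewrite pow_factors_swap => /(IH _ rt).
have lG := @pow_factors_lin s.
have aG t : roots_ge r1 t -> almost_inv N (G t).
  by move=> rt; apply: pow_factors_almost_inv; apply: roots_geW rt.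
have [q [phi [S [[lphi [M M0 bphi]] phiG bS GS split_phi]]]] := almost_inv_image cN (aG _ rs1).
have dec f : exists2 g, G s g = 0 & phi (f - g) = 0.
  by apply: split_phi => g; exact: kerG.
pose F : set X := [set f | G s f = 0]; pose H : set X := [set f | phi f = 0].
have FH f : F f -> H f -> f = 0.
  by move=> Ff /GS Hf; rewrite -Hf; apply: (kerG s) => //; rewrite Hf.
have HT f : H f -> H (T f).
  by move=> /GS <-; rewrite /H /= -pow_factors_comm phiG.
have eigF l f : r1 <= normc l -> T f = l *: f -> F f.
  move=> rl Tf; apply: (kerD l) => //; rewrite pow_factor_pow_factors.
  have -> : D l f = 0; last by rewrite (lin0 lG).
  suff -> : D l f = 0 by [].
  have AE n : iter n T f = l ^+ n *: f.
    elim: n => [|n IH]; first by rewrite expr0 scale1r.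
    by rewrite iterS IH (linZ lT) Tf scalerA -exprSr.
  by rewrite /D AE subrr.
exists r1, r2, F, H; split.
- by split => //; rewrite (le_trans _ rr1)// ltW.
- split.
  + split; first by rewrite inE /F/= (lin0 lG).
    by move=> a f g; rewrite !inE /F/= lG => -> ->; rewrite scaler0 addr0.
  + split; first by rewrite inE /H/= (lin0 lphi).
    by move=> a f g; rewrite !inE /H/= lphi => -> ->; rewrite scaler0 addr0.
  + apply/seteqP; split => [f [Ff Hf]|_ ->]; first exact: FH.
    by split; rewrite /F /H/= ?(lin0 lG) ?(lin0 lphi).
  + by move=> f; have [g Fg Hg] := dec f; exists g, (f - g); split => //; rewrite addrC subrK.
- by split => // f Ff; rewrite /F/= pow_factors_comm Ff (lin0 lT).
- split.
    move=> f _ clf; rewrite /H/=; apply/rowP => i; rewrite mxE.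
    apply: Normc.eq0_normc; apply/eqP; rewrite eq_le normc_ge0 andbT.
    apply/ler_addgt0Pr => e e0; rewrite add0r.
    have [|h Hh fh] := clf (e / (M + 1)); first by rewrite divr_gt0// ltr_wpDl.
    have -> : phi f 0 i = phi (f - h) 0 i by rewrite (linB lphi) Hh subr0.
    rewrite (le_trans (bphi _ _))// (@le_trans _ _ ((M + 1) * N (f - h)))//.
      by rewrite ler_wpM2r ?lerDl// (cnorm_ge0 cN).
    by rewrite mulrC -ler_pdivlMr ?ltW// ltr_wpDl.
  move=> l rl.
  have rls : roots_ge r1 (l :: s) by rewrite /= rl.
  have [q' [psi [S' [[lpsi _] psiG bS' GS' split_psi]]]] := almost_inv_image cN (aG _ rls).
  have kerls g : G (l :: s) g = 0 -> F g by exact: (kerD l g rl).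
  (* [H] lies in the image of the longer product [G (l :: s)]: the splitting for that product writes
     f = g + (f - g) with g in [F] and f - g in [H], which forces g = 0. *)
  have psi0 f : H f -> psi f = 0.
    move=> Hf; have [|g /kerls Fg psig] := split_psi _ f.
      move=> g /(kerD l _ rl) h.
      have /(kerG (l :: s) g rls) Gg : G (l :: s) (G s g) = 0.
        by rewrite /= pow_factor_pow_factors.
      by rewrite /= Gg (lin0 (@pow_factor_lin l)).
    have Hg : H (f - g).
      rewrite -(GS' _ psig) /H/= -/(G s) pow_factor_pow_factors; exact: phiG.
    have g0 : g = 0.
      apply: FH => //; rewrite /H/= -[g](subKr f) (linB lphi) Hf Hg subrr//.
    by move: psig; rewrite g0 subr0.
  have [Z bZ [ZE ZT]] := lin_div_power l.
  (* Since l^p - T^p = (l - T) Z and [S' f] is a preimage of [f] under (l^p - T^p) G s, the vector G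
     s (Z (S' f)) solves (l - T) u = f, and it belongs to [H] as a value of [G s]. *)
  pose U := G s \o Z \o S'.
  have lUE f : H f -> l *: U f - T (U f) = f.
    move=> Hf; rewrite -[RHS](GS' _ (psi0 _ Hf)) /U /= pow_factor_pow_factors ZE.
    by rewrite (linB lG) (linZ lG) pow_factors_comm.
  have bU : blin N U.
    by apply: blin_comp => //; apply: blin_comp => //; exact/almost_inv_blin/aG.
  have [_ [MU _ bMU]] := bU.
  exists U; split => //.
  + by move=> f Hf; rewrite /H /U /= phiG.
  + by exists MU => f _.
  + move=> f Hf; apply/eqP; rewrite -subr_eq0; apply/eqP/FH; last first.
      by rewrite /H/= (linB lphi) Hf subr0 /U/= phiG.
    apply: (eigF l) => //; apply/eqP; rewrite eq_sym -subr_eq0; apply/eqP.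
    rewrite (linB lT) scalerBr opprD addrACA -opprD lUE ?subrr//.
    rewrite /H/= (linB lphi) (linZ lphi) Hf HT// scaler0 subr0//.
- split; first exact: almost_inv_ker (aG _ rs1).
  move=> l f Ff f0 Tf.
  have AE n : iter n T f = l ^+ n *: f.
    elim: n => [|n IH]; first by rewrite expr0 scale1r.
    by rewrite iterS IH (linZ lT) Tf scalerA -exprSr.
  (* On an eigenvector the product acts by a scalar; membership in [F] makes it vanish for [s], so
     l^p = m^p for some root m of the chain and |l| = |m|. *)
  have GE t : G t f = (\prod_(m <- t) (m ^+ p - l ^+ p)) *: f.
    elim: t => [|m t IH]; first by rewrite big_nil scale1r.
    by rewrite /= IH (linZ (@pow_factor_lin m)) /D AE -scalerBl big_cons scalerA mulrC.
  move: Ff; rewrite /F /= GE => /eqP; rewrite scaler_eq0 => /orP[|/eqP//].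
  rewrite prodf_seq_eq0 => /hasP[m ms /=]; rewrite subr_eq0 => /eqP ml.
  have rm : r2 <= normc m by have /allP := rs; apply.
  have : normc m ^+ p = normc l ^+ p by rewrite -!normcX ml.
  by move=> /eqP; rewrite eqrXn2 ?normc_ge0// => /eqP <-.
Qed.

End QuasiCompactSplitting.

(** * Words in two operators and their finite-rank part *)

Section PowerDecomposition.
Variables (R : realType) (X : lmodType R[i]) (N : X -> R).
Hypothesis cN : complete_norm N.

Definition fin_rank_limit (K : X -> X) := blin N K /\
  forall e, 0 < e -> exists2 K', fin_rank N K' & forall f, N (K f - K' f) <= e * N f.

Lemma fin_rank_limit_zero : fin_rank_limit (fun=> 0).
Proof.
split; first exact: blin_zero.
move=> e e0; exists (fun=> 0); first exact: fin_rank_zero.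
by move=> f; rewrite subrr (cnorm0 cN) mulr_ge0 ?(cnorm_ge0 cN)// ltW.
Qed.

Lemma fin_rank_limit_add K L :
  fin_rank_limit K -> fin_rank_limit L -> fin_rank_limit (fun f => K f + L f).
Proof.
move=> [bK hK] [bL hL]; split; first exact: blin_add.
move=> e e0; have e2 : 0 < e / 2 by rewrite divr_gt0.
have [K' fK' KK'] := hK _ e2; have [L' fL' LL'] := hL _ e2.
exists (fun f => K' f + L' f); first exact: fin_rank_add.
move=> f; rewrite opprD addrACA (le_trans (cnormD cN _ _))//.
by rewrite [e]splitr mulrDl lerD.
Qed.

Lemma fin_rank_limit_comp_l A K : blin N A -> fin_rank_limit K -> fin_rank_limit (A \o K).
Proof.
move=> bA [bK hK]; split; first exact: blin_comp.
have [lA [M M0 bM]] := bA.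
have M1 : 0 < M + 1 by rewrite ltr_wpDl.
move=> e e0; have [K' fK' KK'] := hK (e / (M + 1)) (divr_gt0 e0 M1).
exists (A \o K'); first exact: fin_rank_comp_l.
move=> f /=; rewrite -(linB lA) (le_trans (bM _))//.
rewrite (@le_trans _ _ ((M + 1) * N (K f - K' f)))//.
  by rewrite ler_wpM2r ?lerDl// (cnorm_ge0 cN).
rewrite (le_trans (ler_wpM2l (ltW M1) (KK' _)))//.
by rewrite mulrA mulrCA divff ?mulr1// gt_eqF.
Qed.

Lemma fin_rank_limit_comp_r A K : blin N A -> fin_rank_limit K -> fin_rank_limit (K \o A).
Proof.
move=> bA [bK hK]; split; first exact: blin_comp.
have [lA [M M0 bM]] := bA.
have M1 : 0 < M + 1 by rewrite ltr_wpDl.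
move=> e e0; have [K' fK' KK'] := hK (e / (M + 1)) (divr_gt0 e0 M1).
exists (K' \o A); first exact: fin_rank_comp_r.
move=> f /=; rewrite (le_trans (KK' _))// (@le_trans _ _ (e / (M + 1) * ((M + 1) * N f)))//.
  rewrite ler_wpM2l ?divr_ge0 ?(ltW e0) ?(ltW M1)// (le_trans (bM _))//.
  by rewrite ler_wpM2r ?lerDl// (cnorm_ge0 cN).
by rewrite mulrA divfK// gt_eqF.
Qed.

Lemma fin_rank_limit_eq K L : K =1 L -> fin_rank_limit K -> fin_rank_limit L.
Proof. by move=> /funext ->. Qed.

(** With s = sqrt q, the product n s^n is at most the sum of the s^k for k < n, hence at most 1 / (1
    - s); the second factor s^n provides the smallness. *)
Lemma affine_expr_small (q a b e : R) : 0 <= q < 1 -> 0 <= a -> 0 <= b -> 0 < e ->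
  exists2 n, (0 < n)%N & (a + b * n%:R) * q ^+ n <= e.
Proof.
move=> /andP[q0 q1] a0 b0 e0; pose s := Num.sqrt q.
have s0 : 0 <= s by exact: sqrtr_ge0.
have s1 : s < 1 by rewrite -[ltRHS]sqrtr1 ltr_sqrt.
have qE : q = s ^+ 2 by rewrite sqr_sqrtr.
have ns n : n%:R * s ^+ n <= (1 - s)^-1.
  rewrite -[leRHS]mul1r ler_pdivlMr ?subr_gt0//.
  apply: (@le_trans _ _ ((1 - s) * \sum_(k < n) s ^+ k)).
    rewrite mulrC ler_wpM2l ?subr_ge0 ?(ltW s1)// mulr_natl -[X in s ^+ n *+ X](card_ord n) -sumr_const.
    by apply: ler_sum => k _; rewrite ler_wiXn2l ?(ltW s1)// ltnW.
  rewrite -opprB mulNr -subrX1 opprB gerBl exprn_ge0//.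
have D0 : 0 < a + b / (1 - s) + 1.
  by rewrite ltr_wpDl// addr_ge0// mulr_ge0// invr_ge0 subr_ge0 ltW.
have [|n0 h] := @expr_small R s (e / (a + b / (1 - s) + 1)) _ (divr_gt0 e0 D0).
  by rewrite s0.
exists n0.+1 => //; set n := n0.+1.
have /= hn := h n (leqnSn _).
apply: (@le_trans _ _ ((a + b / (1 - s) + 1) * s ^+ n)); last by rewrite mulrC -ler_pdivlMr.
rewrite qE -exprM mulnC exprM expr2 mulrA ler_wpM2r ?exprn_ge0//.
rewrite (@le_trans _ _ (a + b / (1 - s)))// ?lerDl// mulrDl -mulrA lerD//.
  by rewrite ler_piMr// exprn_ile1// ltW.
by rewrite ler_wpM2l.
Qed.

Variables (S T : X -> X) (C sg : R).
Hypotheses (bS : blin N S) (bT : blin N T).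
Hypothesis TST : forall a, fin_rank_limit (T \o iter a S \o T).
Hypotheses (C0 : 0 <= C) (sg0 : 0 < sg).
Hypothesis bSn : forall n f, N (iter n S f) <= C * sg ^+ n * N f.

(* The words in [S] and [T] with exactly one letter [T], summed by length. *)
Fixpoint one_letter_words n (f : X) : X :=
  if n is m.+1 then S (one_letter_words m f) + T (iter m S f) else 0.

Local Notation Y := one_letter_words.
Local Notation P := (fun f => S f + T f).

Let bP : blin N P. Proof. exact: blin_add. Qed.

(** From Y_(n+1) = S Y_n + T S^n, the product T S^a Y_(n+1) is T S^(a+1) Y_n, covered by the
    induction since [a] is free, plus (T S^a T) S^n. *)
Lemma two_letter_words a n : fin_rank_limit (T \o iter a S \o Y n).
Proof.
elim: n a => [|n IH] a.
  apply: fin_rank_limit_eq fin_rank_limit_zero => f /=.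
  by rewrite (lin0 (blin_lin (blin_iter a bS))) (lin0 (blin_lin bT)).
have h := fin_rank_limit_add (IH a.+1) (fin_rank_limit_comp_r (blin_iter n bS) (TST a)).
apply: fin_rank_limit_eq h => f /=.
rewrite (linD (blin_lin (blin_iter a bS))) (linD (blin_lin bT)).
by rewrite -iterSr -iterS.
Qed.

(** P (S^n + Y_n) = S^(n+1) + Y_(n+1) + T Y_n, so the words with at least two letters [T] enter
    through T Y_n and add up to a limit of finite-rank operators. The remaining S^n + Y_n has norm
    at most (C + D n) sg^n. *)
Lemma power_decomposition (t : R) : sg < t -> exists n V K d,
  [/\ (0 < n)%N, lin V, 0 <= d /\ forall f, N (V f) <= d * N f,
      8 * d <= t ^+ n /\ fin_rank N K & forall f, iter n P f = V f + K f].
Proof.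
move=> sgt; have t0 : 0 < t := lt_trans sg0 sgt.
have [_ [B B0 bB]] := bT.
have opprD_K (b e g : X) : b - (e + g) + g = b - e by rewrite opprD addrA subrK.
have PE n : fin_rank_limit (fun f => iter n P f - (iter n S f + Y n f)).
  elim: n => [|n IH].
    by apply: fin_rank_limit_eq fin_rank_limit_zero => f /=; rewrite addr0 subrr.
  have h := fin_rank_limit_add (fin_rank_limit_comp_l bP IH) (two_letter_words 0 n).
  apply: fin_rank_limit_eq h => f.
  have lS := blin_lin bS; have lT := blin_lin bT.
  rewrite /= !(linB lS) !(linB lT) !(linD lS) !(linD lT).
  by rewrite -addrA opprD_K addrACA -opprD; congr (_ - _); rewrite addrA.
(* A word S^a T S^b with a + b = n - 1 has norm at most B C^2 sg^(n-1); dividing by [sg] restores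
   the exponent n. *)
pose D := B * C ^+ 2 / sg.
have D0 : 0 <= D by rewrite divr_ge0 ?mulr_ge0 ?exprn_ge0 ?(ltW sg0).
have bY n a f : N (iter a S (Y n f)) <= D * n%:R * sg ^+ (a + n) * N f.
  elim: n a => [|n IH] a.
    rewrite /= (lin0 (blin_lin (blin_iter a bS))) (cnorm0 cN) mulr0 mul0r.
    by rewrite mul0r.
  rewrite /= (linD (blin_lin (blin_iter a bS))) (le_trans (cnormD cN _ _))//.
  rewrite -iterSr -natr1 mulrDr mulr1 !mulrDl lerD//.
    by rewrite addnS -addSn; exact: IH.
  rewrite (le_trans (bSn _ _))//.
  apply: (@le_trans _ _ (C * sg ^+ a * (B * (C * sg ^+ n * N f)))).
    rewrite ler_wpM2l ?mulr_ge0 ?exprn_ge0 ?(ltW sg0)//.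
    by rewrite (le_trans (bB _))// ler_wpM2l.
  rewrite le_eqVlt; apply/orP; left; apply/eqP; rewrite /D addnS (exprS sg) exprD.
  by field; rewrite gt_eqF.
have q01 : 0 <= sg / t < 1 by rewrite divr_ge0 ?(ltW t0) ?(ltW sg0)//= ltr_pdivrMr// mul1r.
(* One sixteenth of t^n is spent on S^n + Y_n and one on the finite-rank approximation, so that d =
   t^n / 8. *)
have [||//|n n0 hn] := @affine_expr_small (sg / t) C D (16^-1) q01 => //.
have tn : 0 < t ^+ n / 16 by rewrite divr_gt0// exprn_gt0.
have [_ /(_ _ tn)[K fK hK]] := PE n.
pose V f := iter n P f - K f.
exists n, V, K, (t ^+ n / 16 + t ^+ n / 16); split => //.
- by have [] : blin N V by apply: blin_sub; [|exact: blin_iter|exact: fin_rank_blin].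
- split; first by rewrite addr_ge0 ?ltW.
  move=> f; rewrite mulrDl.
  have -> : V f = (iter n P f - (iter n S f + Y n f) - K f) + (iter n S f + Y n f).
    by rewrite addrAC subrK.
  rewrite (le_trans (cnormD cN _ _))// lerD// (le_trans (cnormD cN _ _))//.
  rewrite (le_trans (lerD (bSn n f) (bY n 0%N f)))// add0n -!mulrDl.
  rewrite ler_wpM2r ?(cnorm_ge0 cN)//.
  have -> : (C + D * n%:R) * sg ^+ n = (C + D * n%:R) * (sg / t) ^+ n * t ^+ n.
    by rewrite expr_div_n -mulrA divfK// gt_eqF// exprn_gt0.
  by rewrite [leRHS]mulrC ler_wpM2r// exprn_ge0// ltW.
- split => //; rewrite le_eqVlt; apply/orP; left; apply/eqP; by field.
- by move=> f; rewrite /V subrK.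
Qed.

End PowerDecomposition.

(** * Transfer to a subspace of an ambient vector space *)

Section SubspaceType.
Variables (R : realType) (V : lmodType R[i]) (B : set V).

(** The proof [sB] is an argument of the predicate so that closure under linear combinations can be
    attached to it as a canonical instance. *)
Definition subspace_pred (sB : is_subspace B) : {pred V} := fun f => f \in B.

Variable sB : is_subspace B.

HB.instance Definition _ := GRing.isSubmodClosed.Build R[i] V (subspace_pred sB)
  (GRing.submod_closed_semi (sB : GRing.submod_closed (subspace_pred sB))).

Record subspace_type := SubspaceType {
  subspace_val :> V; _ : subspace_val \in subspace_pred sB }.

HB.instance Definition _ := [isSub for subspace_val].
HB.instance Definition _ := [Choice of subspace_type by <:].
HB.instance Definition _ := [SubChoice_isSubLmodule of subspace_type by <:].

Lemma subspace_valP (x : subspace_type) : B x.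
Proof. by have := valP x; rewrite /subspace_pred => /set_mem. Qed.

Lemma subspace_valD (x y : subspace_type) : val (x + y) = val x + val y.
Proof. exact: raddfD. Qed.

Lemma subspace_val0 : val (0 : subspace_type) = 0.
Proof. exact: raddf0. Qed.

Lemma subspace_valN (x : subspace_type) : val (- x) = - val x.
Proof. exact: raddfN. Qed.

Lemma subspace_valZ a (x : subspace_type) : val (a *: x) = a *: val x.
Proof. exact: linearZ. Qed.

Lemma subspace_val_sum (I : Type) (r : seq I) (P : pred I) (F : I -> subspace_type) :
  val (\sum_(i <- r | P i) F i) = \sum_(i <- r | P i) val (F i).
Proof. exact: raddf_sum. Qed.

(** The default value 0 of [insubd] is never reached when [T] maps [B] into itself. *)
Definition restrict_op (T : V -> V) (x : subspace_type) : subspace_type :=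
  insubd 0 (T (val x)).

Lemma insubd_val f : B f -> val (insubd (0 : subspace_type) f) = f.
Proof. by move=> Bf; rewrite val_insubd /subspace_pred mem_set. Qed.

Lemma subspace_eq (x y : subspace_type) : val x = val y -> x = y.
Proof. exact: val_inj. Qed.

End SubspaceType.

Section OperatorsOnSubspace.
Variables (R : realType) (V : lmodType R[i]) (N : V -> R) (B : set V).
Local Notation C := R[i].
Local Notation normc := (@Normc.normc R).

Definition complete_norm_on :=
  [/\ forall f g, B f -> B g -> N (f + g) <= N f + N g,
      forall (a : C) f, B f -> N (a *: f) = normc a * N f,
      forall f, B f -> N f = 0 -> f = 0 &
      forall u : nat -> V, (forall n, B (u n)) ->
        (forall e, 0 < e -> exists n0, forall m n,
           (n0 <= m)%N -> (n0 <= n)%N -> N (u m - u n) <= e) ->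
        exists2 l, B l & forall e, 0 < e -> exists n0, forall n,
          (n0 <= n)%N -> N (u n - l) <= e].

Definition lin_on (Y : lmodType C) (T : V -> Y) :=
  forall a f g, B f -> B g -> T (a *: f + g) = a *: T f + T g.

Definition blin_on (T : V -> V) :=
  [/\ forall f, B f -> B (T f), lin_on T &
      exists2 M, 0 <= M & forall f, B f -> N (T f) <= M * N f].

Definition fin_rank_on (K : V -> V) := exists r (c : V -> 'rV[C]_r) (e : 'I_r -> V),
  [/\ forall i, B (e i), lin_on c,
      exists2 M, 0 <= M & forall f i, B f -> normc (c f 0 i) <= M * N f &
      forall f, B f -> K f = \sum_i c f 0 i *: e i].

Lemma spectral_radius_ge0 (H : set V) T : 0 <= spectral_radius N H T.
Proof.
rewrite /spectral_radius; set A := image _ _.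
have [[x Ax] |A0] := pselect (A !=set0); last first.
  by rewrite sup_out// => -[].
have [ub|nub] := pselect (has_ubound A); last by rewrite sup_out// => -[].
apply: (@le_trans _ _ x); last exact: ub_le_sup.
by case: Ax => l _ <-; exact: normc_ge0.
Qed.

Lemma spectral_radius_le (H : set V) T r : 0 <= r ->
  (forall l, r <= normc l -> resolvent_set N H T l) -> spectral_radius N H T <= r.
Proof.
move=> r0 h; rewrite /spectral_radius; set A := image _ _.
have [A0|A0] := pselect (A !=set0); last by rewrite sup_out// => -[].
apply: ge_sup => // _ [l sl <-]; rewrite leNgt; apply/negP => rl.
by apply: sl; apply: h; exact: ltW.
Qed.

Lemma ess_spectral_radius_le T (t : R) :
  (forall b, t < b -> exists rho F H, [/\ 0 <= rho, rho <= b & spectral_splitting N B T rho F H]) ->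
  ess_spectral_radius N B T <= t.
Proof.
move=> h; apply/ler_addgt0Pr => e e0; have [|rho [F [H [r0 rb sp]]]] := h (t + e).
  by rewrite ltrDl.
apply: le_trans rb; apply: ge_inf; last by right; split => //; exists F, H.
by exists 0 => x [->|[]//]; exact: spectral_radius_ge0.
Qed.

Hypotheses (cN : complete_norm_on) (sB : is_subspace B).
Local Notation X := (subspace_type sB).
Local Notation NX := (fun x : X => N (val x)).
Local Notation res := (@restrict_op R V B sB).

Let Bv (x : X) : B (val x) := subspace_valP x.

Lemma complete_norm_subspace : complete_norm NX.
Proof.
have [nD nZ n0 nc] := cN; split.
- by move=> f g; rewrite subspace_valD nD.
- by move=> a f; rewrite subspace_valZ nZ.
- by move=> f Nf; apply: subspace_eq; rewrite (n0 _ _ Nf)// raddf0.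
- move=> u uc; have [|l Bl ul] := nc (fun n => val (u n)) (fun n => Bv (u n)).
    move=> e /uc[k h]; exists k => m n km kn.
    by rewrite -subspace_valN -subspace_valD h.
  exists (insubd 0 l) => e /ul[k h]; exists k => n kn.
  by rewrite subspace_valD subspace_valN insubd_val// h.
Qed.

Lemma restrict_opE T x : blin_on T -> val (res T x) = T (val x).
Proof. by move=> [h _ _]; rewrite insubd_val//; exact: h. Qed.

Lemma iter_restrict_opE T n x : blin_on T -> val (iter n (res T) x) = iter n T (val x).
Proof. by move=> bT; elim: n => [//|n IH]; rewrite !iterS restrict_opE// IH. Qed.

Lemma restrict_op_blin T : blin_on T -> blin NX (res T).
Proof.
move=> bT; have [h lT [M M0 bM]] := bT; split.
  move=> a f g; apply: subspace_eq.
  by rewrite subspace_valD subspace_valZ !restrict_opE// subspace_valD subspace_valZ lT.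
by exists M => // f; rewrite restrict_opE// bM.
Qed.

Lemma restrict_op_fin_rank K : fin_rank_on K -> fin_rank NX (res K).
Proof.
move=> [r [c [e [Be lc [M M0 bM] KE]]]].
have KE' x : val (res K x) = \sum_i c (val x) 0 i *: e i.
  rewrite insubd_val ?KE//.
  have -> : \sum_i c (val x) 0 i *: e i = val (\sum_i c (val x) 0 i *: insubd (0 : X) (e i)).
    by rewrite subspace_val_sum; apply: eq_bigr => i _; rewrite subspace_valZ insubd_val.
  exact: Bv.
exists r, (fun x => c (val x)), (fun i => insubd 0 (e i)); split.
- by move=> a f g; rewrite subspace_valD subspace_valZ lc.
- by exists M => // f i; exact: bM.
- move=> f; apply: subspace_eq; rewrite KE' subspace_val_sum; apply: eq_bigr => i _.
  by rewrite subspace_valZ insubd_val.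
Qed.

Definition fin_rank_limit_on (K : V -> V) := forall e, 0 < e ->
  exists2 K', fin_rank_on K' & forall f, B f -> N (K f - K' f) <= e * N f.

Lemma restrict_op_fin_rank_limit K : blin_on K -> fin_rank_limit_on K ->
  fin_rank_limit NX (res K).
Proof.
move=> bK hK; split; first exact: restrict_op_blin.
move=> e /hK[K' fK' KK']; exists (res K'); first exact: restrict_op_fin_rank.
move=> f; rewrite subspace_valD subspace_valN restrict_opE//.
rewrite insubd_val ?KK'//.
move: fK' => [r [c [g [Bg _ _ ->]]]]//.
have -> : \sum_i c (val f) 0 i *: g i = val (\sum_i c (val f) 0 i *: insubd (0 : X) (g i)).
  by rewrite subspace_val_sum; apply: eq_bigr => i _; rewrite subspace_valZ insubd_val.
exact: Bv.
Qed.

Lemma blin_on_comp S T : blin_on S -> blin_on T -> blin_on (S \o T).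
Proof.
move=> [hS lS [M M0 bM]] [hT lT [P P0 bP]]; split.
- by move=> f /hT/hS.
- by move=> a f g Bf Bg /=; rewrite lT// lS//; exact: hT.
- exists (M * P); first exact: mulr_ge0.
  move=> f Bf /=; rewrite (le_trans (bM _ (hT _ Bf)))// -mulrA ler_wpM2l//.
  exact: bP.
Qed.

Lemma blin_on_iter T n : blin_on T -> blin_on (iter n T).
Proof.
move=> bT; elim: n => [|n IH]; first by split => //; exists 1 => // f; rewrite mul1r.
by have := blin_on_comp bT IH.
Qed.

(** Two intermediate radii t < b1 < b2 < b are inserted: the iterates of [S] grow more slowly than
    b1^m, so b1 can play the role of rho for the power n m of [T], and b2 bounds the radius of the
    splitting. *)
Theorem ess_spectral_radius_on_le (T S U : V -> V) (m : nat) (t : R) :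
  (0 < m)%N -> 0 <= t -> blin_on T -> blin_on S -> blin_on U ->
  (forall f, B f -> iter m T f = S f + U f) ->
  (forall a, fin_rank_limit_on (U \o iter a S \o U)) ->
  (forall b, t < b -> exists sg M, [/\ 0 <= M, 0 < sg, sg < b ^+ m &
     forall n f, B f -> N (iter n S f) <= M * sg ^+ n * N f]) ->
  ess_spectral_radius N B T <= t.
Proof.
move=> m0 t0 bT bS bU TSU USU bSn; apply: ess_spectral_radius_le => b tb.
pose b1 := (2 * t + b) / 3; pose b2 := (t + 2 * b) / 3.
have tb1 : t < b1 by rewrite /b1 ltr_pdivlMr//; lra.
have b12 : b1 < b2 by rewrite /b1 /b2 ltr_pM2r ?invr_gt0//; lra.
have b2b : b2 < b by rewrite /b2 ltr_pdivrMr//; lra.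
have b10 : 0 < b1 := le_lt_trans t0 tb1.
have [sg [M [M0 sg0 sgb hM]]] := bSn _ tb1.
have cX := complete_norm_subspace.
have bTX := restrict_op_blin bT.
have USUX a : fin_rank_limit NX (res U \o iter a (res S) \o res U).
  have bUSU := blin_on_comp (blin_on_comp bU (blin_on_iter a bS)) bU.
  apply: fin_rank_limit_eq (restrict_op_fin_rank_limit bUSU (USU a)) => x.
  apply: subspace_eq; rewrite [LHS]restrict_opE// [RHS]restrict_opE//=.
  by rewrite iter_restrict_opE// restrict_opE.
have bSX n f : NX (iter n (res S) f) <= M * sg ^+ n * NX f.
  by rewrite iter_restrict_opE// hM//; exact: Bv.
have [n [W [K [d [n0 lW [d0 bW] [d8 fK] PE]]]]] := power_decomposition cX
  (restrict_op_blin bS) (restrict_op_blin bU) USUX M0 sg0 bSX sgb.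
have iterE k f : iter (k * m) (res T) f = iter k (fun f => res S f + res U f) f.
  elim: k => [//|k IH]; rewrite mulSn iterD IH iterS; apply: subspace_eq.
  rewrite iter_restrict_opE// TSU; last exact: Bv.
  by rewrite subspace_valD !restrict_opE.
have TE f : iter (n * m) (res T) f = W f + K f by rewrite iterE PE.
have nm0 : (0 < n * m)%N by rewrite muln_gt0 n0.
have d8' : 8 * d <= b1 ^+ (n * m) by rewrite mulnC exprM.
have [r1 [r2 [F [H [[r10 r12 r2b] [sF sH FH dec] [iF iH] [clH resH] [fF eF]]]]]] :=
  quasi_compact_splitting cX bTX nm0 b10 lW d0 bW d8' fK TE b12.
have sub_image (G : set X) : is_subspace G -> is_subspace ((val : X -> V) @` G).
  move=> [G0 Gl]; split; first by rewrite inE; exists 0; rewrite ?subspace_val0//; exact: set_mem.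
  move=> a f g; rewrite !inE => -[x Gx <-] [y Gy <-]; exists (a *: x + y).
    by apply: set_mem; apply: Gl; exact: mem_set.
  by rewrite subspace_valD subspace_valZ.
have inv_image (G : set X) : invariant_by (res T) G -> invariant_by T ((val : X -> V) @` G).
  by move=> iG _ [x Gx <-]; exists (res T x); [exact: iG|rewrite restrict_opE].
(* The radius declared is [r2]: on [H] the spectral radius is at most r1 < r2, which is the strict
   inequality required, and on [F] the eigenvalues have modulus at least r2. *)
exists r2, (val @` F), (val @` H); split.
- by rewrite (le_trans r10)// ltW.
- by rewrite (le_trans r2b)// ltW.
split.
- by split; exact: sub_image.
- split.
  + by move=> _ [x _ <-]; exact: Bv.
  + by move=> _ [x _ <-]; exact: Bv.
  + apply/seteqP; split => [_ [[x Fx <-] [y Hy /subspace_eq xy]]|_ ->] /=.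
      have : (F `&` H) x by split => //; rewrite -xy.
      by rewrite FH /= => ->; rewrite subspace_val0.
    have [] : (F `&` H) 0 by rewrite FH.
    by move=> F0 H0; split; exists 0; rewrite ?subspace_val0.
  + move=> f Bf; have [g [h [Fg Hh E]]] := dec (insubd 0 f).
    exists (val g), (val h); split; [by exists g|by exists h|].
    by rewrite -subspace_valD -E insubd_val.
- by split; exact: inv_image.
- split.
    move=> f Bf clf; exists (insubd 0 f); last by rewrite insubd_val.
    apply: clH => // e /clf[_ [h Hh <-] fh]; exists h => //.
    by rewrite subspace_valD subspace_valN insubd_val.
  apply: (le_lt_trans _ r12); apply: spectral_radius_le => // l /resH[U' [h1 [P bP] h2 h3]].
  exists (fun f => val (U' (insubd 0 f))).
  have iK (x : X) : insubd 0 (val x) = x by apply: subspace_eq; rewrite insubd_val//; exact: Bv.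
  split.
  + by move=> _ [x Hx <-]; rewrite iK; exists (U' x) => //; exact: h1.
  + by exists P => _ [x Hx <-]; rewrite iK; exact: bP.
  + move=> _ [x Hx <-]; rewrite -(restrict_opE x bT) -(subspace_valZ l x).
    by rewrite -subspace_valN -subspace_valD iK h2.
  + move=> _ [x Hx <-]; rewrite /= iK -(restrict_opE _ bT) -(subspace_valZ l (U' x)).
    by rewrite -subspace_valN -subspace_valD h3.
- split.
    move: fF => [k [e he]]; exists k, (fun i => val (e i)) => _ [x /he[c ->] <-].
    exists c; rewrite subspace_val_sum; apply: eq_bigr => i _; exact: subspace_valZ.
  move=> l _ [x Fx <-] x0 Tx; apply: (eF l x) => //.
    by move=> xE; apply: x0; rewrite xE subspace_val0.
  by apply: subspace_eq; rewrite restrict_opE// subspace_valZ.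
Qed.

End OperatorsOnSubspace.

(** * Complex-valued functions and the space B_w *)

Section ComplexParts.
Variable R : realType.
Implicit Types x y : R[i].

Lemma ReD x y : complex.Re (x + y) = complex.Re x + complex.Re y.
Proof. by case: x y => a b [c d]. Qed.
Lemma ImD x y : complex.Im (x + y) = complex.Im x + complex.Im y.
Proof. by case: x y => a b [c d]. Qed.
Lemma ReN x : complex.Re (- x) = - complex.Re x.
Proof. by case: x. Qed.
Lemma ImN x : complex.Im (- x) = - complex.Im x.
Proof. by case: x. Qed.
Lemma ReM x y : complex.Re (x * y) =
  complex.Re x * complex.Re y - complex.Im x * complex.Im y.
Proof. by case: x y => a b [c d]. Qed.
Lemma ImM x y : complex.Im (x * y) =
  complex.Re x * complex.Im y + complex.Im x * complex.Re y.
Proof. by case: x y => a b [c d]. Qed.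
Lemma complex_eq x y : complex.Re x = complex.Re y -> complex.Im x = complex.Im y -> x = y.
Proof. by case: x y => a b [c d] /= -> ->. Qed.

End ComplexParts.

Section ComplexMeasurable.
Context {d} {X : measurableType d} {R : realType}.
Local Notation C := R[i].
Local Notation normc := (@Normc.normc R).
Implicit Types (f g : X -> C) (h : X -> R).

Lemma cmeasurable_cst (a : C) : cmeasurable (fun _ : X => a).
Proof. by split; exact: measurable_cst. Qed.

Lemma cmeasurable_real h : measurable_fun setT h -> cmeasurable (fun x => ((h x)%:C)%C).
Proof. by move=> mh; split => //=; exact: measurable_cst. Qed.

Lemma cmeasurableD f g : cmeasurable f -> cmeasurable g -> cmeasurable (fun x => f x + g x).
Proof.
move=> [f1 f2] [g1 g2]; split; under eq_fun do rewrite ?ReD ?ImD;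
exact: measurable_funD.
Qed.

Lemma cmeasurableN f : cmeasurable f -> cmeasurable (fun x => - f x).
Proof.
move=> [f1 f2]; split; under eq_fun do rewrite ?ReN ?ImN;
exact: measurableT_comp.
Qed.

Lemma cmeasurableB f g : cmeasurable f -> cmeasurable g -> cmeasurable (fun x => f x - g x).
Proof. by move=> mf /cmeasurableN; exact: cmeasurableD. Qed.

Lemma cmeasurableM f g : cmeasurable f -> cmeasurable g -> cmeasurable (fun x => f x * g x).
Proof.
move=> [f1 f2] [g1 g2]; split; under eq_fun do rewrite ?ReM ?ImM.
  by apply: measurable_funB; exact: measurable_funM.
by apply: measurable_funD; exact: measurable_funM.
Qed.

Lemma cmeasurable_sum (I : Type) (r : seq I) (F : I -> X -> C) :
  (forall i, cmeasurable (F i)) -> cmeasurable (fun x => \sum_(i <- r) F i x).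
Proof.
move=> mF; elim: r => [|i r IH].
  by under eq_fun do rewrite big_nil; exact: cmeasurable_cst.
by under eq_fun do rewrite big_cons; exact: cmeasurableD.
Qed.

Lemma measurable_normc f : cmeasurable f -> measurable_fun setT (fun x => normc (f x)).
Proof.
move=> [f1 f2].
rewrite (_ : (fun x => _) = (fun x => Num.sqrt (complex.Re (f x) ^+ 2 + complex.Im (f x) ^+ 2))).
  apply: (measurableT_comp (continuous_measurable_fun (@sqrt_continuous R))).
  by apply: measurable_funD; apply: measurable_funX.
by apply/funext => x; case: (f x).
Qed.

Lemma cmeasurable_eq f g : f =1 g -> cmeasurable f -> cmeasurable g.
Proof. by move=> /funext ->. Qed.

End ComplexMeasurable.

Lemma cmeasurable_comp {d d'} {X : measurableType d} {Y : measurableType d'} {R : realType}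
    (f : Y -> R[i]) (g : X -> Y) :
  cmeasurable f -> measurable_fun setT g -> cmeasurable (fun x => f (g x)).
Proof. by move=> [f1 f2] mg; split; [exact: (measurableT_comp f1)|exact: (measurableT_comp f2)]. Qed.

(** * Integration of complex-valued functions *)

Section ComplexIntegral.
Context {d} {X : measurableType d} {R : realType}.
Variable mu : {measure set X -> \bar R}.
Local Notation C := R[i].
Local Notation normc := (@Normc.normc R).
Implicit Types (f g : X -> C) (h : X -> R).

Definition cintegrable f :=
  mu.-integrable setT (fun x => (complex.Re (f x))%:E) /\
  mu.-integrable setT (fun x => (complex.Im (f x))%:E).

Lemma cintegrable_le f h : cmeasurable f -> (forall x, normc (f x) <= h x) ->
  mu.-integrable setT (EFin \o h) -> cintegrable f.
Proof.
move=> [f1 f2] fh ih; split.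
  apply: le_integrable ih => //; first exact/measurable_EFinP.
  move=> x _ /=; rewrite lee_fin (le_trans (le_Re_normc _))//.
  by rewrite (le_trans (fh x))// ler_norm.
apply: le_integrable ih => //; first exact/measurable_EFinP.
move=> x _ /=; rewrite lee_fin (le_trans (le_Im_normc _))//.
by rewrite (le_trans (fh x))// ler_norm.
Qed.

Lemma cintegrable_cmeasurable f : cintegrable f -> cmeasurable f.
Proof.
by move=> [/measurable_int/measurable_EFinP f1 /measurable_int/measurable_EFinP f2].
Qed.

Lemma cintegrable_normc f : cintegrable f -> mu.-integrable setT (fun x => (normc (f x))%:E).
Proof.
move=> cf; have mf := cintegrable_cmeasurable cf; case: cf => f1 f2.
have := integrableD (@measurableT _ X) (integrable_abse f1) (integrable_abse f2).
apply: le_integrable => //; first exact/measurable_EFinP/measurable_normc.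
move=> x _ /=; rewrite lee_fin ger0_norm ?normc_ge0//.
by rewrite (le_trans (normc_le_ReIm _))// ler_norm.
Qed.

Lemma eq_cintegral f g : f =1 g -> cintegral mu f = cintegral mu g.
Proof. by move=> /funext ->. Qed.

Lemma cintegrableD f g : cintegrable f -> cintegrable g -> cintegrable (fun x => f x + g x).
Proof.
move=> [f1 f2] [g1 g2]; split.
  by under eq_fun do rewrite ReD EFinD; exact: (integrableD measurableT f1 g1).
by under eq_fun do rewrite ImD EFinD; exact: (integrableD measurableT f2 g2).
Qed.

Lemma cintegralD f g : cintegrable f -> cintegrable g ->
  cintegral mu (fun x => f x + g x) = cintegral mu f + cintegral mu g.
Proof.
move=> [f1 f2] [g1 g2]; rewrite /cintegral; apply: complex_eq => /=.
  by under eq_Rintegral do rewrite ReD; rewrite RintegralD.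
by under eq_Rintegral do rewrite ImD; rewrite RintegralD.
Qed.

Lemma cintegrableZ a f : cintegrable f -> cintegrable (fun x => a * f x).
Proof.
move=> cf; apply: (@cintegrable_le _ (fun x => normc a * normc (f x))).
- by apply: cmeasurableM; [exact: cmeasurable_cst|exact: cintegrable_cmeasurable].
- by move=> x; rewrite Normc.normcM.
- exact: (integrableZl measurableT (normc a) (cintegrable_normc cf)).
Qed.

Lemma cintegralZ a f : cintegrable f -> cintegral mu (fun x => a * f x) = a * cintegral mu f.
Proof.
move=> [f1 f2]; rewrite /cintegral.
have iZ (r : R) (h : X -> R) : mu.-integrable setT (fun x => (h x)%:E) ->
    mu.-integrable setT (EFin \o (fun x => r * h x)).
  by move=> ih; exact: (integrableZl measurableT r ih).
apply: complex_eq; rewrite ?ReM ?ImM /=.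
  under eq_Rintegral do rewrite ReM.
  by rewrite RintegralB ?RintegralZl//; exact: iZ.
under eq_Rintegral do rewrite ImM.
by rewrite RintegralD ?RintegralZl//; exact: iZ.
Qed.

Lemma cintegralB f g : cintegrable f -> cintegrable g ->
  cintegral mu (fun x => f x - g x) = cintegral mu f - cintegral mu g.
Proof.
move=> cf cg.
rewrite -[RHS]/(_ + - _) -(mulN1r (cintegral mu g)) -cintegralZ// -cintegralD//.
  by apply: eq_cintegral => x; rewrite mulN1r.
exact: cintegrableZ.
Qed.

Lemma cintegrable0 : cintegrable (fun=> 0).
Proof. by split; exact: integrable0. Qed.

Lemma cintegral0 : cintegral mu (fun=> 0) = 0.
Proof. by apply: complex_eq; rewrite /= /Rintegral integral0. Qed.

Lemma cintegrable_sum (I : Type) (r : seq I) (F : I -> X -> C) :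
  (forall i, cintegrable (F i)) -> cintegrable (fun x => \sum_(i <- r) F i x).
Proof.
move=> iF; elim: r => [|i r IH].
  by under eq_fun do rewrite big_nil; exact: cintegrable0.
by under eq_fun do rewrite big_cons; exact: cintegrableD.
Qed.

Lemma cintegral_sum (I : Type) (r : seq I) (F : I -> X -> C) :
  (forall i, cintegrable (F i)) ->
  cintegral mu (fun x => \sum_(i <- r) F i x) = \sum_(i <- r) cintegral mu (F i).
Proof.
move=> iF; elim: r => [|i r IH].
  by rewrite big_nil -[RHS]cintegral0; apply: eq_cintegral => x; rewrite big_nil.
rewrite big_cons -IH -cintegralD//; last exact: cintegrable_sum.
by apply: eq_cintegral => x; rewrite big_cons.
Qed.

(* [|z|^2 = Re (conj z * z)] moves the modulus of the integral under the integral sign. *)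
Lemma normc_cintegral_le f : cintegrable f ->
  normc (cintegral mu f) <= Rintegral mu setT (fun x => normc (f x)).
Proof.
move=> cf; set z := cintegral mu f.
have [->|z0] := eqVneq z 0; first by rewrite Normc.normc0 Rintegral_ge0// => x _; exact: normc_ge0.
have nz0 : 0 < normc z by rewrite normc_gt0.
rewrite -(ler_pM2l nz0) -expr2.
have zc : normc (z^*)%C = normc z by case: (z) => a b /=; rewrite sqrrN.
have -> : normc z ^+ 2 = Rintegral mu setT (fun x => complex.Re ((z^*)%C * f x)).
  have := cintegralZ (z^*)%C cf; rewrite -/z => /(congr1 (@complex.Re R)) /= ->.
  by rewrite sqr_sqrtr ?addr_ge0 ?sqr_ge0// mulNr opprK !expr2.
have [c1 _] := cintegrableZ (z^*)%C cf.
rewrite -RintegralZl//; last exact: cintegrable_normc.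
apply: le_Rintegral => //.
  exact: (integrableZl measurableT (normc z) (cintegrable_normc cf)).
move=> x _; rewrite (le_trans (ler_norm _))// (le_trans (le_Re_normc _))//.
by rewrite Normc.normcM zc.
Qed.

Lemma normc_cintegral_le_dom f h : cmeasurable f -> (forall x, normc (f x) <= h x) ->
  mu.-integrable setT (EFin \o h) -> normc (cintegral mu f) <= Rintegral mu setT h.
Proof.
move=> mf fh ih; have cf := cintegrable_le mf fh ih.
apply: (le_trans (normc_cintegral_le cf)).
by apply: le_Rintegral => //; exact: cintegrable_normc.
Qed.

Lemma cintegral_real h : cintegral mu (fun x => ((h x)%:C)%C) = ((Rintegral mu setT h)%:C)%C.
Proof. by apply: complex_eq => //=; rewrite /Rintegral integral0. Qed.

End ComplexIntegral.

Section ParameterIntegral.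
Context {d d'} {X : measurableType d} {Y : measurableType d'} {R : realType}.
Variable k : R.-fker X ~> Y.

Lemma measurable_fun_Rintegral_kernel (F : X * Y -> R) : measurable_fun setT F ->
  measurable_fun setT (fun x => Rintegral (k x) setT (fun y => F (x, y))).
Proof.
move=> mF; apply: (measurableT_comp (fine_measurable measurableT)).
have meF : measurable_fun setT (EFin \o F) by exact/measurable_EFinP.
rewrite (_ : (fun x => _) = (fun x => \int[k x]_y ((EFin \o F)^\+ (x, y)) - \int[k x]_y ((EFin \o F)^\- (x, y)))%E).
  apply: emeasurable_funB; apply: measurable_fun_integral_finite_kernel => //.
    exact: measurable_funepos.
  exact: measurable_funeneg.
apply/funext => x; rewrite /= integralE; congr (_ - _)%E.
  by apply: eq_integral => y _; rewrite !funeposE.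
by apply: eq_integral => y _; rewrite !funenegE.
Qed.

Lemma cmeasurable_cintegral_kernel (F : X * Y -> R[i]) : cmeasurable F ->
  cmeasurable (fun x => cintegral (k x) (fun y => F (x, y))).
Proof.
move=> [F1 F2]; split => /=.
  exact: (measurable_fun_Rintegral_kernel F1).
exact: (measurable_fun_Rintegral_kernel F2).
Qed.

End ParameterIntegral.

Section RealCauchy.
Variable R : realType.

Lemma cauchy_real_limit (u : nat -> R) :
  (forall e, 0 < e -> exists n0, forall m n, (n0 <= m)%N -> (n0 <= n)%N -> `|u m - u n| <= e) ->
  u @ \oo --> lim (u @ \oo).
Proof.
move=> h; apply/cauchy_cvgP/cauchy_exP => e e0.
have [n0 hn] := h _ (divr_gt0 e0 (ltr0n R 2)).
exists (u n0), n0 => // n /= nn0; rewrite /ball /= (le_lt_trans (hn _ _ _ _))//.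
by rewrite ltr_pdivrMr// ltr_pMr// ltr1n.
Qed.

End RealCauchy.

(** * The Banach space of w-bounded functions *)

Section WeightedSpace.
Context {d : measure_display} {E : measurableType d} {R : realType}.
Local Notation C := R[i].
Local Notation normc := (@Normc.normc R).
Variable w : E -> R.
Hypotheses (w_ge1 : forall x, 1 <= w x) (w_meas : measurable_fun setT w).
Implicit Types f g : E -> R[i]^o.

Let w0 x : 0 < w x. Proof. exact: lt_le_trans (w_ge1 x). Qed.
Let w0' x : 0 <= w x. Proof. exact: ltW. Qed.

Lemma wnorm_le f M : 0 <= M -> (forall x, normc (f x) <= M * w x) -> wnorm w f <= M.
Proof.
move=> M0 fM; rewrite /wnorm; set A := image _ _.
have [A0|A0] := pselect (A !=set0); last by rewrite sup_out// => -[].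
by apply: ge_sup => // _ [x _ <-]; rewrite mulrC ler_pdivrMr.
Qed.

Lemma wspaceI f M : cmeasurable f -> (forall x, normc (f x) <= M * w x) -> wspace w f.
Proof.
by move=> mf fM; split => //; exists M => x; rewrite mulrC ler_pdivrMr.
Qed.

Lemma normc_le_wnorm f x : wspace w f -> normc (f x) <= wnorm w f * w x.
Proof.
move=> [_ [M fM]]; rewrite -ler_pdivrMr// mulrC; apply: ub_le_sup; last by exists x.
by exists M => _ [y _ <-].
Qed.

Lemma wspace_cmeasurable f : wspace w f -> cmeasurable f.
Proof. by case. Qed.

Lemma wnorm_ge0 f : wspace w f -> 0 <= wnorm w f.
Proof.
move=> wf; have [[x _]|nE] := pselect (exists x : E, True).
  have := normc_le_wnorm x wf; rewrite -ler_pdivrMr//; apply: le_trans.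
  by rewrite divr_ge0// normc_ge0.
rewrite /wnorm sup_out// => -[[_ [x _ _]] _].
by apply: nE; exists x.
Qed.

Lemma wspaceD a f g : wspace w f -> wspace w g -> wspace w (a *: f + g).
Proof.
move=> wf wg; apply: (@wspaceI _ (normc a * wnorm w f + wnorm w g)).
  apply: cmeasurableD; last exact: wspace_cmeasurable.
  by apply: cmeasurableM; [exact: cmeasurable_cst|exact: wspace_cmeasurable].
move=> x; rewrite (le_trans (normcD _ _))// mulrDl lerD ?normc_le_wnorm//.
by rewrite Normc.normcM -mulrA ler_wpM2l ?normc_ge0// normc_le_wnorm.
Qed.

Lemma wspace0 : wspace w 0.
Proof.
apply: (@wspaceI _ 0); first exact: cmeasurable_cst.
by move=> x; rewrite mul0r Normc.normc0.
Qed.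

Lemma wspace_subspace : is_subspace (wspace w).
Proof.
split; first by rewrite inE; exact: wspace0.
by move=> a f g; rewrite !inE; exact: wspaceD.
Qed.

Lemma wspace_sub f g : wspace w f -> wspace w g -> wspace w (f - g).
Proof.
by move=> wf wg; rewrite -scaleN1r addrC; exact: wspaceD.
Qed.

(** A Cauchy sequence converges at every point, since [w] is finite there; the pointwise limit is
    measurable, and the estimate with weight [w] passes to the limit point by point. *)
Lemma wspace_complete_norm : complete_norm_on (wnorm w) (wspace w).
Proof.
split.
- move=> f g wf wg; apply: wnorm_le; first by rewrite addr_ge0// wnorm_ge0.
  by move=> x; rewrite (le_trans (normcD _ _))// mulrDl lerD// normc_le_wnorm.
- have le_scale (a : C) f : wspace w f -> wnorm w (a *: f) <= normc a * wnorm w f.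
    move=> wf; apply: wnorm_le; first by rewrite mulr_ge0 ?normc_ge0 ?wnorm_ge0.
    by move=> x; rewrite Normc.normcM -mulrA ler_wpM2l ?normc_ge0// normc_le_wnorm.
  have wZ (a : C) f : wspace w f -> wspace w (a *: f).
    by move=> wf; rewrite -[_ *: _]addr0; apply: wspaceD => //; exact: wspace0.
  move=> a f wf; apply/eqP; rewrite eq_le le_scale//=.
  have [->|a0] := eqVneq a 0.
    by rewrite Normc.normc0 mul0r wnorm_ge0//; exact: wZ.
  rewrite -ler_pdivlMl ?normc_gt0// -Normc.normcV.
  by have := le_scale a^-1 _ (wZ a _ wf); rewrite scalerA mulVf// scale1r.
- move=> f wf f0; apply/funext => x; apply: Normc.eq0_normc; apply/eqP.
  rewrite eq_le normc_ge0 andbT; have := normc_le_wnorm x wf.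
  by rewrite f0 mul0r.
- move=> u wu uc.
  have uc' e : 0 < e -> exists n0, forall m n, (n0 <= m)%N -> (n0 <= n)%N ->
      forall x, normc (u m x - u n x) <= e * w x.
    move=> /uc[n0 h]; exists n0 => m n mn nn x.
    rewrite (le_trans (@normc_le_wnorm (u m - u n) x _))//; first exact: wspace_sub.
    by rewrite ler_wpM2r// h.
  have ucR (P : C -> R) : (forall a b, `|P a - P b| <= normc (a - b)) -> forall x,
      (fun n => P (u n x)) @ \oo --> lim ((fun n => P (u n x)) @ \oo).
    move=> PN x; apply: cauchy_real_limit => e e0.
    have [n0 h] := uc' _ (divr_gt0 e0 (w0 x)); exists n0 => m n mn nn.
    by rewrite (le_trans (PN _ _))// (le_trans (h _ _ mn nn x))// divfK// gt_eqF.
  have ucRe := ucR (@complex.Re R) (fun a b => ltac:(by rewrite -ReN -ReD; exact: le_Re_normc)).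
  have ucIm := ucR (@complex.Im R) (fun a b => ltac:(by rewrite -ImN -ImD; exact: le_Im_normc)).
  pose l : E -> R[i]^o := fun x => (lim ((fun n => complex.Re (u n x)) @ \oo) +i*
            lim ((fun n => complex.Im (u n x)) @ \oo))%C.
  have ml : cmeasurable l.
    split.
      apply: (measurable_fun_cvg (h := fun n x => complex.Re (u n x))) => [n|x _].
        by have [[]] := wu n.
      exact: ucRe.
    apply: (measurable_fun_cvg (h := fun n x => complex.Im (u n x))) => [n|x _].
      by have [[]] := wu n.
    exact: ucIm.
  have ul e : 0 < e -> exists n0, forall n, (n0 <= n)%N -> forall x, normc (u n x - l x) <= e * w x.
    move=> e0; have [n0 h] := uc' _ e0; exists n0 => n nn x.
    apply/ler_addgt0Pr => e' e'0.
    have e2 : 0 < e' / 2 by rewrite divr_gt0.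
    have /cvgrPdist_le/(_ _ e2)[n1 _ h1] := ucRe x.
    have /cvgrPdist_le/(_ _ e2)[n2 _ h2] := ucIm x.
    pose m := maxn n0 (maxn n1 n2).
    have -> : u n x - l x = (u n x - u m x) + (u m x - l x) by rewrite addrA subrK.
    rewrite (le_trans (normcD _ _))// lerD//.
      by apply: h => //; rewrite leq_maxl.
    rewrite (le_trans (normc_le_ReIm _))// [e']splitr lerD//.
      by rewrite ReD ReN distrC h1//= leq_max leq_maxl orbT.
    by rewrite ImD ImN distrC h2//= leq_max leq_maxr orbT.
  exists l.
    have [n0 h] := ul 1 ltr01; have h0 := h _ (leqnn n0).
    apply: (@wspaceI _ (wnorm w (u n0) + 1)) => // x.
    have -> : l x = u n0 x - (u n0 x - l x) by rewrite opprB addrC subrK.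
    by rewrite (le_trans (ler_normcB _ _))// mulrDl lerD// normc_le_wnorm.
  move=> e e0; have [n0 h] := ul _ e0; exists n0 => n nn.
  by apply: wnorm_le; [exact: ltW|exact: h].
Qed.

End WeightedSpace.

(** * Operators of weighted kernels *)

Section WeightedKernelOperators.
Context {d : measure_display} {E : measurableType d} {R : realType}.
Local Notation C := R[i].
Local Notation normc := (@Normc.normc R).
Variable w : E -> R.
Hypotheses (w_ge1 : forall x, 1 <= w x) (w_meas : measurable_fun setT w).
Implicit Types (f g : E -> R[i]^o) (k : R.-fker E ~> E) (chi : E * E -> C).

Let w0 x : 0 < w x. Proof. exact: lt_le_trans (w_ge1 x). Qed.
Let w0' x : 0 <= w x. Proof. exact: ltW. Qed.

(** The kernel of modulus |chi| k maps [w] below [M w]: this single bound provides the integrability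
    of all integrands and the operator norm on B_w. *)
Definition kernel_dominated k chi (M : R) :=
  forall x, (\int[k x]_y (normc (chi (x, y)) * w y)%:E <= (M * w x)%:E)%E.

Lemma cmeasurable_section chi x : cmeasurable chi -> cmeasurable (fun y => chi (x, y)).
Proof. by move=> mc; apply: cmeasurable_comp mc _; exact: pair1_measurable. Qed.

Lemma kernel_dominated_integrable k chi M x : cmeasurable chi -> kernel_dominated k chi M ->
  (k x).-integrable setT (EFin \o (fun y => normc (chi (x, y)) * w y)).
Proof.
move=> mc kM; apply/integrableP; split.
  apply/measurable_EFinP/measurable_funM => //.
  exact/measurable_normc/cmeasurable_section.
under eq_integral do rewrite /= ger0_norm ?mulr_ge0 ?normc_ge0//.
exact: le_lt_trans (kM x) (ltry _).
Qed.

Lemma kernel_dominated_Rintegral k chi M x : cmeasurable chi -> kernel_dominated k chi M ->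
  Rintegral (k x) setT (fun y => normc (chi (x, y)) * w y) <= M * w x.
Proof.
move=> mc kM; rewrite -lee_fin /Rintegral fineK; first exact: kM.
by apply: integrable_fin_num => //; exact: kernel_dominated_integrable kM.
Qed.

Section Op.
Variables (k : R.-fker E ~> E) (chi : E * E -> C) (M : R).
Hypotheses (mchi : cmeasurable chi) (kM : kernel_dominated k chi M).

Let dom f x y : wspace w f ->
  normc (f y * chi (x, y)) <= wnorm w f * (normc (chi (x, y)) * w y).
Proof.
move=> wf; rewrite Normc.normcM mulrC mulrCA ler_wpM2l ?normc_ge0//.
exact: normc_le_wnorm.
Qed.

Let idom f x : (k x).-integrable setT (EFin \o (fun y => wnorm w f * (normc (chi (x, y)) * w y))).
Proof.
exact: (integrableZl measurableT (wnorm w f) (kernel_dominated_integrable x mchi kM)).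
Qed.

Let mint f x : wspace w f -> cmeasurable (fun y => f y * chi (x, y)).
Proof.
by move=> [mf _]; apply: cmeasurableM => //; exact: cmeasurable_section.
Qed.

Lemma kernel_op_weight_integrable f x : wspace w f ->
  cintegrable (k x) (fun y => f y * chi (x, y)).
Proof. by move=> wf; apply: cintegrable_le (idom f x); [exact: mint|move=> y; exact: dom]. Qed.

Lemma kernel_op_weight_le f x : wspace w f ->
  normc (kernel_op_weight k chi f x) <= M * wnorm w f * w x.
Proof.
move=> wf; rewrite (le_trans (normc_cintegral_le_dom (mint x wf) (fun y => dom x y wf) (idom f x)))//.
rewrite RintegralZl//; last exact: kernel_dominated_integrable kM.
rewrite mulrAC [leRHS]mulrC ler_wpM2l ?wnorm_ge0//.
exact: kernel_dominated_Rintegral.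
Qed.

Lemma kernel_op_weight_wspace f : wspace w f -> wspace w (kernel_op_weight k chi f).
Proof.
move=> wf; apply: (@wspaceI _ _ _ _ _ _ (M * wnorm w f)) => //; last first.
  by move=> x; exact: kernel_op_weight_le.
apply: (@cmeasurable_cintegral_kernel _ _ _ _ _ k (fun z => f z.2 * chi z)).
apply: cmeasurableM => //.
by apply: cmeasurable_comp (wspace_cmeasurable wf) _.
Qed.

Lemma kernel_op_weight_lin : lin_on (wspace w) (kernel_op_weight k chi).
Proof.
move=> a f g wf wg; apply/funext => x.
transitivity ((a * cintegral (k x) (fun y => f y * chi (x, y)) : C) +
  cintegral (k x) (fun y => g y * chi (x, y))); last by [].
have iF := kernel_op_weight_integrable x wf.
have iG := kernel_op_weight_integrable x wg.
rewrite -cintegralZ// -cintegralD//; last exact: cintegrableZ.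
by apply: eq_cintegral => y; rewrite [LHS]mulrDl -mulrA.
Qed.

Lemma kernel_op_weight_blin : 0 <= M -> blin_on (wnorm w) (wspace w) (kernel_op_weight k chi).
Proof.
move=> M0; split; [exact: kernel_op_weight_wspace|exact: kernel_op_weight_lin|].
exists M => // f wf; apply: wnorm_le => //; first by rewrite mulr_ge0// wnorm_ge0.
by move=> x; exact: kernel_op_weight_le.
Qed.

End Op.

End WeightedKernelOperators.

(** * Growth of the iterates of a positive kernel *)

Lemma resolvent_set_large {R : realType} {V : lmodType R[i]} (N : V -> R) (B : set V)
    (T : V -> V) (M : R) (l : R[i]) :
  complete_norm_on N B -> is_subspace B -> 0 <= M -> (forall f, B f -> B (T f)) ->
  lin_on B T -> (forall f, B f -> N (T f) <= M * N f) -> M < Normc.normc l ->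
  resolvent_set N B T l.
Proof.
move=> cN sB M0 hT lT bT Ml.
have bTon : blin_on N B T by split => //; exists M.
have cX := complete_norm_subspace cN sB.
have [lX _] := restrict_op_blin sB bTon.
have [|U [lU [P P0 bU]] [UK KU]] := blin_neumann cX lX M0 _ Ml.
  by move=> f; rewrite (restrict_opE _ bTon) bT//; exact: subspace_valP.
pose i0 : V -> subspace_type sB := insubd 0.
have i0K f : B f -> val (i0 f) = f by exact: insubd_val.
have valE f : B f -> exists x : subspace_type sB, f = val x.
  by move=> Bf; exists (i0 f); rewrite i0K.
have Ki0 (x : subspace_type sB) : i0 (val x) = x.
  by apply: subspace_eq; rewrite i0K//; exact: subspace_valP.
exists (fun f => val (U (i0 f))); split.
- by move=> f _; exact: subspace_valP.
- by exists P => _ /valE[x ->]; rewrite Ki0 bU.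
- move=> _ /valE[x ->]; rewrite -(restrict_opE _ bTon) -(subspace_valZ l x).
  by rewrite -subspace_valN -subspace_valD Ki0 UK.
- move=> _ /valE[x ->]; rewrite /= Ki0 -(restrict_opE _ bTon) -(subspace_valZ l (U x)).
  by rewrite -subspace_valN -subspace_valD KU.
Qed.

Section PositiveKernelRadius.
Context {d : measure_display} {E : measurableType d} {R : realType}.
Local Notation C := R[i].
Variable w : E -> R.
Hypotheses (w_ge1 : forall x, 1 <= w x) (w_meas : measurable_fun setT w).
Variables (S : R.-fker E ~> E) (MS : R).
Hypotheses (MS0 : 0 <= MS) (SM : kernel_dominated w S (fun=> 1) MS).

Let w0 x : 0 < w x. Proof. exact: lt_le_trans (w_ge1 x). Qed.
Let w0' x : 0 <= w x. Proof. exact: ltW. Qed.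

(** The kernel acts here on real functions, where pointwise inequalities can be iterated; [of_real]
    embeds them in B_w, where the resolvent acts. *)
Definition real_op (g : E -> R) (x : E) : R := Rintegral (S x) setT g.

Definition of_real (g : E -> R) : E -> R[i]^o := fun x => ((g x)%:C)%C.

Implicit Types (g h p : E -> R).
Local Notation P := real_op.
Local Notation wreal g := (wspace w (of_real g)).

Lemma wrealI g M : measurable_fun setT g -> (forall x, `|g x| <= M * w x) -> wreal g.
Proof.
move=> mg gM; apply: (@wspaceI _ _ _ _ w_ge1 _ M); first exact: cmeasurable_real.
by move=> x; rewrite normc_real.
Qed.

Lemma wreal_weight : wreal w.
Proof. by apply: (@wrealI _ 1) => // x; rewrite mul1r ger0_norm. Qed.

Lemma wreal_lin a g h : wreal g -> wreal h -> wreal (fun x => a * g x + h x).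
Proof.
move=> wg wh; rewrite (_ : of_real _ = (a%:C)%C *: of_real g + of_real h).
  exact: wspaceD.
by apply/funext => x; rewrite /of_real rmorphD rmorphM.
Qed.

Lemma kernel_op_weight1 (Q : R.-fker E ~> E) : kernel_op_weight Q (fun=> 1) = kernel_op Q.
Proof.
by apply/funext => f; apply/funext => x; apply: eq_cintegral => y; rewrite mulr1.
Qed.

Lemma kernel_op_real g : kernel_op S (of_real g) = of_real (P g).
Proof. by apply/funext => x; rewrite /kernel_op cintegral_real. Qed.

Lemma kernel_op_blin : blin_on (wnorm w) (wspace w) (kernel_op S).
Proof.
by rewrite -kernel_op_weight1; apply: kernel_op_weight_blin SM MS0 => //; exact: cmeasurable_cst.
Qed.

Lemma wreal_op g : wreal g -> wreal (P g).
Proof. by rewrite -kernel_op_real; case: kernel_op_blin => h _ _; exact: h. Qed.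

Lemma wreal_iter n g : wreal g -> wreal (iter n P g).
Proof. by move=> wg; elim: n => //= n IH; exact: wreal_op. Qed.

Lemma wreal_integrable g x : wreal g -> (S x).-integrable setT (EFin \o g).
Proof.
move=> wg; have := kernel_op_weight_integrable w_ge1 w_meas (cmeasurable_cst 1) SM x wg.
by move=> [+ _]; under eq_fun do rewrite mulr1.
Qed.

Lemma real_op_lin a g h : wreal g -> wreal h ->
  P (fun x => a * g x + h x) = (fun x => a * P g x + P h x).
Proof.
move=> wg wh; apply/funext => x; rewrite /P RintegralD ?RintegralZl//.
- exact: wreal_integrable.
- exact: (integrableZl measurableT a (wreal_integrable x wg)).
- exact: wreal_integrable.
Qed.

Lemma real_op_le g h : wreal g -> wreal h -> (forall x, g x <= h x) -> forall x, P g x <= P h x.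
Proof.
by move=> wg wh gh x; apply: le_Rintegral => //; exact: wreal_integrable.
Qed.

Lemma real_op_ge0 g : (forall x, 0 <= g x) -> forall x, 0 <= P g x.
Proof. by move=> g0 x; apply: Rintegral_ge0. Qed.

Lemma iter_real_op_ge0 n x : 0 <= iter n P w x.
Proof. by elim: n x => [//|n IH] x; rewrite iterS real_op_ge0. Qed.

Lemma wreal0 : wreal (fun=> 0).
Proof. by apply: (@wrealI _ 0) => // x; rewrite normr0 mul0r. Qed.

Lemma wrealZ a g : wreal g -> wreal (fun x => a * g x).
Proof.
move=> wg; have := wreal_lin a wg wreal0.
by rewrite (_ : (fun x => a * g x + 0) = (fun x => a * g x))//; apply/funext => x; rewrite addr0.
Qed.

Lemma real_opZ a g : wreal g -> P (fun x => a * g x) = (fun x => a * P g x).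
Proof. by move=> wg; apply/funext => x; rewrite /P RintegralZl//; exact: wreal_integrable. Qed.

Definition op_growth (l : R) := 0 < l /\ exists2 M, 0 <= M & forall n x, iter n P w x <= M * l ^+ n * w x.

(** A supersolution comparable to [w] controls the iterates by positivity: P^n w <= c P^n p <= c l^n
    p <= c M l^n w. *)
Lemma op_growth_super p l c M : wreal p -> 0 < l -> 0 <= c -> 0 <= M ->
  (forall x, w x <= c * p x) -> (forall x, p x <= M * w x) ->
  (forall x, P p x <= l * p x) -> op_growth l.
Proof.
move=> wp l0 c0 M0 wcp pM Pp; split => //; exists (c * M); first exact: mulr_ge0.
have h n x : iter n P w x <= c * (l ^+ n * p x).
  elim: n x => [|n IH] x; first by rewrite expr0 mul1r.
  rewrite iterS; apply: (@le_trans _ _ (P (fun y => c * l ^+ n * p y) x)).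
    apply: real_op_le; [exact/wreal_iter/wreal_weight|exact: wrealZ|].
    by move=> y; rewrite -mulrA.
  rewrite real_opZ// -mulrA ler_wpM2l// exprSr -mulrA ler_wpM2l// exprn_ge0// ltW//.
move=> n x; rewrite (le_trans (h n x))// -mulrA -mulrA ler_wpM2l//.
by rewrite mulrCA ler_wpM2l// exprn_ge0// ltW.
Qed.

(** Partial sums of the Neumann series of (l - P)^-1 w. *)
Fixpoint neumann_sum (l : R) n (x : E) : R :=
  if n is m.+1 then neumann_sum l m x + l ^- m.+1 * iter m P w x else 0.

Lemma neumann_sum_wreal l n : wreal (neumann_sum l n).
Proof.
elim: n => [|n IH]; first exact: wreal0.
rewrite (_ : neumann_sum _ _ = fun x => l ^- n.+1 * iter n P w x + neumann_sum l n x).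
  exact: wreal_lin (wreal_iter n wreal_weight) IH.
by apply/funext => x; rewrite /= addrC.
Qed.

Lemma neumann_sum_op l n : l != 0 -> forall x,
  P (neumann_sum l n) x = l * neumann_sum l n x - w x + l ^- n * iter n P w x.
Proof.
move=> l0; elim: n => [|n IH] x.
  rewrite /= mulr0 expr0 invr1 mul1r sub0r addNr /P /Rintegral.
  by rewrite integral0.
rewrite (_ : neumann_sum _ _ = fun x => l ^- n.+1 * iter n P w x + neumann_sum l n x); last first.
  by apply/funext => y; rewrite /= addrC.
rewrite real_op_lin; [|exact: wreal_iter wreal_weight|exact: neumann_sum_wreal].
rewrite IH /= mulrDr.
have -> : l * (l ^- n.+1 * iter n P w x) = l ^- n * iter n P w x.
  by rewrite mulrA exprS invfM mulrA divff// mul1r.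
by rewrite addrC; congr (_ + _); rewrite addrC !addrA.
Qed.

Lemma neumann_sum_ge l n x : 0 < l -> (0 < n)%N -> w x <= l * neumann_sum l n x.
Proof.
move=> l0; case: n => // n _; elim: n => [|n IH].
  by rewrite /= add0r expr1 mulrA divff ?gt_eqF// mul1r.
rewrite (le_trans IH)// ler_wpM2l ?(ltW l0)// lerDl mulr_ge0 ?iter_real_op_ge0//.
by rewrite invr_ge0 exprn_ge0// ltW.
Qed.

(** Let l0 be the infimum of the growth rates and suppose l0 >= s > r(S). The resolvent U at l0
    exists, with a bound c. For l slightly above l0 the Neumann sum p solves (l0 - P) p = (l0 - l) p
    + w - e with a small tail e; applying U gives p <= 2 c w, however close l is to l0. Then P p = l
    p - w + e <= l p - w / 2 <= (l - 1 / (4 c)) p, so p is a supersolution with a rate below l0. *)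
Lemma positive_kernel_growth (s : R) : wradius w S < s -> op_growth s.
Proof.
move=> rs; apply: contrapT => nJ.
have r0 : 0 <= wradius w S by exact: spectral_radius_ge0.
have s0 : 0 < s := le_lt_trans r0 rs.
have [hS lS [M M0 bS]] := kernel_op_blin.
have cW := wspace_complete_norm w_ge1.
have sW := wspace_subspace w_ge1.
have resl (l : R) : wradius w S < l -> resolvent_set (wnorm w) (wspace w) (kernel_op S) (l%:C)%C.
  move=> rl; apply: contrapT => nres.
  suff : l <= wradius w S by rewrite leNgt rl.
  apply: ub_le_sup; last first.
    by exists (l%:C)%C => //; rewrite normc_real ger0_norm// (le_trans r0)// ltW.
  (* The supremum defining the radius is a true upper bound because the spectrum lies in the disc of
     radius [M]. *)
  exists M => _ [m ms <-]; rewrite leNgt; apply/negP => Mm; apply: ms.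
  exact: resolvent_set_large cW sW M0 hS lS bS Mm.
pose J : set R := op_growth.
have J0 : J !=set0.
  exists (MS + 1); apply: (@op_growth_super w _ 1 1) => //; rewrite ?ltr_wpDl//.
  - exact: wreal_weight.
  - by move=> x; rewrite mul1r.
  - by move=> x; rewrite mul1r.
  - move=> x; rewrite (@le_trans _ _ (MS * w x))//.
      have := kernel_dominated_Rintegral w_ge1 w_meas x (cmeasurable_cst 1) SM.
      apply: le_trans; rewrite le_eqVlt; apply/orP; left; apply/eqP.
      by apply: eq_Rintegral => y _; rewrite Normc.normc1 mul1r.
    by rewrite ler_wpM2r// lerDl.
have Jup l l' : J l -> l <= l' -> J l'.
  move=> [l0 [B B0 hB]] ll'; split; first exact: lt_le_trans ll'.
  exists B => // n x; rewrite (le_trans (hB _ _))// ler_wpM2r// ler_wpM2l//.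
  by rewrite lerXn2r// nnegrE ltW// (lt_le_trans l0).
have Js l : J l -> s <= l.
  by move=> Jl; rewrite leNgt; apply/negP => ls; apply: nJ; apply: (Jup l) => //; exact: ltW.
have Jlb : has_lbound J by exists s.
pose l0 := inf J.
have sl0 : s <= l0 by apply: lb_le_inf.
have l00 : 0 < l0 := lt_le_trans s0 sl0.
have [U [hU [B bU] UK _]] := resl l0 (lt_le_trans rs sl0).
pose c := `|B| + 1.
have c0 : 0 < c by rewrite ltr_wpDl.
have bU' f : wspace w f -> wnorm w (U f) <= c * wnorm w f.
  move=> wf; rewrite (le_trans (bU _ wf))// ler_wpM2r ?wnorm_ge0//.
  by rewrite (le_trans (ler_norm _))// lerDl.
(* The constant serves twice: c [eta] = 1/16 lets the term [eta] a be absorbed in a <= c ([eta] a +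
   1), and [eta] < 1 / (4 c) brings l - 1 / (4 c) below l0. *)
pose eta := (16 * c)^-1.
have eta0 : 0 < eta by rewrite invr_gt0 mulr_gt0.
have [l' Jl' l'lt] : exists2 y, J y & y < l0 + eta by apply: inf_lt => //; rewrite ltrDl.
(* [l'] is a growth rate and [l] lies strictly above it, so the tail l^-n P^n w becomes small
   relative to [w]. *)
pose l := (l' + (l0 + eta)) / 2.
have l'l : l' < l by rewrite /l ltr_pdivlMr//; lra.
have llt : l < l0 + eta by rewrite /l ltr_pdivrMr//; lra.
have l0l' : l0 <= l' by apply: ge_inf.
have lpos : 0 < l := lt_trans (lt_le_trans l00 l0l') l'l.
have l'pos : 0 < l' := lt_le_trans l00 l0l'.
have [_ [B' B'0 hB']] := Jl'.
have q01 : 0 <= l' / l < 1 by rewrite divr_ge0 ?(ltW lpos) ?(ltW l'pos)//= ltr_pdivrMr// mul1r.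
have [||//|n n0 hn] := @affine_expr_small R (l' / l) B' 0 2^-1 q01 => //.
rewrite mul0r addr0 in hn.
pose e x := l ^- n * iter n P w x; pose p := neumann_sum l n.
have e_ge0 x : 0 <= e x by rewrite mulr_ge0 ?iter_real_op_ge0// invr_ge0 exprn_ge0// ltW.
have e_le x : e x <= 2^-1 * w x.
  rewrite /e mulrC ler_pdivrMr ?exprn_gt0//.
  apply: (le_trans (hB' n x)); rewrite [leRHS]mulrAC ler_wpM2r// -ler_pdivrMr ?exprn_gt0//.
  by rewrite -mulrA -expr_div_n.
have wp : wreal p by exact: neumann_sum_wreal.
have we : wreal e by apply: wrealZ; exact: wreal_iter wreal_weight.
have l_neq0 : l != 0 by rewrite gt_eqF.
have Pp := neumann_sum_op n l_neq0.
pose h x := (l0 - l) * p x + (w x - e x).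
have wwe : wreal (fun x => w x - e x).
  have := wreal_lin (-1) we wreal_weight.
  by rewrite (_ : (fun x => _ + _) = (fun x => w x - e x))//; apply/funext => x; rewrite mulN1r addrC.
have wh : wreal h by exact: wreal_lin.
have pU : of_real p = U (of_real h).
  rewrite -[LHS]UK//; congr U; apply/funext => x.
  rewrite kernel_op_real.
  transitivity ((l0%:C)%C * of_real p x - of_real (P p) x : C); first by [].
  rewrite /of_real -rmorphM -rmorphB/= /h Pp -/p; congr (_%:C)%C; rewrite /e; ring.
have p0 x : 0 <= p x.
  by have := le_trans (w0' x) (neumann_sum_ge x lpos n0); rewrite pmulr_rge0.
pose a := wnorm w (of_real p).
have a0 : 0 <= a by exact: wnorm_ge0.
have pa x : p x <= a * w x.
  by have := normc_le_wnorm w_ge1 x wp; rewrite normc_real ger0_norm.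
have ha : wnorm w (of_real h) <= eta * a + 1.
  apply: wnorm_le => //; first by rewrite addr_ge0// mulr_ge0// ltW.
  move=> x; rewrite normc_real /h (le_trans (ler_normD _ _))// [leRHS]mulrDl lerD//.
    rewrite normrM (ger0_norm (p0 x)) -mulrA ler_pM// distrC ger0_norm ?subr_ge0.
      by move: llt; lra.
    by move: l0l' l'l; lra.
  have := e_le x; have := e_ge0 x; have := w0' x.
  by rewrite ler_norml; lra.
have a2 : a <= 2 * c.
  have : a <= c * (eta * a + 1).
    by rewrite {1}/a pU (le_trans (bU' _ wh))// ler_wpM2l// ltW.
  rewrite mulrDr mulr1 mulrA (_ : c * eta = 16^-1); last first.
    by rewrite /eta; field; rewrite gt_eqF.
  by move: a0 c0; lra.
(* The maximum with l0 / 2 keeps the rate positive, as [op_growth] demands. *)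
pose l2 := Num.max (l - (4 * c)^-1) (l0 / 2).
have l2pos : 0 < l2 by rewrite lt_max divr_gt0// orbT.
have l2lt : l2 < l0.
  rewrite gt_max ltr_pdivrMr// ltr_pMr// ltr1n andbT.
  have : eta < (4 * c)^-1 by rewrite ltf_pV2 ?posrE ?mulr_gt0// ltr_pM2r// ltr_nat.
  by move: llt; lra.
have : J l2.
  apply: (@op_growth_super p _ l (2 * c)) => //; rewrite ?(ltW lpos) ?mulr_ge0 ?(ltW c0)//.
  - by move=> x; exact: neumann_sum_ge.
  - by move=> x; rewrite (le_trans (pa x))// ler_wpM2r.
  - move=> x; apply: (@le_trans _ _ ((l - (4 * c)^-1) * p x)); last first.
      by rewrite ler_wpM2r// le_max lexx.
    rewrite Pp -/p -/(e x) mulrBl -addrA lerD2l.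
    have pw : (4 * c)^-1 * p x <= 2^-1 * w x.
      rewrite mulrC ler_pdivrMr ?mulr_gt0// (le_trans (pa x))//.
      have -> : 2^-1 * w x * (4 * c) = 2 * c * w x by field.
      by rewrite ler_wpM2r.
    by move: pw (e_le x); lra.
by move=> /(ge_inf Jlb); rewrite -/l0 leNgt l2lt.
Qed.

End PositiveKernelRadius.

(** * Finite-rank approximation of the products T S^a T *)

(** Turns the finiteness of a measure from a fact into the structure expected by Fubini's theorem,
    together with an equality by which [m] can be rewritten. *)
Lemma finite_measure_of {d} {X : measurableType d} {R : realType}
    (m : {measure set X -> \bar R}) : fin_num_fun m ->
  exists m' : {finite_measure set X -> \bar R}, m = m' :> {measure set X -> \bar R}.
Proof.
move=> fm.
have sf : sfinite_measure m.
  exists (fun n => if n is O then m else mzero) => [[]//|U mU].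
  by rewrite /mseries nneseries_recl// eseries0 ?adde0// => -[|].
have sgf : sigma_finite [set: X] m by apply: fin_num_fun_sigma_finite; rewrite ?measure0.
pose H1 := isFinite.Build _ _ _ _ fm.
pose H2 := isSFinite.Build _ _ _ _ sf.
pose H3 := isSigmaFinite.Build _ _ _ _ sgf.
exists (HB.pack_for (FiniteMeasure.type X R) (Measure.sort m) H1 H2 H3).
exact: eq_measure.
Qed.

Section Fubini.
Context {d d'} {X : measurableType d} {Y : measurableType d'} {R : realType}.
Variables (m1 : {measure set X -> \bar R}) (m2 : {measure set Y -> \bar R}).
Hypotheses (fm1 : fin_num_fun m1) (fm2 : fin_num_fun m2).

Let ibound (F : Y -> R) (a : R) : measurable_fun setT F -> (forall y, `|F y| <= a) ->
  m2.-integrable setT (EFin \o F).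
Proof.
move=> mF Fa; have [m' ->] := finite_measure_of fm2.
apply: (@le_integrable _ _ _ _ _ _ _ (EFin \o cst a)) => //.
- exact/measurable_EFinP.
- by move=> y _; rewrite lee_fin (le_trans (Fa y))// ler_norm.
- exact: finite_measure_integrable_cst.
Qed.

(** The bound depends on the first variable alone, because it is applied with a multiple of the
    possibly unbounded weight [w]; the double integral of |F| is at most that of |h| times the mass
    of [m2]. *)
Lemma Rintegral_swap (F : X * Y -> R) (h : X -> R) :
  measurable_fun setT F -> m1.-integrable setT (EFin \o h) ->
  (forall x y, `|F (x, y)| <= h x) ->
  Rintegral m1 setT (fun x => Rintegral m2 setT (fun y => F (x, y))) =
  Rintegral m2 setT (fun y => Rintegral m1 setT (fun x => F (x, y))).
Proof.
move=> mF ih Fh.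
have i2 x : m2.-integrable setT (EFin \o (fun y => F (x, y))).
  apply: (@ibound _ (h x)) => //.
  exact: measurable_fun_pair2.
have i1 y : m1.-integrable setT (EFin \o (fun x => F (x, y))).
  apply: le_integrable ih => //.
    by apply/measurable_EFinP; exact: measurable_fun_pair1.
  by move=> x _; rewrite lee_fin (le_trans (Fh x y))// ler_norm.
rewrite /Rintegral; congr fine.
rewrite (eq_integral (fun x => \int[m2]_y (F (x, y))%:E)%E); last first.
  by move=> x _; rewrite fineK//; exact: integrable_fin_num (i2 x).
rewrite [RHS](eq_integral (fun y => \int[m1]_x (F (x, y))%:E)%E); last first.
  by move=> y _; rewrite fineK//; exact: integrable_fin_num (i1 y).
move: ih i1 i2; have [n1 ->] := finite_measure_of fm1; have [n2 n2E] := finite_measure_of fm2.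
rewrite !n2E => ih i1 i2.
apply: (@Fubini _ _ _ _ _ n1 n2 (EFin \o F)).
apply/integrable12ltyP; first exact/measurable_EFinP.
apply: (@le_lt_trans _ _ (\int[n1]_x (`|h x|%:E * n2 setT)))%E.
  apply: ge0_le_integral => //.
  - by move=> x _; exact: integral_ge0.
  - have mabsF : measurable_fun setT (fun z => `|(EFin \o F) z|)%E.
      by apply: measurableT_comp => //; exact/measurable_EFinP.
    exact: (measurable_fun_fubini_tonelli_F (m2 := n2) _ mabsF (fun=> abse_ge0 _)).
  - apply: emeasurable_funM => //; apply/measurable_EFinP; apply: measurableT_comp => //.
    exact/measurable_EFinP/(measurable_int n1).
  - move=> x _; rewrite -integral_cst//; apply: ge0_le_integral => //.
    + apply: measurableT_comp => //; exact: (measurable_int n2 (i2 x)).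
    + by move=> y _; rewrite lee_fin (le_trans (Fh x y))// ler_norm.
rewrite ge0_integralZr//.
- apply: lte_mul_pinfty => //.
  + exact: integral_ge0.
  + have := integrable_fin_num measurableT (integrable_abse ih); apply.
  + by rewrite ltey_eq fin_num_measure.
- apply/measurable_EFinP; apply: measurableT_comp => //.
  exact/measurable_EFinP/(measurable_int n1).
Qed.

Lemma cintegral_swap (F : X * Y -> R[i]) (h : X -> R) :
  cmeasurable F -> m1.-integrable setT (EFin \o h) ->
  (forall x y, Normc.normc (F (x, y)) <= h x) ->
  cintegral m1 (fun x => cintegral m2 (fun y => F (x, y))) =
  cintegral m2 (fun y => cintegral m1 (fun x => F (x, y))).
Proof.
move=> [F1 F2] ih Fh; apply: complex_eq => /=.
  apply: (Rintegral_swap F1 ih) => x y.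
  by rewrite (le_trans _ (Fh x y))// le_Re_normc.
apply: (Rintegral_swap F2 ih) => x y.
by rewrite (le_trans _ (Fh x y))// le_Im_normc.
Qed.

End Fubini.

(** * Density in L1 of a linear space containing the indicators of a pi-system *)

Section DenseInL1.
Local Open Scope ereal_scope.
Context {d} {T : measurableType d} {R : realType}.
Variable m : {finite_measure set T -> \bar R}.
Variable L : set (T -> R).
Hypothesis L_bounded : forall g, L g ->
  measurable_fun setT g /\ exists M : R, forall x, (`|g x| <= M)%R.
Hypothesis L_lin : forall a g h, L g -> L h -> L (fun x => a * g x + h x)%R.

Definition L1_approx (f : T -> R) := forall e : R, (0 < e)%R ->
  exists2 g, L g & \int[m]_x (`|f x - g x|)%:E <= e%:E.

Let mabs (f g : T -> R) : measurable_fun setT f -> measurable_fun setT g ->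
  measurable_fun setT (fun x => (`|f x - g x|)%:E).
Proof.
move=> mf mg; apply/measurable_EFinP; apply: measurableT_comp => //.
exact: measurable_funB.
Qed.

Lemma L1_approx_of (f : T -> R) : L f -> L1_approx f.
Proof.
move=> Lf e e0; exists f => //; under eq_integral do rewrite subrr normr0.
by rewrite integral0 lee_fin ltW.
Qed.

Lemma L1_approx_lin a (f h : T -> R) : measurable_fun setT f -> measurable_fun setT h ->
  L1_approx f -> L1_approx h -> L1_approx (fun x => a * f x + h x)%R.
Proof.
move=> mf mh af ah e e0.
have e1 : (0 < e / (2 * (`|a| + 1)))%R by rewrite divr_gt0// mulr_gt0// ltr_wpDl.
have e2 : (0 < e / 2)%R by rewrite divr_gt0.
have [g Lg fg] := af _ e1; have [k Lk hk] := ah _ e2.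
have [mg _] := L_bounded Lg; have [mk _] := L_bounded Lk.
exists (fun x => a * g x + k x)%R; first exact: L_lin.
apply: (@le_trans _ _ (\int[m]_x (`|a|%:E * (`|f x - g x|)%:E + (`|h x - k x|)%:E))).
  apply: ge0_le_integral => //.
  - by apply: mabs; apply: measurable_funD => //; exact: measurable_funM.
  - by apply: emeasurable_funD; [apply: emeasurable_funM => //; exact: mabs|exact: mabs].
  - move=> x _; rewrite -EFinM -EFinD lee_fin -normrM (le_trans _ (ler_normD _ _))//.
    by rewrite opprD addrACA mulrBr.
rewrite ge0_integralD//; last 2 first.
- by apply: emeasurable_funM => //; exact: mabs.
- exact: mabs.
rewrite ge0_integralZl//; last exact: mabs.
rewrite [e]splitr EFinD leeD//.
apply: (@le_trans _ _ (`|a|%:E * (e / (2 * (`|a| + 1)))%:E)); first by apply: lee_wpmul2l; rewrite ?lee_fin.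
have a1 : (0 < `|a| + 1)%R by rewrite ltr_wpDl.
rewrite -EFinM lee_fin.
have -> : (`|a| * (e / (2 * (`|a| + 1))) = e / 2 * (`|a| / (`|a| + 1)))%R.
  by field; rewrite gt_eqF.
by rewrite ler_piMr ?(ltW e2)// ler_pdivrMr// mul1r lerDl.
Qed.

Lemma L1_approx_closed (f : T -> R) : measurable_fun setT f ->
  (forall e : R, (0 < e)%R -> exists h, [/\ measurable_fun setT h, L1_approx h &
    \int[m]_x (`|f x - h x|)%:E <= e%:E]) -> L1_approx f.
Proof.
move=> mf hf e e0; have e2 : (0 < e / 2)%R by rewrite divr_gt0.
have [h [mh ah fh]] := hf _ e2; have [g Lg hg] := ah _ e2; exists g => //.
have [mg _] := L_bounded Lg.
apply: (@le_trans _ _ (\int[m]_x ((`|f x - h x|)%:E + (`|h x - g x|)%:E))).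
  apply: ge0_le_integral => //; [exact: mabs|by apply: emeasurable_funD; exact: mabs|].
  by move=> x _; rewrite -EFinD lee_fin ler_distD.
rewrite ge0_integralD//; [|exact: mabs|exact: mabs].
by rewrite [e]splitr EFinD leeD.
Qed.

Variable G : set (set T).
Hypotheses (GI : setI_closed G) (GE : @measurable _ T = <<s G >>).
Hypotheses (L1 : L (fun=> 1%R)) (GL : forall A, G A -> L (\1_A)).

(** The sets with an approximable indicator form a lambda-system: proper differences by linearity,
    increasing unions by continuity of the finite measure. *)
Lemma L1_approx_indic A : measurable A -> L1_approx (\1_A).
Proof.
pose D := [set A | measurable A /\ L1_approx (\1_A)].
suff : @measurable _ T `<=` D by move=> h /h[].
rewrite GE; apply: lambda_system_subset => //; last first.
  move=> B GB; split; last exact/L1_approx_of/GL.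
  by rewrite GE; exact: sub_sigma_algebra.
split => //.
- by split; [exact: measurableT|rewrite indicT; exact: L1_approx_of].
- move=> B B' B'B [mB aB] [mB' aB']; split; first exact: measurableD.
  rewrite (_ : \1_(B `\` B') = (fun x => -1 * \1_B' x + \1_B x)%R).
    exact: L1_approx_lin.
  apply/funext => x; rewrite mulN1r addrC !indicE in_setD.
  have [/set_mem xB'|] := boolP (x \in B'); first by rewrite (mem_set (B'B _ xB')) subrr.
  by rewrite subr0; case: (x \in B).
- move=> F ndF DF; have mF n : measurable (F n) by have [] := DF n.
  have mU : measurable (\bigcup_i F i) by exact: bigcup_measurable.
  split => //; apply: L1_approx_closed => // e e0.
  have fin B : measurable B -> m B \is a fin_num by exact: fin_num_measure.
  have cF : fine (m (F n)) @[n --> \oo] --> fine (m (\bigcup_i F i)).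
    by apply: fine_cvg; rewrite fineK ?fin//; exact: nondecreasing_cvg_mu.
  have /cvgrPdist_le/(_ _ e0)[n _ /(_ n (leqnn n)) Fn] := cF.
  exists (\1_(F n)); split => //; first by have [] := DF n.
  have FU : F n `<=` \bigcup_i F i by exact: bigcup_sup.
  rewrite (eq_integral (fun x => (\1_(\bigcup_i F i `\` F n) x)%:E)); last first.
    move=> x _; congr (_%:E); rewrite !indicE in_setD.
    have [/set_mem xF|] := boolP (x \in F n).
      by rewrite (mem_set (FU _ xF)) subrr normr0.
    by rewrite andbT subr0 ger0_norm.
  rewrite integral_indic ?setIT//; last exact: measurableD.
  rewrite [leLHS](_ : _ = (fine (m (\bigcup_i F i)) - fine (m (F n)))%:E); last first.
    rewrite EFinB !fineK ?fin// measureD//; last by rewrite ltey_eq fin.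
    by congr (_ - m _)%E; rewrite setIidr.
  by rewrite lee_fin; exact: le_trans (ler_norm _) Fn.
Qed.

Local Open Scope ring_scope.

(** Up to [eta], the function f + M is [eta] times the number of levels (j + 1) [eta] that it
    reaches, a finite combination of indicators; [k] levels are enough since f + M <= 2 M. *)
Lemma L1_approx_bounded (f : T -> R) (M : R) : measurable_fun setT f ->
  (forall x, `|f x| <= M) -> L1_approx f.
Proof.
move=> mf fM; apply: L1_approx_closed => // e e0.
have mTE : m setT \is a fin_num by rewrite fin_num_measure.
pose mT := fine (m setT); have mT0 : 0 <= mT by exact: fine_ge0.
pose eta := e / (mT + 1); have eta0 : 0 < eta by rewrite divr_gt0// ltr_wpDl.
pose k := (Num.trunc ((M + M) / eta)).+1.
pose A j := [set x | j%:R * eta <= f x + M].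
have mA j : measurable (A j).
  have := measurable_funD mf (measurable_cst M) measurableT (measurable_itv `[j%:R * eta, +oo[).
  rewrite setTI; congr measurable; apply/seteqP.
  by split => x /=; rewrite in_itv/= andbT.
pose h n x := \sum_(j < n) eta * \1_(A j.+1) x + (- M).
have hS n : h n.+1 = fun x => eta * \1_(A n.+1) x + h n x.
  by apply/funext => x; rewrite /h big_ord_recr/= addrAC addrC addrA.
have mh n : measurable_fun setT (h n).
  elim: n => [|n IH]; first by rewrite /h; under eq_fun do rewrite big_ord0 add0r; exact: measurable_cst.
  rewrite hS; apply: measurable_funD => //; exact: measurable_funM.
have ah n : L1_approx (h n).
  elim: n => [|n IH]; last first.
    by rewrite hS; apply: L1_approx_lin => //; exact: L1_approx_indic.
  have L0 : L (fun=> 0).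
    by have := L_lin (-1) L1 L1; rewrite (_ : (fun _ => _) = fun=> 0)//; apply/funext => x; rewrite mulN1r addNr.
  apply: L1_approx_of; have := L_lin (- M) L1 L0; congr L; apply/funext => x.
  by rewrite /h big_ord0 mulr1 addr0 add0r.
exists (h k); split => //.
have fh x : `|f x - h k x| <= eta.
  have /ler_normlP[f1 f2] := fM x.
  have fM0 : 0 <= f x + M by lra.
  pose t := (f x + M) / eta; have t0 : 0 <= t by rewrite divr_ge0// ltW.
  have tk : (Num.trunc t < k)%N by rewrite ltnS le_truncn// ler_pM2r ?invr_gt0// lerD2r.
  have -> : h k x = eta * (Num.trunc t)%:R - M.
    rewrite /h -mulr_sumr; congr (_ * _ - _).
    rewrite (eq_bigr (fun j : 'I_k => (j < Num.trunc t)%:R)); last first.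
      move=> j _; rewrite indicE mem_setE /A; congr (nat_of_bool _)%:R.
      by rewrite truncn_ge_nat// /t ler_pdivlMr.
    rewrite -natr_sum -(big_mkord predT (fun j => nat_of_bool (j < Num.trunc t)%N)).
    rewrite (big_cat_nat (n := Num.trunc t)) ?(ltnW tk)//=.
    rewrite (eq_big_nat _ _ (F2 := fun=> 1%N)); last by move=> i /andP[_ ->].
    rewrite [X in (_ + X)%N](eq_big_nat _ _ (F2 := fun=> 0%N)); last first.
      by move=> i /andP[ti _]; rewrite ltnNge ti.
    by rewrite !sum_nat_const_nat subn0 muln1 muln0 addn0.
  have /andP[] := trunc_itv t0; rewrite -natr1; move: (Num.trunc t)%:R => n.
  rewrite /t ler_pdivlMr// ltr_pdivrMr// mulrDl mul1r => h1 h2.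
  by rewrite ler_norml; move: h1 h2; rewrite [eta * _]mulrC; lra.
apply: (@le_trans _ _ (\int[m]_x (cst eta%:E x))%E).
  apply: ge0_le_integral => //; first exact: mabs.
  by move=> x _; rewrite lee_fin.
rewrite integral_cst// [leLHS](_ : _ = (eta * mT)%:E); last first.
  by rewrite (EFinM eta mT); congr (_ * _)%E; apply/esym/fineK.
rewrite lee_fin; by rewrite /eta mulrAC ler_pdivrMr ?ltr_wpDl// ler_wpM2l ?(ltW e0)// lerDl.
Qed.

End DenseInL1.

Section FiniteRankOn.
Variables (R : realType) (V : lmodType R[i]) (N : V -> R) (B : set V).
Hypothesis sB : is_subspace B.

Lemma subspace_lin a f g : B f -> B g -> B (a *: f + g).
Proof.
by move=> Bf Bg; have [_ h] := sB; have := h a f g; rewrite !inE; exact.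
Qed.

Lemma subspace_zero : B 0.
Proof. by have [+ _] := sB; rewrite inE. Qed.

Lemma lin_on_sum (Y : lmodType R[i]) (A : V -> Y) (I : Type) (s : seq I) (c : I -> R[i]) (e : I -> V) :
  lin_on B A -> (forall i, B (e i)) ->
  B (\sum_(i <- s) c i *: e i) /\ A (\sum_(i <- s) c i *: e i) = \sum_(i <- s) c i *: A (e i).
Proof.
move=> lA Be; elim: s => [|i s [IB IA]].
  rewrite !big_nil; split; first exact: subspace_zero.
  have := lA (-1) 0 0 subspace_zero subspace_zero.
  by rewrite !scaleN1r !addNr.
rewrite !big_cons; split; first exact: subspace_lin.
by rewrite lA// IA.
Qed.

Lemma fin_rank_on_comp_l A K : blin_on N B A -> fin_rank_on N B K -> fin_rank_on N B (A \o K).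
Proof.
move=> [hA lA _] [r [c [e [Be lc bc KE]]]]; exists r, c, (A \o e); split => //.
- by move=> i; exact/hA.
- by move=> f Bf /=; rewrite KE//; have [_ ->] := lin_on_sum (index_enum 'I_r) (c f 0) lA Be.
Qed.

End FiniteRankOn.

Section ConstantKernel.
Context {d} {E : measurableType d} {R : realType}.

(** A probability as a constant kernel, so that integral operators against [nu] and kernel operators
    share one theory. *)
Definition kconst (nu : probability E R) (x : E) : {measure set E -> \bar R} := nu.

Variable nu : probability E R.

Let measurable_kconst U : measurable U -> measurable_fun setT (kconst nu ^~ U).
Proof. by move=> mU; exact: measurable_cst. Qed.

HB.instance Definition _ := isKernel.Build _ _ _ _ R (kconst nu) measurable_kconst.

Let kconst_uub : measure_fam_uub (kconst nu).
Proof.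
exists 2 => x; rewrite [ltLHS](_ : _ = 1%E); last exact: probability_setT.
by rewrite lte_fin ltr1n.
Qed.

HB.instance Definition _ := Kernel_isFinite.Build _ _ _ _ R (kconst nu) kconst_uub.

End ConstantKernel.

Section PullbackKernel.
Context {d d'} {X : measurableType d} {E : measurableType d'} {R : realType}.

(** Lets a kernel ignore part of its source: along the first projection it makes the density of a
    product jointly measurable, along the second it turns [mkcomp] into the composition of two
    kernels. *)
Definition kpull (g : X -> E) (mg : measurable_fun setT g) (S : R.-fker E ~> E) (z : X) :
  {measure set E -> \bar R} := S (g z).

Variables (g : X -> E) (mg : measurable_fun setT g) (S : R.-fker E ~> E).

Let measurable_kpull U : measurable U -> measurable_fun setT (kpull mg S ^~ U).
Proof. by move=> mU; apply: (measurableT_comp (measurable_kernel S U mU)). Qed.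

HB.instance Definition _ := isKernel.Build _ _ _ _ R (kpull mg S) measurable_kpull.

Let kpull_uub : measure_fam_uub (kpull mg S).
Proof. by have [r hr] := measure_uub S; exists r => z; exact: hr. Qed.

HB.instance Definition _ := Kernel_isFinite.Build _ _ _ _ R (kpull mg S) kpull_uub.

End PullbackKernel.

(** * Approximation of bounded densities by rectangle sums *)

Section RectangleSums.
Context {d : measure_display} {E : measurableType d} {R : realType}.
Local Notation C := R[i].
Local Notation normc := (@Normc.normc R).
Variable nu : probability E R.

Definition rectangle_sum (s : seq (C * (set E * set E))) (z : E * E) : C :=
  \sum_(q <- s) q.1 * ((\1_(q.2.1) z.1 * \1_(q.2.2) z.2)%:C)%C.

Definition measurable_rectangles (s : seq (C * (set E * set E))) :=
  forall q, q \in s -> measurable q.2.1 /\ measurable q.2.2.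

Let L : set (E * E -> R) := [set g | exists2 s : seq (C * (set E * set E)),
  measurable_rectangles s & forall z, ((g z)%:C)%C = rectangle_sum s z].

Lemma measurable_rectangle_indic (A B : set E) : measurable A -> measurable B ->
  measurable_fun setT (fun z : E * E => \1_A z.1 * \1_B z.2 : R).
Proof.
move=> mA mB.
have hA : measurable_fun setT (\1_A : E -> R) by exact: measurable_indic.
have hB : measurable_fun setT (\1_B : E -> R) by exact: measurable_indic.
by apply: measurable_funM; [exact: (measurableT_comp hA)|exact: (measurableT_comp hB)].
Qed.

Lemma rectangle_sum_cmeasurable s : measurable_rectangles s -> cmeasurable (rectangle_sum s).
Proof.
rewrite /rectangle_sum; elim: s => [_|q s IH ms].
  by under eq_fun do rewrite big_nil; exact: cmeasurable_cst.
under eq_fun do rewrite big_cons.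
apply: cmeasurableD; last by apply: IH => q' q's; apply: ms; rewrite inE q's orbT.
have [mA mB] := ms q (mem_head _ _).
apply: cmeasurableM; first exact: cmeasurable_cst.
by apply: cmeasurable_real; exact: measurable_rectangle_indic.
Qed.

Lemma indic_norm_le1 (A : set E) x : `|\1_A x| <= 1 :> R.
Proof. by rewrite indicE; case: (x \in A) => /=; rewrite ?normr1 ?normr0. Qed.

Lemma rectangle_sum_bounded s z : normc (rectangle_sum s z) <= \sum_(q <- s) normc q.1.
Proof.
rewrite (le_trans (normc_sum _ _ _))//; apply: ler_sum => q _.
rewrite Normc.normcM normc_real ler_piMr ?normc_ge0// normrM.
by rewrite -[leRHS]mulr1 ler_pM// indic_norm_le1.
Qed.

Lemma rectangle_sum_cat s t z : rectangle_sum (s ++ t) z = rectangle_sum s z + rectangle_sum t z.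
Proof. by rewrite /rectangle_sum big_cat. Qed.

Lemma rectangle_sum_scale a s z :
  rectangle_sum [seq (a * q.1, q.2) | q <- s] z = a * rectangle_sum s z.
Proof. by rewrite /rectangle_sum big_map mulr_sumr; apply: eq_bigr => q _; rewrite mulrA. Qed.

Lemma measurable_rectangles_scale a s : measurable_rectangles s ->
  measurable_rectangles [seq (a * q.1, q.2) | q <- s].
Proof. by move=> ms q' /mapP[q qs ->] /=; exact: (ms q). Qed.

Lemma measurable_rectangles_cat s t : measurable_rectangles s -> measurable_rectangles t ->
  measurable_rectangles (s ++ t).
Proof. by move=> ms mt q; rewrite mem_cat => /orP[/ms|/mt]. Qed.

Lemma rectangle_dense (f : E * E -> R) M : measurable_fun setT f -> (forall z, `|f z| <= M) ->
  forall e : R, 0 < e -> exists2 g, L g & (\int[(nu \x nu)%E]_z (`|f z - g z|)%:E <= e%:E)%E.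
Proof.
move=> mf fM.
have fin : fin_num_fun (nu \x nu)%E.
  apply: lty_fin_num_fun; have -> : [set: E * E] = setT `*` setT by rewrite setXTT.
  rewrite [ltLHS](_ : _ = (nu setT * nu setT)%E); last exact: product_measure1E.
  by rewrite probability_setT mule1 ltry.
have [m mE] := finite_measure_of fin => e e0.
suff /(_ e e0)[g Lg fg] : L1_approx m L f.
  exists g => //; rewrite (le_trans _ fg)// le_eqVlt; apply/orP; left; apply/eqP.
  by apply: eq_measure_integral => A mA _; rewrite -mE.
clear e e0.
apply: (@L1_approx_bounded _ _ _ m L _ _ [set A `*` B | A in measurable & B in measurable] _ _ _ _ f M mf fM).
- move=> g [s ms gE]; have gE' : g = fun z => complex.Re (rectangle_sum s z).
    by apply/funext => z; rewrite -gE.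
  split; first by have [] := rectangle_sum_cmeasurable ms; rewrite gE'.
  exists (\sum_(q <- s) normc q.1) => z.
  by rewrite gE' (le_trans (le_Re_normc _))// rectangle_sum_bounded.
- move=> a g h [s ms gE] [t mt hE]; exists ([seq ((a%:C)%C * q.1, q.2) | q <- s] ++ t).
    by apply: measurable_rectangles_cat => //; exact: measurable_rectangles_scale.
  by move=> z; rewrite rectangle_sum_cat rectangle_sum_scale -gE -hE rmorphD rmorphM.
- move=> _ _ [X1 mX1 [X2 mX2 <-]] [Y1 mY1 [Y2 mY2 <-]].
  exists (X1 `&` Y1); first exact: measurableI.
  exists (X2 `&` Y2); [exact: measurableI|exact: setXI].
- exact: measurable_prod_measurableType.
- exists [:: (1, (setT, setT))]; first by move=> q; rewrite inE => /eqP -> /=; split.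
  by move=> z; rewrite /rectangle_sum big_seq1 /= !indicT /= mulr1 mul1r.
- move=> _ [A mA [B mB <-]]; exists [:: (1, (A, B))]; first by move=> q; rewrite inE => /eqP -> /=; split.
  by move=> z; rewrite /rectangle_sum big_seq1/= mul1r !indicE in_setX; case: (_ \in A); rewrite ?mul1r ?mul0r.
Qed.

Lemma rectangle_sum_dense (b : E * E -> C) M : cmeasurable b -> (forall z, normc (b z) <= M) ->
  forall e : R, 0 < e -> exists2 s, measurable_rectangles s &
    (\int[nu]_x \int[nu]_y (normc (b (x, y) - rectangle_sum s (x, y)))%:E <= e%:E)%E.
Proof.
move=> mb bM e e0; have [b1 b2] := mb.
have e2 : 0 < e / 2 by rewrite divr_gt0.
have [|g1 [s1 m1 g1E] h1] := @rectangle_dense _ M b1 _ _ e2.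
  by move=> z; rewrite (le_trans (le_Re_normc _)).
have [|g2 [s2 m2 g2E] h2] := @rectangle_dense _ M b2 _ _ e2.
  by move=> z; rewrite (le_trans (le_Im_normc _)).
have ms : measurable_rectangles (s1 ++ [seq ('i%C * q.1, q.2) | q <- s2]).
  by apply: measurable_rectangles_cat => //; exact: measurable_rectangles_scale.
exists (s1 ++ [seq ('i%C * q.1, q.2) | q <- s2]) => //.
have mdiff : measurable_fun setT (fun z =>
    (normc (b z - rectangle_sum (s1 ++ [seq ('i%C * q.1, q.2) | q <- s2]) z))%:E).
  apply/measurable_EFinP/measurable_normc/cmeasurableB => //.
  exact: rectangle_sum_cmeasurable.
rewrite -(fubini_tonelli1 _ mdiff); last by move=> z; rewrite lee_fin normc_ge0.
have mg (g f : E * E -> R) s : measurable_fun setT f -> measurable_rectangles s ->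
    (forall z, ((g z)%:C)%C = rectangle_sum s z) -> measurable_fun setT (fun z => (`|f z - g z|)%:E).
  move=> mf m gE; apply/measurable_EFinP; apply: measurableT_comp => //; apply: measurable_funB => //.
  have [h _] := rectangle_sum_cmeasurable m.
  by rewrite (_ : g = fun z => complex.Re (rectangle_sum s z))//; apply/funext => z; rewrite -gE.
apply: (@le_trans _ _ (\int[(nu \x nu)%E]_z ((`|complex.Re (b z) - g1 z|)%:E + (`|complex.Im (b z) - g2 z|)%:E))%E).
  apply: ge0_le_integral => //.
  - by move=> z _; rewrite lee_fin normc_ge0.
  - by apply: emeasurable_funD; [exact: mg g1E|exact: mg g2E].
  - move=> z _; rewrite -EFinD lee_fin rectangle_sum_cat rectangle_sum_scale -g1E -g2E.
    rewrite (le_trans (normc_le_ReIm _))// !ReD !ImD !ReN !ImN !ReD !ImD /=.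
    by rewrite !mul0r !mulr0 !mul1r !subr0 !add0r !addr0.
rewrite ge0_integralD//; [|exact: mg g1E|exact: mg g2E].
by rewrite [e]splitr EFinD leeD.
Qed.

End RectangleSums.

(** * Integral operators with a bounded density *)

Section DensityOperators.
Context {d : measure_display} {E : measurableType d} {R : realType}.
Local Notation C := R[i].
Local Notation normc := (@Normc.normc R).
Variable w : E -> R.
Hypotheses (w_ge1 : forall x, 1 <= w x) (w_meas : measurable_fun setT w).
Variable nu : probability E R.
Local Notation B := (wspace w).
Local Notation N := (wnorm w).
Implicit Types (f : E -> R[i]^o) (b : E * E -> C).

Let w0 x : 0 < w x. Proof. exact: lt_le_trans (w_ge1 x). Qed.
Let w0' x : 0 <= w x. Proof. exact: ltW. Qed.
Let sB : is_subspace B. Proof. exact: wspace_subspace. Qed.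

(* Integral operators with respect to [nu], normalized so that a kernel [b]
   bounded by [M] gives an operator of norm at most [M] on [B_w]. *)
Definition normalized (b : E * E -> C) (z : E * E) : C := ((w z.1 / w z.2)%:C)%C * b z.
Definition density_op (b : E * E -> C) := kernel_op_weight (kconst nu) (normalized b).

Lemma measurable_wfst : measurable_fun setT (fun z : E * E => w z.1).
Proof. exact: (measurableT_comp w_meas measurable_fst). Qed.

Lemma measurable_winv : measurable_fun setT (fun x => (w x)^-1).
Proof.
rewrite (_ : (fun x => _) = fun x => w x `^ (-1)); last first.
  by apply/funext => x; rewrite powR_inv1.
exact: (measurableT_comp (measurable_powR (-1)) w_meas).
Qed.

Lemma normalized_cmeasurable b : cmeasurable b -> cmeasurable (normalized b).
Proof.
move=> mb; apply: cmeasurableM => //; apply: cmeasurable_real.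
apply: measurable_funM; first exact: measurable_wfst.
exact: (measurableT_comp measurable_winv measurable_snd).
Qed.

Lemma prob_integral_le (g : E -> R) (K : R) : 0 <= K -> measurable_fun setT g ->
  (forall y, g y <= K) -> (forall y, 0 <= g y) -> (\int[nu]_y (g y)%:E <= K%:E)%E.
Proof.
move=> K0 mg gK g0; apply: (@le_trans _ _ (\int[nu]_y (cst K%:E y))%E).
  apply: ge0_le_integral => //; first by move=> y _; rewrite lee_fin.
    exact/measurable_EFinP.
  by move=> y _; rewrite lee_fin.
rewrite integral_cst// [X in (_ * X)%E](_ : _ = 1%E) ?mule1//.
exact: probability_setT.
Qed.

Lemma prob_integrable_bounded (g : E -> R) (K : R) : measurable_fun setT g ->
  (forall y, `|g y| <= K) -> nu.-integrable setT (EFin \o g).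
Proof.
move=> mg gK; apply/integrableP; split; first exact/measurable_EFinP.
have [x0|nx] := pselect (exists x : E, True); last first.
  by rewrite (_ : setT = set0) ?integral_set0//; apply/seteqP; split => // x _; case: nx; exists x.
have K0 : 0 <= K by have [x _] := x0; exact: le_trans (normr_ge0 _) (gK x).
by rewrite (le_lt_trans (prob_integral_le K0 _ gK _)) ?ltry//; exact: measurableT_comp.
Qed.

Lemma normalized_norm b x y : normc (normalized b (x, y)) = w x / w y * normc (b (x, y)).
Proof.
by rewrite Normc.normcM normc_real ger0_norm// divr_ge0.
Qed.

Lemma normalized_dominated b M : 0 <= M -> cmeasurable b -> (forall z, normc (b z) <= M) ->
  kernel_dominated w (kconst nu) (normalized b) M.
Proof.
move=> M0 mb bM x; apply: prob_integral_le.
- by rewrite mulr_ge0.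
- apply: measurable_funM => //; apply: measurable_normc.
  by apply: cmeasurable_section => //; exact: normalized_cmeasurable.
- move=> y; rewrite normalized_norm.
  have -> : w x / w y * normc (b (x, y)) * w y = normc (b (x, y)) * w x.
    by field; rewrite gt_eqF.
  by rewrite ler_wpM2r.
- by move=> y; rewrite mulr_ge0// normc_ge0.
Qed.

Lemma density_op_blin b M : 0 <= M -> cmeasurable b -> (forall z, normc (b z) <= M) ->
  blin_on N B (density_op b).
Proof.
move=> M0 mb bM; apply: (kernel_op_weight_blin w_ge1 w_meas _ (normalized_dominated M0 mb bM)) => //.
exact: normalized_cmeasurable.
Qed.

Lemma density_op_integrable b M f x : 0 <= M -> cmeasurable b -> (forall z, normc (b z) <= M) ->
  B f -> cintegrable nu (fun y => f y * normalized b (x, y)).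
Proof.
move=> M0 mb bM Bf.
exact: (kernel_op_weight_integrable w_ge1 w_meas (normalized_cmeasurable mb)
  (normalized_dominated M0 mb bM) x Bf).
Qed.

Lemma density_op_sub b b' M f : 0 <= M -> cmeasurable b -> cmeasurable b' ->
  (forall z, normc (b z) <= M) -> (forall z, normc (b' z) <= M) -> B f ->
  density_op b f - density_op b' f = density_op (fun z => b z - b' z) f.
Proof.
move=> M0 mb mb' bM b'M Bf; apply/funext => x.
have i1 := density_op_integrable x M0 mb bM Bf.
have i2 := density_op_integrable x M0 mb' b'M Bf.
transitivity (cintegral nu (fun y => f y * normalized b (x, y)) -
  cintegral nu (fun y => f y * normalized b' (x, y)) : C); first by [].
rewrite -cintegralB//; apply: eq_cintegral => y.
by rewrite /normalized !mulrBr.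
Qed.

Lemma density_op_L1 b f M x : 0 <= M -> cmeasurable b -> (forall z, normc (b z) <= M) -> B f ->
  normc (density_op b f x) <= w x * N f * Rintegral nu setT (fun y => normc (b (x, y))).
Proof.
move=> M0 mb bM Bf.
have mbx : measurable_fun setT (fun y => normc (b (x, y))).
  exact/measurable_normc/cmeasurable_section.
have ib : nu.-integrable setT (EFin \o (fun y => normc (b (x, y)))).
  by apply: (prob_integrable_bounded mbx (K := M)) => y; rewrite ger0_norm// normc_ge0.
have i1 := density_op_integrable x M0 mb bM Bf.
rewrite -RintegralZl//; apply: normc_cintegral_le_dom.
- exact: (cintegrable_cmeasurable i1).
- move=> y; rewrite Normc.normcM normalized_norm mulrA ler_wpM2r ?normc_ge0//.
  rewrite mulrC -mulrA ler_wpM2l// mulrC ler_pdivrMr//.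
  exact: normc_le_wnorm.
- exact: (integrableZl measurableT (w x * N f) ib).
Qed.

(** The outer operator integrates the pointwise bound of [density_op_L1] against [nu], so that only
    the double integral of |h| enters. For a single operator the supremum over the first variable
    would remain. *)
Lemma density_op_comp_L1 b h f M M' e : 0 <= M -> cmeasurable b -> (forall z, normc (b z) <= M) ->
  0 <= M' -> cmeasurable h -> (forall z, normc (h z) <= M') -> B f -> 0 <= e ->
  (\int[nu]_x \int[nu]_y (normc (h (x, y)))%:E <= e%:E)%E ->
  N (density_op b (density_op h f)) <= M * e * N f.
Proof.
move=> M0 mb bM M'0 mh hM' Bf e0 he.
have Nf : 0 <= N f by exact: wnorm_ge0.
apply: wnorm_le => //; first by rewrite !mulr_ge0.
move=> x; have [hB _ _] := density_op_blin M'0 mh hM'.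
have i1 := density_op_integrable x M0 mb bM (hB _ Bf).
pose I y := Rintegral nu setT (fun t => normc (h (y, t))).
have I0 y : 0 <= I y by apply: Rintegral_ge0 => t _; exact: normc_ge0.
have mI : measurable_fun setT I.
  exact: (measurable_fun_Rintegral_kernel (kconst nu) (measurable_normc mh)).
have mhy y : measurable_fun setT (fun t => normc (h (y, t))).
  exact/measurable_normc/cmeasurable_section.
have ih y : nu.-integrable setT (EFin \o (fun t => normc (h (y, t)))).
  by apply: (prob_integrable_bounded (mhy y) (K := M')) => t; rewrite ger0_norm// normc_ge0.
have IE y : ((I y)%:E = \int[nu]_t (normc (h (y, t)))%:E)%E.
  by rewrite /I /Rintegral fineK//; exact: integrable_fin_num (ih y).
have IM y : `|I y| <= M'.
  rewrite ger0_norm// -lee_fin IE; apply: prob_integral_le => // t; exact: normc_ge0.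
have iI : nu.-integrable setT (EFin \o I) by exact: prob_integrable_bounded IM.
apply: (@le_trans _ _ (Rintegral nu setT (fun y => w x * M * N f * I y))).
  apply: normc_cintegral_le_dom.
  - exact: (cintegrable_cmeasurable i1).
  - move=> y; rewrite Normc.normcM normalized_norm.
    apply: (@le_trans _ _ (w y * N f * I y * (w x / w y * M))).
      apply: ler_pM; rewrite ?normc_ge0 ?mulr_ge0 ?normc_ge0 ?invr_ge0//.
        exact: density_op_L1 M'0 mh hM' Bf.
      by rewrite ler_wpM2l// divr_ge0.
    by rewrite le_eqVlt; apply/orP; left; apply/eqP; field; rewrite gt_eqF.
  - exact: (integrableZl measurableT (w x * M * N f) iI).
rewrite RintegralZl//.
have Ie : Rintegral nu setT I <= e.
  rewrite -lee_fin /Rintegral fineK; last exact: integrable_fin_num iI.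
  by under eq_integral do rewrite IE.
rewrite (_ : M * e * N f * w x = w x * M * N f * e); last by ring.
by rewrite ler_wpM2l// !mulr_ge0.
Qed.

(** The normalized indicator of A x B factors into (1_A w)(x) and (1_B / w)(y), so each rectangle
    contributes rank one. *)
Lemma density_op_rectangles s : measurable_rectangles s ->
  fin_rank_on N B (density_op (rectangle_sum s)).
Proof.
move=> ms; pose q0 : C * (set E * set E) := (0, (set0, set0)).
pose q (i : 'I_(size s)) := nth q0 s i.
have mq i : measurable (q i).2.1 /\ measurable (q i).2.2 by apply: ms; exact: mem_nth.
pose g i y : C := ((\1_(q i).2.2 y / w y)%:C)%C.
have mg i : cmeasurable (g i).
  apply: cmeasurable_real; apply: measurable_funM; last exact: measurable_winv.
  by apply: measurable_indic; have [] := mq i.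
have fg f i y : B f -> normc (f y * g i y) <= N f.
  move=> Bf; rewrite Normc.normcM normc_real normrM.
  apply: (@le_trans _ _ (N f * w y * (1 * (w y)^-1))).
    apply: ler_pM; rewrite ?normc_ge0 ?mulr_ge0//; first exact: normc_le_wnorm.
    by rewrite ler_pM// ?indic_norm_le1// ger0_norm// invr_ge0.
  by rewrite mul1r mulfK// gt_eqF.
have ig f i : B f -> cintegrable nu (fun y => f y * g i y).
  move=> Bf; apply: (@cintegrable_le _ _ _ _ _ (fun=> N f)).
  - by apply: cmeasurableM => //; exact: (wspace_cmeasurable Bf).
  - by move=> y; exact: fg.
  - apply: (prob_integrable_bounded (K := N f)) => // y.
    by rewrite ger0_norm// wnorm_ge0.
pose c f := \row_(i < size s) ((q i).1 * cintegral nu (fun y => f y * g i y)).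
pose ec (i : 'I_(size s)) x : C := ((\1_(q i).2.1 x * w x)%:C)%C.
pose e (i : 'I_(size s)) : E -> R[i]^o := ec i.
exists (size s), c, e; split.
- move=> i; apply: (@wspaceI _ _ _ _ w_ge1 _ 1).
    apply: cmeasurable_real; apply: measurable_funM => //.
    by apply: measurable_indic; have [] := mq i.
  move=> x; rewrite normc_real normrM (ger0_norm (w0' x)) ler_wpM2r//.
  exact: indic_norm_le1.
- move=> a f h Bf Bh; apply/rowP => i; rewrite !mxE.
  have iF := ig _ i Bf; have iH := ig _ i Bh.
  have -> : cintegral nu (fun y => (a *: f + h) y * g i y) =
      cintegral nu (fun y => a * (f y * g i y) + h y * g i y).
    by apply: eq_cintegral => y; rewrite [LHS]mulrDl -mulrA.
  rewrite cintegralD//; last exact: cintegrableZ.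
  by rewrite cintegralZ// mulrDr mulrCA.
- exists (\sum_i normc (q i).1); first by apply: sumr_ge0 => i _; exact: normc_ge0.
  move=> f i Bf; rewrite mxE Normc.normcM.
  apply: (@le_trans _ _ (normc (q i).1 * N f)).
    rewrite ler_wpM2l ?normc_ge0//.
    have i1 : nu.-integrable setT (EFin \o (fun=> N f)).
      by apply: (prob_integrable_bounded (K := N f)) => // y; rewrite ger0_norm// wnorm_ge0.
    apply: (le_trans (normc_cintegral_le_dom _ (fun y => fg f i y Bf) i1)).
      by have := cintegrable_cmeasurable (ig _ i Bf).
    rewrite Rintegral_cst// [X in fine X](_ : _ = 1%E) ?mulr1//.
    exact: probability_setT.
  rewrite ler_wpM2r ?wnorm_ge0// (bigD1 i)//= lerDl.
  by apply: sumr_ge0 => j _; exact: normc_ge0.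
- move=> f Bf; apply/funext => x.
  rewrite fct_sumE.
  transitivity (\sum_(i < size s) ((q i).1 * cintegral nu (fun y => f y * g i y)) * ec i x : C).
    2: by apply: eq_bigr => i _; rewrite mxE.
  have iq i : cintegrable nu (fun y => ((q i).1 * ec i x) * (f y * g i y)).
    by apply: cintegrableZ; exact: ig.
  rewrite (eq_bigr (fun i => cintegral nu (fun y => ((q i).1 * ec i x) * (f y * g i y)))); last first.
    by move=> i _; rewrite cintegralZ; [rewrite mulrAC|exact: ig].
  rewrite -cintegral_sum//; apply: eq_cintegral => y.
  rewrite /normalized /rectangle_sum (big_nth q0) big_mkord !mulr_sumr; apply: eq_bigr => i _ /=.
  rewrite -/(q i) /ec /g !rmorphM /=; ring.
Qed.

End DensityOperators.

(** * Products of operators with a uniformly integrable density *)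

Section WeaklyCompactProducts.
Context {d : measure_display} {E : measurableType d} {R : realType}.
Local Notation C := R[i].
Local Notation normc := (@Normc.normc R).
Variable w : E -> R.
Hypotheses (w_ge1 : forall x, 1 <= w x) (w_meas : measurable_fun setT w).
Variable nu : probability E R.
Variables (S : R.-fker E ~> E) (MS : R).
Hypotheses (MS0 : 0 <= MS) (SM : kernel_dominated w S (fun=> 1) MS).
Variables (theta : E * E -> C) (c : R).
Hypotheses (mtheta : cmeasurable theta) (c0 : 0 <= c) (theta_le : forall z, normc (theta z) <= c).
Local Notation B := (wspace w).
Local Notation N := (wnorm w).
Local Notation D := (density_op w nu).
Implicit Types (f : E -> R[i]^o) (b : E * E -> C).

Let w0 x : 0 < w x. Proof. exact: lt_le_trans (w_ge1 x). Qed.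
Let w0' x : 0 <= w x. Proof. exact: ltW. Qed.
Let sB : is_subspace B. Proof. exact: wspace_subspace. Qed.

Lemma fker_fin_num (k : R.-fker E ~> E) x : fin_num_fun (k x).
Proof. exact: finite_kernel_measure. Qed.

Lemma weight_integrable x : (S x).-integrable setT (EFin \o w).
Proof.
have := kernel_dominated_integrable w_ge1 w_meas x (cmeasurable_cst 1) SM.
by under eq_fun do rewrite Normc.normc1 mul1r.
Qed.

Lemma weight_Rintegral x : Rintegral (S x) setT w <= MS * w x.
Proof.
have := kernel_dominated_Rintegral w_ge1 w_meas x (cmeasurable_cst 1) SM.
by under eq_Rintegral do rewrite Normc.normc1 mul1r.
Qed.

Lemma theta_dominated : kernel_dominated w S theta (c * MS).
Proof.
move=> x; apply: (@le_trans _ _ (\int[S x]_y (c%:E * (w y)%:E)))%E.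
  apply: ge0_le_integral => //.
  - by move=> y _; rewrite lee_fin mulr_ge0// normc_ge0.
  - apply/measurable_EFinP/measurable_funM => //.
    exact/measurable_normc/cmeasurable_section.
  - by apply: emeasurable_funM => //; exact/measurable_EFinP.
  - by move=> y _; rewrite -EFinM lee_fin ler_wpM2r.
rewrite ge0_integralZl//; last 2 first.
- exact/measurable_EFinP.
- by move=> y _; rewrite lee_fin.
rewrite -mulrA EFinM lee_wpmul2l ?lee_fin//.
by have := SM x; under eq_integral do rewrite Normc.normc1 mul1r.
Qed.

Local Notation St := (kernel_op_weight S theta).

Lemma St_blin : blin_on N B St.
Proof. by apply: (kernel_op_weight_blin w_ge1 w_meas mtheta theta_dominated); exact: mulr_ge0. Qed.

(** The density of the product of [St] and [D b], before normalization: the factors w(y) and 1 /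
    w(x) compensate, so it is bounded by c M MS when |b| <= M. *)
Definition compose_density b (z : E * E) : C :=
  (((w z.1)^-1)%:C)%C * cintegral (S z.1) (fun y => theta (z.1, y) * (((w y)%:C)%C * b (y, z.2))).

Section Compose.
Variables (b : E * E -> C) (M : R).
Hypotheses (mb : cmeasurable b) (M0 : 0 <= M) (bM : forall z, normc (b z) <= M).

Let inner_le x t y : normc (theta (x, y) * (((w y)%:C)%C * b (y, t))) <= c * M * w y.
Proof.
rewrite !Normc.normcM normc_real ger0_norm// -mulrA ler_pM ?mulr_ge0 ?normc_ge0//.
by rewrite mulrC ler_wpM2r.
Qed.

Let inner_dom x : (S x).-integrable setT (EFin \o (fun y => c * M * w y)).
Proof. exact: (integrableZl measurableT (c * M) (weight_integrable x)). Qed.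

Let inner_meas x t : cmeasurable (fun y => theta (x, y) * (((w y)%:C)%C * b (y, t))).
Proof.
apply: cmeasurableM; first exact: cmeasurable_section.
apply: cmeasurableM; first exact: cmeasurable_real.
by apply: cmeasurable_comp mb _; exact: pair2_measurable.
Qed.

Lemma compose_density_cmeasurable : cmeasurable (compose_density b).
Proof.
apply: cmeasurableM.
  apply: cmeasurable_real; apply: (measurableT_comp (measurable_winv w_ge1 w_meas)).
  exact: measurable_fst.
apply: (@cmeasurable_cintegral_kernel _ _ _ _ _ (kpull measurable_fst S)
  (fun p => theta (p.1.1, p.2) * (((w p.2)%:C)%C * b (p.2, p.1.2)))).
have m11 : measurable_fun setT (fun p : E * E * E => p.1.1).
  exact: (measurableT_comp measurable_fst measurable_fst).
have m12 : measurable_fun setT (fun p : E * E * E => p.1.2).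
  exact: (measurableT_comp measurable_snd measurable_fst).
have m2 : measurable_fun setT (fun p : E * E * E => p.2) by exact: measurable_snd.
apply: cmeasurableM; first by apply: cmeasurable_comp mtheta _; exact: measurable_fun_pair.
apply: cmeasurableM; first by apply: cmeasurable_real; exact: (measurableT_comp w_meas m2).
by apply: cmeasurable_comp mb _; exact: measurable_fun_pair.
Qed.

Lemma compose_density_le z : normc (compose_density b z) <= c * M * MS.
Proof.
rewrite Normc.normcM normc_real ger0_norm ?invr_ge0// mulrC ler_pdivrMr//.
apply: (le_trans (normc_cintegral_le_dom (inner_meas _ _) (inner_le z.1 z.2) (inner_dom z.1))).
rewrite RintegralZl//; last exact: weight_integrable.
by rewrite -[leRHS]mulrA ler_wpM2l ?mulr_ge0// weight_Rintegral.
Qed.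

(** Fubini for S(x, .) and [nu]: the integrand is below c N(f) M w(y), which is integrable for S(x,
    .) and free of the other variable. *)
Lemma compose_densityE f : B f -> St (D b f) = D (compose_density b) f.
Proof.
move=> Bf; apply/funext => x.
have fN t : normc (f t) <= N f * w t by exact: normc_le_wnorm.
have Nf : 0 <= N f by exact: wnorm_ge0.
pose F (z : E * E) : C := theta (x, z.1) * (f z.2 * normalized w b z).
have mF : cmeasurable F.
  apply: cmeasurableM.
    by apply: cmeasurable_comp mtheta _; apply: measurable_fun_pair => //; exact: measurable_fst.
  apply: cmeasurableM; last exact: normalized_cmeasurable.
  by apply: (cmeasurable_comp (wspace_cmeasurable Bf)); exact: measurable_snd.
pose h y := c * (N f * M) * w y.
have ih : (S x).-integrable setT (EFin \o h).
  exact: (integrableZl measurableT (c * (N f * M)) (weight_integrable x)).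
have Fh y t : normc (F (y, t)) <= h y.
  rewrite /F [(y, t).1]/= [(y, t).2]/= 2!Normc.normcM normalized_norm// /h -[leRHS]mulrA.
  rewrite ler_pM ?mulr_ge0 ?normc_ge0 ?invr_ge0//.
  have q0 : 0 <= w y / w t by rewrite divr_ge0.
  apply: (@le_trans _ _ (N f * w t * (w y / w t * M))); last first.
    by rewrite le_eqVlt; apply/orP; left; apply/eqP; field; rewrite gt_eqF.
  apply: ler_pM => //; first exact: normc_ge0.
    by rewrite mulr_ge0// normc_ge0.
  by rewrite ler_wpM2l.
transitivity (cintegral (S x) (fun y => cintegral nu (fun t => F (y, t)))).
  apply: eq_cintegral => y; rewrite [LHS]mulrC.
  rewrite [D b f y]/(cintegral nu (fun t => f t * normalized w b (y, t))) -cintegralZ//.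
  exact: density_op_integrable M0 mb bM Bf.
rewrite (cintegral_swap _ _ mF ih Fh); [|exact: fker_fin_num|exact: (fker_fin_num (kconst nu) x)].
apply: eq_cintegral => t.
have it : cintegrable (S x) (fun y => theta (x, y) * (((w y)%:C)%C * b (y, t))).
  exact: cintegrable_le (inner_meas x t) (inner_le x t) (inner_dom x).
rewrite /normalized /compose_density /=.
transitivity (f t * (((w t)^-1)%:C)%C * cintegral (S x) (fun y => theta (x, y) * (((w y)%:C)%C * b (y, t))) : C).
  rewrite -cintegralZ//; apply: eq_cintegral => y; rewrite /F /normalized /= rmorphM /=.
  by rewrite mulrCA; ring.
have wt : (w t)^-1 = w x / w t * (w x)^-1 by field; rewrite !gt_eqF.
by rewrite [in LHS]wt [in LHS]rmorphM /= -!mulrA.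
Qed.

End Compose.

Lemma iter_density a b M : 0 <= M -> cmeasurable b -> (forall z, normc (b z) <= M) ->
  exists b' M', [/\ 0 <= M', cmeasurable b', forall z, normc (b' z) <= M' &
    forall f, B f -> iter a St (D b f) = D b' f].
Proof.
move=> M0 mb bM; elim: a => [|a [b' [M' [M'0 mb' bM' IH]]]]; first by exists b, M.
exists (compose_density b'), (c * M' * MS); split.
- by rewrite !mulr_ge0.
- exact: compose_density_cmeasurable.
- exact: compose_density_le.
- by move=> f Bf; rewrite iterS IH// (compose_densityE mb' M'0 bM').
Qed.

(** By [iter_density] the right part of the product has a bounded density, close in L1 to a
    rectangle sum; the outer [D b] converts this closeness into a norm estimate. *)
Lemma density_iter_density_limit b M a : 0 <= M -> cmeasurable b -> (forall z, normc (b z) <= M) ->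
  fin_rank_limit_on N B (D b \o iter a St \o D b).
Proof.
move=> M0 mb bM e e0.
have [b' [M' [M'0 mb' bM' b'E]]] := iter_density a M0 mb bM.
have e1 : 0 < e / (M + 1) by rewrite divr_gt0// ltr_wpDl.
have [s ms hs] := rectangle_sum_dense nu mb' bM' e1.
pose K := \sum_(q <- s) normc q.1.
have K0 : 0 <= K by apply: sumr_ge0 => q _; exact: normc_ge0.
have mr := rectangle_sum_cmeasurable ms.
have rK z : normc (rectangle_sum s z) <= K by exact: rectangle_sum_bounded.
have MK0 : 0 <= M' + K by exact: addr_ge0.
have bD := density_op_blin w_ge1 w_meas nu M0 mb bM.
exists (D b \o D (rectangle_sum s)).
  apply: fin_rank_on_comp_l => //; exact: density_op_rectangles.
move=> f Bf; rewrite /= b'E//.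
have [hD lD _] := bD.
have B1 : B (D b' f) by have [h _ _] := density_op_blin w_ge1 w_meas nu M'0 mb' bM'; exact: h.
have B2 : B (D (rectangle_sum s) f) by have [h _ _] := density_op_blin w_ge1 w_meas nu K0 mr rK; exact: h.
have -> : D b (D b' f) - D b (D (rectangle_sum s) f) = D b (D b' f - D (rectangle_sum s) f).
  have := lD (-1) _ _ B2 B1; rewrite !scaleN1r addrC => ->.
  by rewrite addrC.
have b'MK z : normc (b' z) <= M' + K by rewrite (le_trans (bM' z))// lerDl.
have rMK z : normc (rectangle_sum s z) <= M' + K by rewrite (le_trans (rK z))// lerDr.
rewrite (density_op_sub w_ge1 w_meas nu MK0 mb' mr b'MK rMK Bf).
have mdiff := cmeasurableB mb' mr.
have dM z : normc (b' z - rectangle_sum s z) <= M' + K.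
  by rewrite (le_trans (ler_normcB _ _))// lerD.
apply: (le_trans (density_op_comp_L1 w_ge1 w_meas M0 mb bM MK0 mdiff dM Bf (ltW e1) hs)).
rewrite ler_wpM2r ?wnorm_ge0// mulrCA ler_piMr ?(ltW e0)// ler_pdivrMr ?ltr_wpDl//.
by rewrite mul1r lerDl.
Qed.

Section UniformlyIntegrable.
Variable alpha : E * E -> R.
Hypothesis alpha_ui : unif_int_density w nu alpha.

Let alpha0 z : 0 <= alpha z. Proof. by case: alpha_ui. Qed.
Let malpha : measurable_fun setT alpha. Proof. by case: alpha_ui. Qed.

Lemma weighted_density_ge0 x y : 0 <= weighted_density w alpha x y.
Proof. by rewrite !mulr_ge0// invr_ge0. Qed.

Lemma measurable_weighted_density : measurable_fun setT (fun z : E * E => weighted_density w alpha z.1 z.2).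
Proof.
apply: measurable_funM; last exact: (measurableT_comp w_meas measurable_snd).
apply: measurable_funM; last by rewrite (_ : (fun x => _) = alpha)//; apply/funext => -[].
exact: (measurableT_comp (measurable_winv w_ge1 w_meas) measurable_fst).
Qed.

Lemma uniform_tail e : 0 < e -> exists2 m, 0 < m & forall x,
  (\int[nu]_(y in [set y | (m <= weighted_density w alpha x y)%R]) (weighted_density w alpha x y)%:E <= e%:E)%E.
Proof.
move=> e0; have [_ _] := alpha_ui; set F := (fun m : R => _) => cvF.
have e0' : (0 < e%:E)%E by rewrite lte_fin.
have : \forall m \near +oo%R, (F m < e%:E)%E.
  have nb : nbhs (0%E : \bar R) [set y | (y < e%:E)%E].
    by apply: open_nbhs_nbhs; split => //; exact: open_ereal_lt_ereal.
  exact: (cvF _ nb).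
(* The + 1 makes the level positive and strictly larger than the threshold [A]. *)
move=> [A [_ hA]]; pose m := Num.max A 0 + 1; exists m.
  by rewrite ltr_wpDl// le_max lexx orbT.
move=> x; apply: (@le_trans _ _ (F m)); last first.
  by apply/ltW/hA; rewrite (@le_lt_trans _ _ (Num.max A 0)) ?le_max ?lexx// ltrDl.
by apply: ereal_sup_ubound; exists x.
Qed.

(** The cut is made on the weighted density, the quantity in which uniform integrability is
    expressed: the truncated part is bounded, and the excess has a small integral uniformly in x. *)
Definition truncated (m : R) (z : E * E) : R :=
  if weighted_density w alpha z.1 z.2 < m then weighted_density w alpha z.1 z.2 else 0.

Definition excess (m : R) (z : E * E) : R := weighted_density w alpha z.1 z.2 - truncated m z.

Lemma measurable_truncated m : measurable_fun setT (truncated m).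
Proof.
apply: measurable_fun_ifT => //; last exact: measurable_weighted_density.
by apply: measurable_fun_ltr => //; exact: measurable_weighted_density.
Qed.

Local Notation dens := (fun z : E * E => theta z * ((alpha z)%:C)%C).
Local Notation dens_of g := (fun z : E * E => normalized w (fun z => theta z * ((g z)%:C)%C) z).

Lemma truncated_ge0 m z : 0 <= truncated m z.
Proof. by rewrite /truncated; case: ifP => // _; exact: weighted_density_ge0. Qed.

Lemma truncated_le m z : 0 < m -> truncated m z <= m.
Proof. by move=> m0; rewrite /truncated; case: ifP => [/ltW//|_]; exact: ltW. Qed.

Lemma excess_ge0 m z : 0 <= excess m z.
Proof.
rewrite subr_ge0 /truncated; case: ifP => // _; exact: weighted_density_ge0.
Qed.

Lemma measurable_excess m : measurable_fun setT (excess m).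
Proof. by apply: measurable_funB; [exact: measurable_weighted_density|exact: measurable_truncated]. Qed.

Lemma cmeasurable_dens_of (g : E * E -> R) : measurable_fun setT g -> cmeasurable (dens_of g).
Proof.
move=> mg; apply: normalized_cmeasurable => //; apply: cmeasurableM => //.
Qed.

(** Normalization undoes the weighting: w(x) / w(y) times the weighted density is alpha(x, y). *)
Lemma dens_split m z : dens z = dens_of (truncated m) z + dens_of (excess m) z.
Proof.
case: z => x y; rewrite /normalized /= /excess /weighted_density /=.
rewrite -mulrDr -mulrDr -rmorphD/= addrC subrK mulrCA -rmorphM/=; congr (_ * (_%:C)%C).
by field; rewrite !gt_eqF.
Qed.

Lemma dens_of_dominated (g : E * E -> R) (K : R) : measurable_fun setT g ->
  (forall z, 0 <= g z) -> 0 <= K ->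
  (forall x, (\int[nu]_y (g (x, y))%:E <= K%:E)%E) ->
  kernel_dominated w (kconst nu) (dens_of g) (c * K).
Proof.
move=> mg g0 K0 gK x.
have mgx : measurable_fun setT (fun y => g (x, y)) by exact: measurable_fun_pair2.
apply: (@le_trans _ _ (\int[nu]_y ((c * w x)%:E * (g (x, y))%:E)))%E.
  apply: ge0_le_integral => //.
  - by move=> y _; rewrite lee_fin mulr_ge0// normc_ge0.
  - apply/measurable_EFinP/measurable_funM => //; apply: measurable_normc.
    by apply: cmeasurable_section; exact: cmeasurable_dens_of.
  - by apply: emeasurable_funM => //; exact/measurable_EFinP.
  - move=> y _; rewrite -EFinM lee_fin normalized_norm// Normc.normcM normc_real ger0_norm//.
    have -> : w x / w y * (normc (theta (x, y)) * g (x, y)) * w y = normc (theta (x, y)) * (w x * g (x, y)).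
      by field; rewrite gt_eqF.
    by rewrite -mulrA ler_wpM2r// mulr_ge0.
rewrite ge0_integralZl//; last 3 first.
- exact/measurable_EFinP.
- by move=> y _; rewrite lee_fin.
- by rewrite lee_fin mulr_ge0.
rewrite (_ : c * K * w x = c * w x * K); last by ring.
by rewrite (EFinM _ K) lee_wpmul2l// lee_fin mulr_ge0.
Qed.

Lemma excess_integral_le m e x :
  (\int[nu]_(y in [set y | (m <= weighted_density w alpha x y)%R]) (weighted_density w alpha x y)%:E <= e%:E)%E ->
  (\int[nu]_y (excess m (x, y))%:E <= e%:E)%E.
Proof.
apply: le_trans; rewrite [leRHS]integral_mkcond le_eqVlt; apply/orP; left; apply/eqP.
apply: eq_integral => y _; rewrite /excess /truncated /patch /=.
case: ifPn => [h|]; first by rewrite subrr memNset//= => /(lt_le_trans h); rewrite ltxx.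
by rewrite -leNgt => h; rewrite subr0 mem_set.
Qed.

Local Notation T := (kernel_op_weight (kconst nu) dens).

(** Split T into T1 + T2 with the truncated and the excess density. T S^a T is T1 S^a T1, whose
    outer factors have bounded normalized densities, plus terms containing T2, whose norm is at most
    c times the excess integral. *)
Theorem compact_product : exists2 K, 0 <= K & kernel_dominated w (kconst nu) dens K /\
  forall a, fin_rank_limit_on N B (T \o iter a St \o T).
Proof.
have mdens : cmeasurable dens by apply: cmeasurableM => //; exact: cmeasurable_real.
have tdom m : 0 < m -> kernel_dominated w (kconst nu) (dens_of (truncated m)) (c * m).
  move=> m0; apply: dens_of_dominated; rewrite ?(ltW m0)//.
  - exact: measurable_truncated.
  - by move=> z; exact: truncated_ge0.
  - move=> x; apply: prob_integral_le; rewrite ?(ltW m0)//.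
    + by apply: measurable_fun_pair2; exact: measurable_truncated.
    + by move=> y; exact: truncated_le.
    + by move=> y; exact: truncated_ge0.
have xdom e : 0 < e -> exists2 m, 0 < m & kernel_dominated w (kconst nu) (dens_of (excess m)) (c * e).
  move=> e0; have [m m0 hm] := uniform_tail e0; exists m => //.
  apply: dens_of_dominated; rewrite ?(ltW e0)//.
  - exact: measurable_excess.
  - by move=> z; exact: excess_ge0.
  - by move=> x; apply: excess_integral_le.
have mtr m := cmeasurable_dens_of (measurable_truncated m).
have mex m := cmeasurable_dens_of (measurable_excess m).
have [m1 m10 hm1] := xdom 1 ltr01.
pose K := c * m1 + c * 1.
have K0 : 0 <= K by rewrite addr_ge0// mulr_ge0// ltW.
have TK : kernel_dominated w (kconst nu) dens K.
  move=> x.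
  have mm g : cmeasurable g -> measurable_fun setT (fun y => (normc (g (x, y)) * w y)%:E).
    move=> mg; apply/measurable_EFinP/measurable_funM => //.
    exact/measurable_normc/cmeasurable_section.
  apply: (@le_trans _ _ (\int[nu]_y ((normc (dens_of (truncated m1) (x, y)) * w y)%:E +
      (normc (dens_of (excess m1) (x, y)) * w y)%:E)))%E.
    apply: ge0_le_integral => //.
    - by move=> y _; rewrite lee_fin mulr_ge0// normc_ge0.
    - exact: (mm _ mdens).
    - by apply: emeasurable_funD; [exact: (mm _ (mtr m1))|exact: (mm _ (mex m1))].
    - by move=> y _; rewrite -EFinD lee_fin -mulrDl ler_wpM2r// (dens_split m1) normcD.
  rewrite ge0_integralD//.
  - by rewrite /K mulrDl EFinD leeD//; [exact: tdom|exact: hm1].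
  - by move=> y _; rewrite lee_fin mulr_ge0// normc_ge0.
  - exact: (mm _ (mtr m1)).
  - by move=> y _; rewrite lee_fin mulr_ge0// normc_ge0.
  - exact: (mm _ (mex m1)).
exists K => //; split => // a.
have bT := kernel_op_weight_blin w_ge1 w_meas mdens TK K0.
have bSa := blin_on_iter a St_blin.
have [hT lT [MT MT0 hMT]] := bT.
have [hS lS [Ma Ma0 hMa]] := bSa.
move=> e e0.
(* [L] dominates the coefficients of [dl] in the bounds for T2 S^a T and T1 S^a T2; the + 1 keeps it
   positive. *)
pose L := c * MT * Ma * 2 + 2 * c * Ma * c + 1.
have L0 : 0 < L by rewrite ltr_wpDl// addr_ge0// !mulr_ge0.
pose dl := Num.min 1 (e / 2 / L).
have dl0 : 0 < dl by rewrite lt_min ltr01 !divr_gt0.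
have dl1 : dl <= 1 by rewrite ge_min lexx.
have dlL : dl * L <= e / 2 by rewrite -ler_pdivlMr// ge_min lexx orbT.
have [m m0 hm] := xdom dl dl0.
pose T1 := kernel_op_weight (kconst nu) (dens_of (truncated m)).
pose T2 := kernel_op_weight (kconst nu) (dens_of (excess m)).
have cm0 : 0 <= c * m by rewrite mulr_ge0// ltW.
have cdl0 : 0 <= c * dl by rewrite mulr_ge0// ltW.
have bT1 : blin_on N B T1 := kernel_op_weight_blin w_ge1 w_meas (mtr m) (tdom m m0) cm0.
have bT2 : blin_on N B T2 := kernel_op_weight_blin w_ge1 w_meas (mex m) hm cdl0.
have [hT1 lT1 _] := bT1.
have [hT2 lT2 _] := bT2.
have T2N f : B f -> N (T2 f) <= c * dl * N f.
  move=> Bf; apply: wnorm_le => //; first by rewrite mulr_ge0// wnorm_ge0.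
  by move=> x; exact: (kernel_op_weight_le w_ge1 w_meas (mex m) hm).
have TE f : B f -> T f = T1 f + T2 f.
  move=> Bf; apply/funext => x.
  have i1 := kernel_op_weight_integrable w_ge1 w_meas (mtr m) (tdom m m0) x Bf.
  have i2 := kernel_op_weight_integrable w_ge1 w_meas (mex m) hm x Bf.
  transitivity (cintegral nu (fun y => f y * dens_of (truncated m) (x, y)) +
    cintegral nu (fun y => f y * dens_of (excess m) (x, y)) : C); last by [].
  rewrite -cintegralD//; apply: eq_cintegral => y.
  by rewrite (dens_split m) mulrDr.
have [nD _ _ _] := wspace_complete_norm w_ge1.
(* The bound on T1 must not involve the level [m], which is chosen after [dl] and may grow as [dl]
   decreases: hence T - T2 with dl <= 1, instead of the bound c m of the truncated density. *)
have T1N f : B f -> N (T1 f) <= (MT + c) * N f.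
  move=> Bf; have Nf : 0 <= N f by exact: wnorm_ge0.
  have -> : T1 f = T f + (-1) *: T2 f by rewrite TE// scaleN1r addrK.
  rewrite (le_trans (nD _ _ (hT _ Bf) _))//.
    by rewrite -[_ *: _]addr0; apply: subspace_lin => //; [exact: hT2|exact: subspace_zero].
  have [_ nZ _ _] := wspace_complete_norm w_ge1.
  rewrite nZ; last exact: hT2.
  have -> : normc (-1) = 1 by rewrite normcNE Normc.normc1.
  rewrite mul1r mulrDl; apply: lerD; first exact: hMT.
  apply: le_trans (T2N f Bf) _; apply: ler_wpM2r => //.
  by rewrite -[leRHS]mulr1; exact: ler_wpM2l.
have mb : cmeasurable (fun z => theta z * ((truncated m z)%:C)%C).
  by apply: cmeasurableM => //; apply: cmeasurable_real; exact: measurable_truncated.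
have bM z : normc (theta z * ((truncated m z)%:C)%C) <= c * m.
  rewrite Normc.normcM normc_real ger0_norm ?truncated_ge0//.
  by rewrite ler_pM ?normc_ge0 ?truncated_ge0 ?truncated_le.
have e2 : 0 < e / 2 by rewrite divr_gt0.
have [K' fK' hK'] := density_iter_density_limit a cm0 mb bM e2.
exists K' => // f Bf; have Nf : 0 <= N f by exact: wnorm_ge0.
have BTf := hT _ Bf; have BT1f := hT1 _ Bf; have BT2f := hT2 _ Bf.
have B0 := subspace_zero sB.
have BD g h : B g -> B h -> B (g + h).
  by move=> Bg Bh; rewrite -[g]scale1r; exact: subspace_lin.
have BN g h : B g -> B h -> B (g - h) by exact: wspace_sub.
have linD' (Z : (E -> R[i]^o) -> (E -> R[i]^o)) g h : lin_on B Z -> B g -> B h -> Z (g + h) = Z g + Z h.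
  by move=> lZ Bg Bh; have := lZ 1 g h Bg Bh; rewrite !scale1r.
have alg (p q r k : E -> R[i]^o) : p + q + r - k = r + (q + (p - k)).
  by rewrite [p + q]addrC [_ + r]addrC -!addrA.
have BS1 := hS _ BT1f; have BS2 := hS _ BT2f.
have q1 : T (iter a St (T f)) = T1 (iter a St (T f)) + T2 (iter a St (T f)).
  exact/TE/hS.
have q2 : iter a St (T f) = iter a St (T1 f) + iter a St (T2 f).
  by rewrite [in LHS](TE f Bf); exact: linD'.
have q3 : T1 (iter a St (T f)) = T1 (iter a St (T1 f)) + T1 (iter a St (T2 f)).
  by rewrite [in LHS]q2; exact: linD'.
have -> : (T \o iter a St \o T) f - K' f =
    T2 (iter a St (T f)) + (T1 (iter a St (T2 f)) + (T1 (iter a St (T1 f)) - K' f)).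
  transitivity (T1 (iter a St (T1 f)) + T1 (iter a St (T2 f)) + T2 (iter a St (T f)) - K' f).
    by rewrite -q3 -q1.
  exact: alg.
have BK'f : B (K' f).
  move: fK' => [r [cc [ee [Be _ _ ->]]]]//.
  by have [] := lin_on_sum sB (index_enum 'I_r) (cc f 0) lT Be.
have BT1ST1 : B (T1 (iter a St (T1 f))) by exact/hT1/hS.
apply: (le_trans (nD _ _ _ _)).
- by apply: hT2; exact: hS.
- by apply: (BD); [exact/hT1/hS|exact: BN].
rewrite [e]splitr mulrDl.
have h1 : N (T2 (iter a St (T f))) <= c * dl * (Ma * (MT * N f)).
  rewrite (le_trans (T2N _ (hS _ BTf)))// ler_wpM2l// (le_trans (hMa _ BTf))// ler_wpM2l//.
  exact: hMT.
have h2 : N (T1 (iter a St (T2 f))) <= (MT + c) * (Ma * (c * dl * N f)).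
  rewrite (le_trans (T1N _ (hS _ BT2f)))// ler_wpM2l ?addr_ge0// (le_trans (hMa _ BT2f))//.
  by rewrite ler_wpM2l// T2N.
have h3 : N (T1 (iter a St (T1 f)) + - K' f) <= e / 2 * N f by exact: hK'.
have h23 := nD _ _ (hT1 _ (hS _ BT2f)) (BN _ _ BT1ST1 BK'f).
apply: (le_trans (lerD h1 (le_trans h23 (lerD h2 h3)))).
rewrite addrA lerD2r.
rewrite (_ : _ + _ = dl * (c * MT * Ma * 2 + c * Ma * c) * N f); last by ring.
rewrite ler_wpM2r// (le_trans _ dlL)// ler_wpM2l ?(ltW dl0)// /L.
have cc : 0 <= c * Ma * c by rewrite !mulr_ge0.
move: cc; rewrite (_ : 2 * c * Ma * c = 2 * (c * Ma * c)); last by ring.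
by move: (c * Ma * c) => q q0; rewrite -addrA lerD2l mulr_natl mulr2n -addrA lerDl addr_ge0.
Qed.

End UniformlyIntegrable.

End WeaklyCompactProducts.

(** * Functionals determined by their values on indicators *)

Section ContinuousFunctionals.
Import HBNNSimple.
Context {d : measure_display} {E : measurableType d} {R : realType}.
Variable w : E -> R.
Hypotheses (w_ge1 : forall x, 1 <= w x) (w_meas : measurable_fun setT w).
Implicit Types (g h : E -> R) (M : R).

Let w0 x : 0 < w x. Proof. exact: lt_le_trans (w_ge1 x). Qed.
Let w0' x : 0 <= w x. Proof. exact: ltW. Qed.

Definition wbounded M g := measurable_fun setT g /\ forall x, `|g x| <= M * w x.

Lemma wbounded_indic (A : set E) : measurable A -> wbounded 1 (\1_A).
Proof.
move=> mA; split; first exact: measurable_indic.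
by move=> x; rewrite mul1r (le_trans (indic_norm_le1 A x)).
Qed.

Lemma wbounded_lin a g h M M' : wbounded M g -> wbounded M' h ->
  wbounded (`|a| * M + M') (fun x => a * g x + h x).
Proof.
move=> [mg gM] [mh hM]; split.
  by apply: measurable_funD => //; exact: measurable_funM.
by move=> x; rewrite (le_trans (ler_normD _ _))// mulrDl lerD// normrM -mulrA ler_wpM2l.
Qed.

(** Plays the role of a signed measure that integrates [w]: linear on w-bounded functions and
    continuous under dominated pointwise convergence. Differences of integrals against distinct
    measures are of this kind. *)
Definition dominated_functional (L : (E -> R) -> R) :=
  (forall a g h M M', wbounded M g -> wbounded M' h -> L (fun x => a * g x + h x) = a * L g + L h) /\
  (forall u g M, (forall n, wbounded M (u n)) -> wbounded M g ->
     (forall x, u n x @[n --> \oo] --> g x) -> L (u n) @[n --> \oo] --> L g).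

Lemma dominated_functional0 L : dominated_functional L -> L (fun=> 0) = 0.
Proof.
move=> [lL _]; have b0 : wbounded 0 (fun=> 0).
  by split => // x; rewrite normr0 mul0r.
have := lL (-1) _ _ _ _ b0 b0.
rewrite (_ : (fun _ => _) = fun=> 0); last by apply/funext => x; rewrite mulr0 addr0.
by rewrite mulN1r addNr.
Qed.

Lemma dominated_functional_sub L L' : dominated_functional L -> dominated_functional L' ->
  dominated_functional (fun g => L g - L' g).
Proof.
move=> [lL cL] [lL' cL']; split.
  move=> a g h M M' bg bh; rewrite (lL _ _ _ _ _ bg bh) (lL' _ _ _ _ _ bg bh).
  by rewrite mulrBr opprD addrACA.
by move=> u g M bu bg ug; apply: cvgB; [exact: cL bu bg ug|exact: cL' bu bg ug].
Qed.

Lemma dominated_functional_eq0_simple L (f : {nnsfun E >-> R}) : dominated_functional L ->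
  (forall A, measurable A -> L (\1_A) = 0) -> L f = 0.
Proof.
move=> dL L0; have lL := dL.1.
have -> : (f : E -> R) = fun x => \sum_(y <- finmap.enum_fset (fset_set (range f))) y * \1_(f @^-1` [set y]) x.
  by apply/funext => x; rewrite {1}fimfunE fsbig_finite.
elim: (finmap.enum_fset _) => [|y s IH].
  under eq_fun do rewrite big_nil; exact: dominated_functional0.
under eq_fun do rewrite big_cons.
have mA : measurable (f @^-1` [set y]) by [].
have bs (t : seq R) : exists M, wbounded M (fun x => \sum_(z <- t) z * \1_(f @^-1` [set z]) x).
  elim: t => [|z t [M bM]].
    exists 0; split; first by under eq_fun do rewrite big_nil; exact: measurable_cst.
    by move=> x; rewrite big_nil normr0 mul0r.
  exists (`|z| * 1 + M); under eq_fun do rewrite big_cons.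
  by apply: wbounded_lin => //; exact: wbounded_indic.
have [M bM] := bs s.
by rewrite (lL _ _ _ _ _ (wbounded_indic mA) bM) IH addr0 L0 ?mulr0.
Qed.

(** Simple functions increase to the positive and to the negative part of [g] below one multiple of
    [w], so continuity applies. *)
Lemma dominated_functional_eq0 L g M : dominated_functional L ->
  (forall A, measurable A -> L (\1_A) = 0) -> wbounded M g -> L g = 0.
Proof.
move=> dL L0.
have pos h M' : (forall x, 0 <= h x) -> wbounded M' h -> L h = 0.
  move=> h0 bh; have [mh hM] := bh.
  have meh : measurable_fun setT (EFin \o h) by exact/measurable_EFinP.
  pose u := nnsfun_approx measurableT meh.
  have uh x : u n x @[n --> \oo] --> h x.
    have := @cvg_nnsfun_approx _ _ _ _ measurableT _ meh (fun x _ => h0 x) x I.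
    by move/fine_cvg.
  have ule n x : u n x <= h x.
    have nd : nondecreasing_seq (fun n => u n x).
      by move=> a b ab; exact/lefP/nd_nnsfun_approx.
    rewrite -(cvg_lim (@Rhausdorff R) (uh x)); apply: nondecreasing_cvgn_le => //.
    by apply/cvg_ex; exists (h x); exact: uh.
  have bu n : wbounded M' (u n).
    split; first exact: measurable_funP.
    by move=> x; rewrite ger0_norm// (le_trans (ule n x))// (le_trans (ler_norm _)).
  have cv := dL.2 (fun n => u n) h M' bu bh uh.
  have : (fun n => L (u n)) = fun=> 0.
    by apply/funext => n; exact: dominated_functional_eq0_simple.
  by move=> E0; move: cv; rewrite E0 => /(cvg_lim (@Rhausdorff R)); rewrite lim_cst.
move=> [mg gM].
have gE : g = fun x => -1 * g^\- x + g^\+ x.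
  by apply/funext => x; rewrite mulN1r addrC -[in LHS](funrposBneg g).
have gN x : `|g x| = g^\+ x + g^\- x by rewrite -[LHS]/((Num.norm \o g) x) -funrposDneg.
have bp : wbounded M (g^\+).
  split; first exact: measurable_funrpos.
  move=> x; rewrite ger0_norm ?funrpos_ge0// (le_trans _ (gM x))//.
  by rewrite gN lerDl funrneg_ge0.
have bn : wbounded M (g^\-).
  split; first exact: measurable_funrneg.
  move=> x; rewrite ger0_norm ?funrneg_ge0// (le_trans _ (gM x))//.
  by rewrite gN lerDr funrpos_ge0.
rewrite gE (dL.1 _ _ _ _ _ bn bp) (pos _ _ (funrneg_ge0 g) bn) (pos _ _ (funrpos_ge0 g) bp).
by rewrite mulr0 addr0.
Qed.

Lemma Rintegral_dominated_functional (mu : {measure set E -> \bar R}) (h : E -> R) :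
  measurable_fun setT h -> mu.-integrable setT (EFin \o (fun x => `|h x| * w x)) ->
  dominated_functional (fun g => Rintegral mu setT (fun x => g x * h x)).
Proof.
move=> mh ih.
have ig g M : wbounded M g -> mu.-integrable setT (EFin \o (fun x => g x * h x)).
  move=> [mg gM]; apply: le_integrable (integrableZl measurableT M ih) => //.
    by apply/measurable_EFinP; exact: measurable_funM.
  move=> x _ /=; rewrite lee_fin normrM (le_trans _ (ler_norm _))//.
  by rewrite mulrC mulrCA ler_wpM2l.
split.
  move=> a g k M M' bg bk; have iG := ig _ _ bg; have iK := ig _ _ bk.
  under eq_Rintegral do rewrite mulrDl -mulrA.
  rewrite RintegralD ?RintegralZl//.
  exact: (integrableZl measurableT a iG).
move=> u g M bu bg ug.
apply: fine_cvg; rewrite fineK; last exact: integrable_fin_num (ig _ _ bg).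
have m_ n : measurable_fun setT (EFin \o (fun x => u n x * h x)).
  by have [mu' _] := bu n; exact/measurable_EFinP/measurable_funM.
have mg : measurable_fun setT (EFin \o (fun x => g x * h x)).
  by have [mg _] := bg; exact/measurable_EFinP/measurable_funM.
have cv : {ae mu, forall x, setT x -> (EFin \o (fun x => u n x * h x)) x @[n --> \oo] --> (EFin \o (fun x => g x * h x)) x}.
  by apply: aeW => x _; apply: cvg_EFin; [exact: nearW|apply: cvgMl; exact: ug].
have dom : {ae mu, forall (x : E) (n : nat), setT x ->
    (`|((u n x * h x)%R)%:E| <= ((M * (`|h x| * w x))%R)%:E)%E}.
  apply: aeW => x n _; rewrite lee_fin normrM; have [_ h1] := bu n.
  by rewrite mulrC [leRHS]mulrCA ler_wpM2l.
by have [_ _ ?] := dominated_convergence measurableT m_ mg cv (integrableZl measurableT M ih) dom.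
Qed.

End ContinuousFunctionals.

(** * Powers of a kernel and their decomposition *)

Section KernelComposition.
Context {d : measure_display} {E : measurableType d} {R : realType}.
Variables k l : R.-fker E ~> E.

Definition kcompose (x : E) : {measure set E -> \bar R} :=
  mkcomp k (kpull (@measurable_snd _ _ E E) l) x.

Let measurable_kcompose U : measurable U -> measurable_fun setT (kcompose ^~ U).
Proof. by move=> mU; exact: (measurable_fun_mkcomp_sfinite k (kpull (@measurable_snd _ _ E E) l) mU). Qed.

HB.instance Definition _ := isKernel.Build _ _ _ _ R kcompose measurable_kcompose.

Let kcompose_uub : measure_fam_uub kcompose.
Proof.
have /measure_fam_uubP[r hr] := measure_uub l.
have /measure_fam_uubP[s hs] := measure_uub k.
apply/measure_fam_uubP; exists (PosNum [gt0 of (r%:num * s%:num)%R]) => x /=.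
apply: (@le_lt_trans _ _ (\int[k x]__ r%:num%:E)%E).
  apply: ge0_le_integral => //.
  - exact: measurable_kernel.
  - by move=> y _; exact/ltW/hr.
by rewrite integral_cst//= EFinM lte_pmul2l.
Qed.

HB.instance Definition _ := Kernel_isFinite.Build _ _ _ _ R kcompose kcompose_uub.

End KernelComposition.

Section KernelPowers.
Context {d : measure_display} {E : measurableType d} {R : realType}.
Local Notation C := R[i].
Local Notation normc := (@Normc.normc R).
Variable w : E -> R.
Hypotheses (w_ge1 : forall x, 1 <= w x) (w_meas : measurable_fun setT w).
Implicit Types (f : E -> R[i]^o) (g h : E -> R).
Local Notation B := (wspace w).

Let w0 x : 0 < w x. Proof. exact: lt_le_trans (w_ge1 x). Qed.
Let w0' x : 0 <= w x. Proof. exact: ltW. Qed.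

Lemma wbounded_wreal M g : wbounded w M g -> wspace w (of_real g).
Proof. by move=> [mg gM]; exact: wrealI gM. Qed.

Lemma wspace_Re f : B f -> wbounded w (wnorm w f) (fun x => complex.Re (f x)).
Proof.
move=> Bf; split; first by have [[]] := Bf.
by move=> x; rewrite (le_trans (le_Re_normc _))// normc_le_wnorm.
Qed.

Lemma wspace_Im f : B f -> wbounded w (wnorm w f) (fun x => complex.Im (f x)).
Proof.
move=> Bf; split; first by have [[]] := Bf.
by move=> x; rewrite (le_trans (le_Im_normc _))// normc_le_wnorm.
Qed.

Lemma wspace_normc f : B f -> wspace w (of_real (fun x => normc (f x))).
Proof.
move=> Bf; apply: (@wrealI _ _ _ w w_ge1 _ (wnorm w f)).
  exact/measurable_normc/(wspace_cmeasurable Bf).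
by move=> x; rewrite ger0_norm ?normc_ge0// normc_le_wnorm.
Qed.

(** Each step costs a factor [c] and replaces the weighted kernel by the positive one. This carries
    the growth of a positive kernel over to its weighted versions, and it is the domination from
    which iterates of Q_chi receive a density. *)
Lemma iter_kernel_op_weight_le (k : R.-fker E ~> E) (Mk : R) (chi : E * E -> C) (c : R) n f x :
  0 <= Mk -> kernel_dominated w k (fun=> 1) Mk -> cmeasurable chi ->
  (forall z, normc (chi z) <= c) -> 0 <= c -> B f ->
  normc (iter n (kernel_op_weight k chi) f x) <= c ^+ n * iter n (real_op k) (fun x => normc (f x)) x.
Proof.
move=> Mk0 kM mchi chic c0 Bf; elim: n x => [|n IH] x; first by rewrite expr0 mul1r.
have bk := kernel_op_weight_blin w_ge1 w_meas mchi
  (theta_dominated w_ge1 w_meas kM mchi c0 chic) (mulr_ge0 c0 Mk0).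
have [hk _ _] := blin_on_iter n bk.
have wn := wreal_iter w_ge1 w_meas Mk0 kM n (wspace_normc Bf).
rewrite iterS.
pose h y := c ^+ n.+1 * iter n (real_op k) (fun x => normc (f x)) y.
have ih : (k x).-integrable setT (EFin \o h).
  exact: (integrableZl measurableT (c ^+ n.+1) (wreal_integrable w_ge1 w_meas kM x wn)).
apply: (@le_trans _ _ (Rintegral (k x) setT h)).
  apply: normc_cintegral_le_dom => //.
    apply: cmeasurableM; first exact: (wspace_cmeasurable (hk _ Bf)).
    exact: cmeasurable_section.
  move=> y; rewrite Normc.normcM /h exprS -mulrA mulrC.
  by rewrite ler_pM ?normc_ge0.
by rewrite RintegralZl//; exact: wreal_integrable wn.
Qed.

Variables (Q : R.-fker E ~> E) (MQ : R).
Hypotheses (MQ0 : 0 <= MQ) (QM : kernel_dominated w Q (fun=> 1) MQ).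

Definition kid : R.-fker E ~> E :=
  [the R.-fker E ~> E of kdirac (@measurable_id _ E setT)].

(** The powers as finite kernels, against which one can integrate; [kpowE] identifies them on
    measurable sets with the bare set functions [kernel_pow]. *)
Fixpoint kpow (n : nat) : R.-fker E ~> E := if n is m.+1 then [the R.-fker E ~> E of kcompose Q (kpow m)] else kid.

Lemma kpowE n x A : measurable A -> kpow n x A = kernel_pow Q n x A.
Proof.
move=> mA; elim: n x => [//|n IH] x.
by apply: eq_integral => y _; exact: IH.
Qed.

Lemma integral_kpowS n x (f : E -> \bar R) : (forall y, 0 <= f y)%E -> measurable_fun setT f ->
  (\int[kpow n.+1 x]_y f y = \int[Q x]_y \int[kpow n y]_z f z)%E.
Proof. by move=> f0 mf; rewrite [LHS]integral_kcomp. Qed.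

Lemma kernel_dominated1E (k : R.-fker E ~> E) M :
  kernel_dominated w k (fun=> 1) M <-> forall x, (\int[k x]_y (w y)%:E <= (M * w x)%:E)%E.
Proof.
have e x : (\int[k x]_y (normc 1 * w y)%:E = \int[k x]_y (w y)%:E)%E.
  by apply: eq_integral => y _; rewrite Normc.normc1 mul1r.
by split => kM x; [rewrite -e|rewrite [leLHS]e]; exact: kM.
Qed.

Lemma kpow_dominated n : kernel_dominated w (kpow n) (fun=> 1) (MQ ^+ n).
Proof.
have mw : measurable_fun setT (EFin \o w) by exact/measurable_EFinP.
apply/kernel_dominated1E; elim: n => [|n IH] x.
  rewrite /= expr0 mul1r.
  by rewrite integral_dirac// diracE in_setT mul1e.
rewrite integral_kpowS//.
apply: (@le_trans _ _ (\int[Q x]_y ((MQ ^+ n)%:E * (w y)%:E)))%E.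
  apply: ge0_le_integral => //.
  - by move=> y _; apply: integral_ge0 => z _; rewrite lee_fin.
  - apply: (@measurable_fun_integral_finite_kernel _ _ _ _ _ (fun z => (w z.2)%:E) (kpow n)) => //.
      by move=> z; rewrite lee_fin.
    exact: (measurableT_comp mw measurable_snd).
  - by apply: emeasurable_funM.
rewrite ge0_integralZl//; last 2 first.
- by move=> y _; rewrite lee_fin.
- by rewrite lee_fin exprn_ge0.
rewrite exprSr -mulrA EFinM lee_wpmul2l ?lee_fin ?exprn_ge0//.
by move/kernel_dominated1E: QM; exact.
Qed.

Lemma real_op_kpowS n M g : wbounded w M g ->
  real_op (kpow n.+1) g = real_op Q (real_op (kpow n) g).
Proof.
have MQn0 m : 0 <= MQ ^+ m by exact: exprn_ge0.
have pos h M' : (forall x, 0 <= h x) -> wbounded w M' h ->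
    real_op (kpow n.+1) h = real_op Q (real_op (kpow n) h).
  move=> h0 bh; apply/funext => x; rewrite /real_op /Rintegral; congr fine.
  rewrite integral_kpowS//; last by have [mh _] := bh; exact/measurable_EFinP.
  apply: eq_integral => y _; rewrite fineK//.
  apply: integrable_fin_num => //.
  exact: (wreal_integrable w_ge1 w_meas (kpow_dominated n) y (wbounded_wreal bh)).
move=> [mg gM].
have gE : g = fun x => -1 * g^\- x + g^\+ x.
  by apply/funext => x; rewrite mulN1r addrC -[in LHS](funrposBneg g).
have gN x : `|g x| = g^\+ x + g^\- x by rewrite -[LHS]/((Num.norm \o g) x) -funrposDneg.
have bp : wbounded w M (g^\+).
  split; first exact: measurable_funrpos.
  move=> x; rewrite ger0_norm ?funrpos_ge0// (le_trans _ (gM x))//.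
  by rewrite gN lerDl funrneg_ge0.
have bn : wbounded w M (g^\-).
  split; first exact: measurable_funrneg.
  move=> x; rewrite ger0_norm ?funrneg_ge0// (le_trans _ (gM x))//.
  by rewrite gN lerDr funrpos_ge0.
have wp := wbounded_wreal bp; have wn := wbounded_wreal bn.
rewrite gE (real_op_lin w_ge1 w_meas (kpow_dominated n.+1))//.
rewrite (real_op_lin w_ge1 w_meas (kpow_dominated n))//.
rewrite (real_op_lin w_ge1 w_meas QM); last 2 first.
- exact: (wreal_op w_ge1 w_meas (MQn0 n) (kpow_dominated n)).
- exact: (wreal_op w_ge1 w_meas (MQn0 n) (kpow_dominated n)).
by rewrite (pos _ _ (funrneg_ge0 g) bn) (pos _ _ (funrpos_ge0 g) bp).
Qed.

Lemma iter_real_op n M g : wbounded w M g -> iter n (real_op Q) g = real_op (kpow n) g.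
Proof.
move=> bg; elim: n => [|n IH]; last by rewrite iterS IH -(real_op_kpowS n bg).
have [mg _] := bg; apply/funext => x; rewrite /real_op /Rintegral /=.
by rewrite integral_dirac ?diracE ?in_setT ?mul1e//; exact/measurable_EFinP.
Qed.

Lemma kernel_opE (k : R.-fker E ~> E) f : kernel_op k f =
  fun x => (real_op k (fun x => complex.Re (f x)) x +i* real_op k (fun x => complex.Im (f x)) x)%C.
Proof. by []. Qed.

Lemma iter_kernel_op n f : B f -> iter n (kernel_op Q) f = kernel_op (kpow n) f.
Proof.
move=> Bf.
have h m : iter m (kernel_op Q) f = fun x => (iter m (real_op Q) (fun x => complex.Re (f x)) x +i*
    iter m (real_op Q) (fun x => complex.Im (f x)) x)%C.
  elim: m => [|m IH]; first by apply/funext => x /=; case: (f x).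
  by rewrite iterS IH kernel_opE.
rewrite h kernel_opE; apply/funext => x.
by rewrite (iter_real_op n (wspace_Re Bf)) (iter_real_op n (wspace_Im Bf)).
Qed.

End KernelPowers.

(** * Integration against a decomposed power of the kernel *)

Section Decomposition.
Context {d : measure_display} {E : measurableType d} {R : realType}.
Local Notation C := R[i].
Local Notation normc := (@Normc.normc R).
Variable w : E -> R.
Hypotheses (w_ge1 : forall x, 1 <= w x) (w_meas : measurable_fun setT w).
Implicit Types (f : E -> R[i]^o) (g h : E -> R).
Local Notation B := (wspace w).

Let w0 x : 0 < w x. Proof. exact: lt_le_trans (w_ge1 x). Qed.
Let w0' x : 0 <= w x. Proof. exact: ltW. Qed.

Lemma Rintegral_dominated_functional1 (k : R.-fker E ~> E) M x :
  kernel_dominated w k (fun=> 1) M -> dominated_functional w (fun g => Rintegral (k x) setT g).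
Proof.
move=> kM.
have := @Rintegral_dominated_functional _ _ _ w (k x) (fun=> 1) (ltac:(exact: measurable_cst)).
rewrite (_ : (fun g => Rintegral _ _ (fun x => g x * 1)) = (fun g => Rintegral (k x) setT g)); last first.
  by apply/funext => g; apply: eq_Rintegral => y _; rewrite mulr1.
apply; have := kernel_dominated_integrable w_ge1 w_meas x (cmeasurable_cst 1) kM.
rewrite (_ : (fun y => normc 1 * w y) = (fun y => `|1| * w y))//.
by apply/funext => y; rewrite Normc.normc1 normr1.
Qed.

Lemma kernel_dominated_mono (k l : R.-fker E ~> E) M :
  (forall x A, measurable A -> (k x A <= l x A)%E) ->
  kernel_dominated w l (fun=> 1) M -> kernel_dominated w k (fun=> 1) M.
Proof.
move=> kl /kernel_dominated1E lM; apply/kernel_dominated1E => x.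
apply: le_trans (lM x); apply: ge0_le_measure_integral => //.
- by move=> A mA; exact: kl.
- exact/measurable_EFinP.
Qed.

Variables (K S : R.-fker E ~> E) (nu : probability E R) (alpha : E * E -> R) (MK : R).
Hypotheses (KM : kernel_dominated w K (fun=> 1) MK) (MK0 : 0 <= MK).
Hypothesis alpha_ui : unif_int_density w nu alpha.
Hypothesis KS : forall x A, measurable A -> K x A = (S x A + kernel_density nu alpha x A)%E.

Let alpha0 z : 0 <= alpha z. Proof. by case: alpha_ui. Qed.
Let malpha : measurable_fun setT alpha. Proof. by case: alpha_ui. Qed.

Lemma remainder_dominated : kernel_dominated w S (fun=> 1) MK.
Proof.
apply: kernel_dominated_mono KM => x A mA; rewrite KS// leeDl//.
by apply: integral_ge0 => y _; rewrite lee_fin.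
Qed.

(** The case theta = 1 of [compact_product] contains the boundedness on B_w of the operator of
    density alpha. *)
Lemma density_dominated : exists2 L, 0 <= L & kernel_dominated w (kconst nu) (fun z => ((alpha z)%:C)%C) L.
Proof.
have [L L0 [h _]] := compact_product w_ge1 w_meas MK0 remainder_dominated (cmeasurable_cst 1)
  ler01 (fun z => ltac:(by rewrite Normc.normc1)) alpha_ui.
by exists L => // x; have := h x; under eq_integral do rewrite mul1r.
Qed.

Lemma density_integrable x : nu.-integrable setT (EFin \o (fun y => `|alpha (x, y)| * w y)).
Proof.
have [L _ h] := density_dominated.
have := kernel_dominated_integrable w_ge1 w_meas x (cmeasurable_real malpha) h.
by under eq_fun do rewrite normc_real.
Qed.

(** The difference of the two sides is a dominated functional of [g], and on indicators it vanishes
    by [KS]. *)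
Lemma Rintegral_decomposition x g M : wbounded w M g ->
  Rintegral (K x) setT g = Rintegral (S x) setT g + Rintegral nu setT (fun y => g y * alpha (x, y)).
Proof.
move=> bg; apply/eqP; rewrite -subr_eq0 opprD addrA; apply/eqP.
have ma : measurable_fun setT (fun y => alpha (x, y)) by exact: measurable_fun_pair2.
pose L g := (Rintegral (K x) setT g - Rintegral (S x) setT g) - Rintegral nu setT (fun y => g y * alpha (x, y)).
have dL : dominated_functional w L.
  apply: dominated_functional_sub; last exact: (Rintegral_dominated_functional ma (density_integrable x)).
  apply: dominated_functional_sub; first exact: Rintegral_dominated_functional1 KM.
  exact: Rintegral_dominated_functional1 remainder_dominated.
apply: (dominated_functional_eq0 w_ge1 dL _ bg) => A mA.
have i1 (k : R.-fker E ~> E) : Rintegral (k x) setT (\1_A) = fine (k x A).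
  by rewrite /Rintegral integral_indic// setIT.
have i2 : Rintegral nu setT (fun y => \1_A y * alpha (x, y)) = fine (kernel_density nu alpha x A).
  rewrite /Rintegral /kernel_density [in RHS]integral_mkcond; congr fine.
  apply: eq_integral => y _; rewrite /patch indicE.
  by case: (y \in A); rewrite ?mul1r ?mul0r.
rewrite /L !i1 i2 KS// fineD ?addrK ?[_ + fine (kernel_density _ _ _ _)]addrC ?addrK ?subrr//.
- exact: fker_fin_num.
- have : K x A \is a fin_num by exact: fker_fin_num.
  by rewrite KS// fin_numD => /andP[].
Qed.

Section Weighted.
Variables (theta : E * E -> C) (c : R).
Hypotheses (mtheta : cmeasurable theta) (theta_le : forall z, normc (theta z) <= c).

Lemma wbounded_ReIm f x : B f ->
  wbounded w (c * wnorm w f) (fun y => complex.Re (f y * theta (x, y))) /\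
  wbounded w (c * wnorm w f) (fun y => complex.Im (f y * theta (x, y))).
Proof.
move=> Bf.
have [m1 m2] : cmeasurable (fun y => f y * theta (x, y)).
  by apply: cmeasurableM; [exact: wspace_cmeasurable Bf|exact: cmeasurable_section].
have b y : normc (f y * theta (x, y)) <= c * wnorm w f * w y.
  by rewrite Normc.normcM mulrC -mulrA ler_pM ?normc_ge0// normc_le_wnorm.
by split; split => // y; apply: le_trans (b y); [exact: le_Re_normc|exact: le_Im_normc].
Qed.

Lemma kernel_op_weight_decomposition f : B f ->
  kernel_op_weight K theta f = kernel_op_weight S theta f +
    kernel_op_weight (kconst nu) (fun z => theta z * ((alpha z)%:C)%C) f.
Proof.
move=> Bf; apply/funext => x; have [bR bI] := wbounded_ReIm x Bf.
have ReC (u v : C) (a : R) : complex.Re (u * v) * a = complex.Re (u * (v * (a%:C)%C)).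
  by case: u v => p q [r t] /=; ring.
have ImC (u v : C) (a : R) : complex.Im (u * v) * a = complex.Im (u * (v * (a%:C)%C)).
  by case: u v => p q [r t] /=; ring.
transitivity (cintegral (S x) (fun y => f y * theta (x, y)) +
  cintegral nu (fun y => f y * (theta (x, y) * ((alpha (x, y))%:C)%C)) : C); last by [].
rewrite /kernel_op_weight /cintegral; apply: complex_eq; rewrite ?ReD ?ImD /=.
  rewrite (Rintegral_decomposition x bR); congr (_ + _).
  by apply: eq_Rintegral => y _; exact: ReC.
rewrite (Rintegral_decomposition x bI); congr (_ + _).
by apply: eq_Rintegral => y _; exact: ImC.
Qed.

End Weighted.

End Decomposition.

Section FunctionalExtensions.
Context {d : measure_display} {E : measurableType d} {R : realType}.
Variable w : E -> R.
Hypotheses (w_ge1 : forall x, 1 <= w x) (w_meas : measurable_fun setT w).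
Implicit Types (g h : E -> R) (M : R).

Let w0 x : 0 < w x. Proof. exact: lt_le_trans (w_ge1 x). Qed.
Let w0' x : 0 <= w x. Proof. exact: ltW. Qed.

Lemma fker_bounded_integrable (k : R.-fker E ~> E) x h a : measurable_fun setT h ->
  (forall y, `|h y| <= a) -> (k x).-integrable setT (EFin \o h).
Proof.
move=> mh ha; have [m' ->] := finite_measure_of (fker_fin_num k x).
apply: (@le_integrable _ _ _ _ _ _ _ (EFin \o cst a)) => //.
- exact/measurable_EFinP.
- by move=> y _; rewrite lee_fin (le_trans (ha y))// ler_norm.
- exact: finite_measure_integrable_cst.
Qed.

Lemma wboundedB g h M M' : wbounded w M g -> wbounded w M' h -> wbounded w (M + M') (fun x => g x - h x).
Proof.
move=> bg bh; have := wbounded_lin (-1) bh bg; rewrite normrN1 mul1r addrC.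
by rewrite (_ : (fun x => -1 * h x + g x) = fun x => g x - h x)//; apply/funext => x; rewrite mulN1r addrC.
Qed.

(** Continuity comes from the bound applied to u n - g, followed by dominated convergence for the
    integral of |u n - g|. *)
Lemma bounded_dominated_functional (mu : {measure set E -> \bar R}) (L : (E -> R) -> R) c :
  mu.-integrable setT (EFin \o w) ->
  (forall a g h M M', wbounded w M g -> wbounded w M' h -> L (fun x => a * g x + h x) = a * L g + L h) ->
  (forall g M, wbounded w M g -> `|L g| <= c * Rintegral mu setT (fun x => `|g x|)) ->
  dominated_functional w L.
Proof.
move=> iw lL Lc; split => // u g M bu bg ug.
have dI := @Rintegral_dominated_functional _ _ _ w mu (fun=> 1) (ltac:(exact: measurable_cst)).
have {}dI := dI _.
pose I (h : E -> R) := Rintegral mu setT (fun x => h x * 1).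
have {}dI : dominated_functional w I.
  by apply: dI; rewrite (_ : (fun x => `|1| * w x) = w)//; apply/funext => x; rewrite normr1 mul1r.
have b_ n : wbounded w (M + M) (fun x => `|u n x - g x|).
  have [m1 m2] := wboundedB (bu n) bg; split; first exact: measurableT_comp.
  by move=> x; rewrite normr_id.
have M0 x : 0 <= (M + M) * w x.
  by have [_ h] := b_ 0%N; apply: le_trans (h x).
have b0 : wbounded w (M + M) (fun=> 0) by split => // x; rewrite normr0.
have := dI.2 _ _ _ b_ b0; rewrite (dominated_functional0 dI) => cI.
have {}cI : I (fun x => `|u n x - g x|) @[n --> \oo] --> 0.
  apply: cI => x; rewrite -[X in _ --> X](normr0 R) -(subrr (g x)).
  by apply: cvg_norm; apply: cvgB; [exact: ug|exact: cvg_cst].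
apply/subr_cvg0; apply: norm_cvg0; rewrite -(mulr0 c).
apply: (@squeeze_cvgr _ _ _ _ (fun=> c * 0) (fun n => c * I (fun x => `|u n x - g x|))).
- apply: nearW => n; rewrite mulr0 normr_ge0/=.
  have [bd1 _] := wboundedB (bu n) bg.
  have -> : L (u n) - L g = L (fun x => -1 * g x + u n x).
    by rewrite (lL _ _ _ _ _ bg (bu n)) mulN1r addrC.
  rewrite (le_trans (Lc _ _ (wbounded_lin (-1) bg (bu n))))// le_eqVlt; apply/orP; left; apply/eqP.
  by congr (c * _); apply: eq_Rintegral => x _; rewrite mulr1 mulN1r addrC.
- exact: cvg_cst.
- by apply: cvgMr; exact: cI.
Qed.

(** Dynkin's argument: vanishing passes to complements by linearity, and to countable disjoint
    unions by continuity along the partial unions. *)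
Lemma dominated_functional_pi_system L (G : set (set E)) : dominated_functional w L ->
  @measurable d E = <<s G >> -> setI_closed G -> L (\1_setT) = 0 -> (forall A, G A -> L (\1_A) = 0) ->
  forall A, measurable A -> L (\1_A) = 0.
Proof.
move=> dL GE GI LT LG A mA.
apply: (@dynkin_induction _ _ G (fun A => L (\1_A) = 0)) => //; last by rewrite -GE.
- move=> S mS LS.
  have -> : \1_(~` S) = (fun x => -1 * \1_S x + \1_setT x) :> (E -> R).
    by apply/funext => x; rewrite !indicE in_setT in_setC; case: (x \in S) => /=; rewrite ?mulr1 ?mulr0 ?addNr ?add0r.
  by rewrite (dL.1 _ _ _ _ _ (wbounded_indic w_ge1 mS) (wbounded_indic w_ge1 measurableT)) LS LT mulr0 addr0.
- move=> F mF tF LF.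
  pose U n := \big[setU/set0]_(i < n) F i.
  have mU n : measurable (U n) by exact: bigsetU_measurable.
  have LU n : L (\1_(U n)) = 0.
    elim: n => [|n IH].
      by rewrite /U big_ord0 indic0 (dominated_functional0 dL).
    have -> : \1_(U n.+1) = (fun x => 1 * \1_(U n) x + \1_(F n) x) :> (E -> R).
      apply/funext => x; rewrite mul1r !indicE /U big_ord_recr/= in_setU.
      have [|//] := boolP (x \in \big[setU/set0]_(i < n) F i); last by rewrite add0r.
      have [|_] := boolP (x \in F n); last by rewrite addr0.
      rewrite !inE -bigcup_mkord => Fn [i /= ilt Fi].
      by have := tF i n I I (ex_intro _ x (conj Fi Fn)) => /eqP; rewrite ltn_eqF.
    by rewrite (dL.1 _ _ _ _ _ (wbounded_indic w_ge1 (mU n)) (wbounded_indic w_ge1 (mF n))) IH LF mulr0 addr0.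
  have mB : measurable (\bigcup_k F k) by exact: bigcup_measurable.
  have cU x : (\1_(U n) x : R) @[n --> \oo] --> (\1_(\bigcup_k F k) x : R).
    have [[k _ Fk]|nF] := pselect ((\bigcup_k F k) x).
      rewrite [X in _ --> X]indicE mem_set/=; last by exists k.
      apply: cvg_near_cst; exists k.+1 => // n /= kn.
      by rewrite indicE mem_set// /U -bigcup_mkord; exists k.
    rewrite [X in _ --> X]indicE memNset//=; apply: cvg_near_cst; apply: nearW => n.
    rewrite indicE memNset// /U -bigcup_mkord => -[k _ Fk].
    by apply: nF; exists k.
  have := dL.2 _ _ _ (fun n => wbounded_indic w_ge1 (mU n)) (wbounded_indic w_ge1 mB) cU.
  under eq_fun do rewrite LU.
  by move/(cvg_lim (@Rhausdorff R)); rewrite lim_cst.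
Qed.

End FunctionalExtensions.

(** * Jointly measurable densities *)

(** The 2^n words naming the atoms of level n, listed so that [sum_words] pairs the two children of
    every atom. *)
Fixpoint words (n : nat) : seq (seq bool) :=
  if n is k.+1 then map (cons true) (words k) ++ map (cons false) (words k) else [:: [::]].

Lemma sum_words {V : nmodType} n (h : seq bool -> V) :
  \sum_(s <- words n.+1) h s = \sum_(s <- words n) (h (true :: s) + h (false :: s)).
Proof. by rewrite /= big_cat !big_map big_split. Qed.

(** * Partitions generated by a sequence of sets *)

Section Atoms.
Context {d : measure_display} {E : measurableType d} {R : realType}.
Local Notation C := R[i].
Variable g : nat -> set E.
Hypothesis mg : forall n, measurable (g n).

(* Most recent bit first, so that [drop k] forgets the last [k] sets. *)
Fixpoint itinerary (n : nat) (y : E) : seq bool :=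
  if n is k.+1 then (y \in g k) :: itinerary k y else [::].

Definition atom (n : nat) (s : seq bool) : set E := [set y | itinerary n y = s].

Lemma atom_cons n b s : atom n.+1 (b :: s) = [set y | (y \in g n) = b] `&` atom n s.
Proof. by apply/seteqP; split => [y [<- <-]|y [/= <- <-]]. Qed.

Lemma measurable_bit n b : measurable [set y | (y \in g n) = b].
Proof.
case: b.
  by rewrite (_ : [set y | _] = g n)//; apply/seteqP; split => y /=; [move/set_mem|move/mem_set].
rewrite (_ : [set y | _] = ~` g n); first exact: measurableC.
by apply/seteqP; split => y /=; [move=> /negbT; rewrite notin_setE|move=> ?; apply: memNset].
Qed.

Lemma measurable_atom n s : measurable (atom n s).
Proof.
elim: n s => [|n IH] [|b s].
- by rewrite (_ : atom _ _ = setT)//; apply/seteqP; split.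
- by rewrite (_ : atom _ _ = set0)//; apply/seteqP; split.
- by rewrite (_ : atom _ _ = set0)//; apply/seteqP; split.
- by rewrite atom_cons; apply: measurableI => //; exact: measurable_bit.
Qed.

Lemma atom_split n s : atom n s = atom n.+1 (true :: s) `|` atom n.+1 (false :: s).
Proof.
rewrite !atom_cons; apply/seteqP; split => [y ys|y [[]//|[]//]].
by case e : (y \in g n); [left|right].
Qed.

Lemma atom_split_disjoint n s : atom n.+1 (true :: s) `&` atom n.+1 (false :: s) = set0.
Proof. by rewrite !atom_cons; apply/seteqP; split => // y [[/= -> _] [//]]. Qed.

(** Exactly one atom of level n contains [y]; functions of the itinerary thus become finite sums,
    with coefficients that may depend measurably on x. *)
Lemma sum_atoms (phi : seq bool -> C) n y :
  \sum_(s <- words n) phi s * ((\1_(atom n s) y)%:C)%C = phi (itinerary n y).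
Proof.
elim: n phi => [|n IH] phi.
  by rewrite big_seq1 indicE mem_set// mulr1.
rewrite sum_words /= -(IH (fun s => phi ((y \in g n) :: s))).
apply: eq_bigr => s _; rewrite !atom_cons !indicE !in_setI.
have bitE b : (y \in [set y | (y \in g n) = b]) = ((y \in g n) == b).
  by apply/idP/eqP => [/set_mem|?]//; exact/mem_set.
by rewrite !bitE; case: (y \in g n); rewrite /= ?mulr0 ?addr0 ?add0r.
Qed.

Lemma itinerary_drop k n y : drop k (itinerary (k + n) y) = itinerary n y.
Proof. by elim: k => [|k IH]; rewrite ?drop0// addSn. Qed.

(** Unions of atoms of one level, described by a boolean test on itineraries; tests of two levels
    combine after dropping recent bits, which makes this a pi-system. *)
Definition atomic_sets : set (set E) :=
  [set A | exists n (p : seq bool -> bool), A = [set y | p (itinerary n y)]].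

Lemma atomic_setI : setI_closed atomic_sets.
Proof.
move=> _ _ [n [p ->]] [m [q ->]].
exists (m + n)%N, (fun s => p (drop m s) && q (drop n s)); apply/seteqP.
by split => y /=; rewrite itinerary_drop addnC itinerary_drop; [move=> [-> ->]|move=> /andP].
Qed.

Lemma measurable_itinerary n (p : seq bool -> bool) : measurable [set y | p (itinerary n y)].
Proof.
elim: n p => [|n IH] p.
  case: (p [::]) (erefl (p [::])) => e.
    by rewrite (_ : [set y | _] = setT)//; apply/seteqP; split => y //=; rewrite e.
  by rewrite (_ : [set y | _] = set0)//; apply/seteqP; split => y //=; rewrite e.
rewrite (_ : [set y | _] = ([set y | (y \in g n) = true] `&` [set y | p (true :: itinerary n y)]) `|`
  ([set y | (y \in g n) = false] `&` [set y | p (false :: itinerary n y)])).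
  by apply: measurableU; apply: measurableI; try exact: measurable_bit; exact: (IH (fun s => p (_ :: s))).
apply/seteqP; split => [y /=|y /=]; last by move=> [] [->].
by case e : (y \in g n) => h; [left|right].
Qed.

Lemma measurable_atomic_sets : @measurable d E = <<s range g >> -> @measurable d E = <<s atomic_sets >>.
Proof.
move=> gE; apply/seteqP; split.
  rewrite gE; apply: smallest_sub; first exact: smallest_sigma_algebra.
  move=> _ [n _ <-]; apply: sub_gen_smallest; exists n.+1, (head true).
  by apply/seteqP; split => y /=; rewrite ?inE.
apply: smallest_sub; first exact: sigma_algebra_measurable.
by move=> _ [n [p ->]]; exact: measurable_itinerary.
Qed.

End Atoms.

(** * The martingale of quotients on atoms *)

Section DensityMartingale.
Context {d : measure_display} {E : measurableType d} {R : realType}.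
Local Notation C := R[i].
Local Notation normc := (@Normc.normc R).
Variables (K : R.-fker E ~> E) (m : E -> set E -> C) (c : R) (g : nat -> set E).
Hypotheses (mg : forall n, measurable (g n)) (c0 : 0 <= c).
Hypothesis mm : forall A, measurable A -> cmeasurable (m ^~ A).
Hypothesis mle : forall x A, measurable A -> normc (m x A) <= c * fine (K x A).
Hypothesis madd : forall x A B, measurable A -> measurable B -> A `&` B = set0 ->
  m x (A `|` B) = m x A + m x B.
Implicit Types (phi : seq bool -> C).

Local Notation itinerary := (itinerary g).
Local Notation atom := (atom g).

Let matom n s : measurable (atom n s). Proof. exact: measurable_atom. Qed.

Lemma fker_bounded_cintegrable x (F : E -> C) a : cmeasurable F -> (forall y, normc (F y) <= a) ->
  cintegrable (K x) F.
Proof.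
move=> mF Fa; apply: (cintegrable_le mF Fa).
apply: (@fker_bounded_integrable _ _ _ _ _ _ `|a|) => //.
Qed.

(** On an atom without mass the convention 0^-1 = 0 gives the value 0; as [m] vanishes there as
    well, [ratio_mul] holds on every atom. *)
Definition ratio n x s : C := m x (atom n s) * (((fine (K x (atom n s)))^-1)%:C)%C.

Definition step n (z : E * E) : C := ratio n z.1 (itinerary n z.2).

Lemma fineK0 x A : 0 <= fine (K x A).
Proof. exact: fine_ge0. Qed.

Lemma ratio_mul n x s : ratio n x s * ((fine (K x (atom n s)))%:C)%C = m x (atom n s).
Proof.
rewrite /ratio -mulrA -rmorphM/=.
have [k0|k0] := eqVneq (fine (K x (atom n s))) 0; last by rewrite mulVf// mulr1.
have := mle x (matom n s); rewrite k0 mulr0 => h.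
suff -> : m x (atom n s) = 0 by rewrite mul0r.
by apply: Normc.eq0_normc; apply/eqP; rewrite eq_le h normc_ge0.
Qed.

Lemma ratio_le n x s : normc (ratio n x s) <= c.
Proof.
rewrite /ratio Normc.normcM normc_real ger0_norm ?invr_ge0 ?fineK0//.
have [->|k0] := eqVneq (fine (K x (atom n s))) 0; first by rewrite invr0 mulr0.
by rewrite ler_pdivrMr ?mle// lt_neqAle eq_sym k0 fineK0.
Qed.

Lemma step_le n z : normc (step n z) <= c. Proof. exact: ratio_le. Qed.

Lemma ratio_cmeasurable n s : cmeasurable (fun x => ratio n x s).
Proof.
apply: cmeasurableM; first exact: mm.
apply: cmeasurable_real.
rewrite (_ : (fun x => _) = fun x => (fine (K x (atom n s))) `^ (-1)); last first.
  by apply/funext => x; rewrite powR_inv1// fineK0.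
apply: (measurableT_comp (measurable_powR (-1))).
by apply: (measurableT_comp (fine_measurable measurableT)); exact: measurable_kernel.
Qed.

Lemma indic_cmeasurable (A : set E) : measurable A -> cmeasurable (fun y => ((\1_A y : R)%:C)%C).
Proof. by move=> mA; apply: cmeasurable_real; exact: measurable_indic. Qed.

Lemma step_cmeasurable n : cmeasurable (step n).
Proof.
apply: (@cmeasurable_eq _ _ _ (fun z => \sum_(s <- words n) ratio n z.1 s * ((\1_(atom n s) z.2)%:C)%C)).
  by move=> z; rewrite (sum_atoms g).
apply: cmeasurable_sum => s; apply: cmeasurableM.
  exact: (cmeasurable_comp (ratio_cmeasurable n s) measurable_fst).
exact: (cmeasurable_comp (indic_cmeasurable (matom n s)) measurable_snd).
Qed.

Lemma cintegral_itinerary n phi x : cintegral (K x) (fun y => phi (itinerary n y)) =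
  \sum_(s <- words n) phi s * ((fine (K x (atom n s)))%:C)%C.
Proof.
have ii s : cintegrable (K x) (fun y => ((\1_(atom n s) y : R)%:C)%C).
  apply: (@fker_bounded_cintegrable _ _ 1); first exact: indic_cmeasurable.
  by move=> y; rewrite normc_real indic_norm_le1.
transitivity (cintegral (K x) (fun y => \sum_(s <- words n) phi s * ((\1_(atom n s) y)%:C)%C)).
  by apply: eq_cintegral => y; rewrite (sum_atoms g).
rewrite cintegral_sum; last by move=> s; exact: cintegrableZ.
apply: eq_bigr => s _; rewrite cintegralZ// cintegral_real.
by rewrite /Rintegral integral_indic// setIT.
Qed.

Lemma sum_words_drop k n phi x :
  \sum_(s <- words (k + n)) phi (drop k s) * m x (atom (k + n) s) =
  \sum_(s <- words n) phi s * m x (atom n s).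
Proof.
elim: k => [|k IH]; first by apply: eq_bigr => s _; rewrite drop0.
rewrite addSn sum_words -IH; apply: eq_bigr => s _ /=.
rewrite -mulrDr -madd; [by rewrite -atom_split| | |exact: atom_split_disjoint].
- exact: (matom (k + n).+1).
- exact: (matom (k + n).+1).
Qed.

(** The martingale property: integrated against a function of the level n itinerary, every later
    quotient gives the same value, because [m] is additive when atoms split. *)
Lemma cintegral_itinerary_step k n phi x :
  cintegral (K x) (fun y => phi (itinerary n y) * step (k + n) (x, y)) =
  \sum_(s <- words n) phi s * m x (atom n s).
Proof.
rewrite -(sum_words_drop k); transitivity
  (\sum_(s <- words (k + n)) (phi (drop k s) * ratio (k + n) x s) * ((fine (K x (atom (k + n) s)))%:C)%C).
  rewrite -cintegral_itinerary; apply: eq_cintegral => y.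
  by rewrite itinerary_drop.
by apply: eq_bigr => s _; rewrite -mulrA ratio_mul.
Qed.

Definition energy n x := Rintegral (K x) setT (fun y => normc (step n (x, y)) ^+ 2).

Lemma step_section_cmeasurable n x : cmeasurable (fun y => step n (x, y)).
Proof. exact: cmeasurable_section (step_cmeasurable n). Qed.

Lemma sqr_step_integrable x (F : E -> C) a : cmeasurable F -> (forall y, normc (F y) <= a) ->
  (K x).-integrable setT (EFin \o (fun y => normc (F y) ^+ 2)).
Proof.
move=> mF Fa; apply: (@fker_bounded_integrable _ _ _ _ _ _ (a ^+ 2)).
  exact: measurable_funX (measurable_normc mF).
move=> y; rewrite ger0_norm ?exprn_ge0 ?normc_ge0//.
by rewrite ler_pXn2r ?nnegrE ?normc_ge0// (le_trans (normc_ge0 (F y))).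
Qed.

(** Pythagoras in L2 of [K x]: by the martingale property the increment u - v is orthogonal to the
    earlier quotient v. *)
Lemma energy_diff k n x :
  Rintegral (K x) setT (fun y => normc (step (k + n) (x, y) - step n (x, y)) ^+ 2) =
  energy (k + n) x - energy n x.
Proof.
set u := step (k + n); set v := step n.
have mu := step_section_cmeasurable (k + n) x; have mv := step_section_cmeasurable n x.
have md := cmeasurableB mu mv.
have id : (K x).-integrable setT (EFin \o (fun y => normc (u (x, y) - v (x, y)) ^+ 2)).
  apply: (@sqr_step_integrable _ _ (c + c)) => // y.
  by rewrite (le_trans (ler_normcB _ _))// lerD// step_le.
have iv : (K x).-integrable setT (EFin \o (fun y => normc (v (x, y)) ^+ 2)).
  by apply: (@sqr_step_integrable _ _ c) => // y; exact: step_le.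
pose cj (z : C) : C := (complex.Re z -i* complex.Im z)%C.
have cross : cintegral (K x) (fun y => cj (v (x, y)) * u (x, y)) =
             cintegral (K x) (fun y => cj (v (x, y)) * v (x, y)).
  transitivity (\sum_(s <- words n) cj (ratio n x s) * m x (atom n s)).
    exact: (cintegral_itinerary_step k n (fun s => cj (ratio n x s)) x).
  by rewrite -(cintegral_itinerary_step 0 n (fun s => cj (ratio n x s)) x).
have ncj (z : C) : normc (cj z) = normc z by case: z => p q /=; rewrite sqrrN.
have mcj : cmeasurable (fun y => cj (v (x, y))).
  by case: mv => m1 m2; split => //=; exact: measurableT_comp.
have icj (F : E -> C) : cmeasurable F -> (forall y, normc (F y) <= c) ->
    cintegrable (K x) (fun y => cj (v (x, y)) * F y).
  move=> mF Fc; apply: (@fker_bounded_cintegrable _ _ (c * c)); first exact: cmeasurableM.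
  by move=> y; rewrite Normc.normcM ncj ler_pM ?normc_ge0 ?step_le.
have iu' := icj _ mu (fun y => step_le (k + n) (x, y)).
have iv' := icj _ mv (fun y => step_le n (x, y)).
have cross0 : Rintegral (K x) setT (fun y => complex.Re (cj (v (x, y)) * u (x, y) - cj (v (x, y)) * v (x, y))) = 0.
  by have := congr1 (@complex.Re R) (cintegralB iu' iv'); rewrite cross subrr.
have [ic _] : cintegrable (K x) (fun y => cj (v (x, y)) * u (x, y) - cj (v (x, y)) * v (x, y)).
  by rewrite (_ : (fun y => _) = fun y => cj (v (x, y)) * u (x, y) + (-1) * (cj (v (x, y)) * v (x, y)));
    [apply: cintegrableD => //; exact: cintegrableZ|apply/funext => y; rewrite mulN1r].
apply/eqP; rewrite eq_sym subr_eq; apply/eqP.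
pose p y := normc (u (x, y) - v (x, y)) ^+ 2.
pose q y := normc (v (x, y)) ^+ 2.
pose r y := complex.Re (cj (v (x, y)) * u (x, y) - cj (v (x, y)) * v (x, y)).
have i2 : (K x).-integrable setT (EFin \o (fun y => 2 * r y)) by exact: (integrableZl measurableT 2 ic).
have ipq : (K x).-integrable setT (EFin \o (fun y => p y + q y)) by exact: (integrableD measurableT id iv).
transitivity (Rintegral (K x) setT (fun y => (p y + q y) + 2 * r y)).
  apply: eq_Rintegral => y _; rewrite /p /q /r /cj -/u !sqr_normcE.
  by case: (u (x, y)) (v (x, y)) => u1 u2 [v1 v2] /=; ring.
by rewrite RintegralD// RintegralD// RintegralZl// cross0 mulr0 addr0.
Qed.

End DensityMartingale.

(** * Stopping levels with summable increments *)

Section MartingaleSubsequence.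
Context {d : measure_display} {E : measurableType d} {R : realType}.
Local Notation C := R[i].
Local Notation normc := (@Normc.normc R).
Variables (K : R.-fker E ~> E) (m : E -> set E -> C) (c : R) (g : nat -> set E).
Hypotheses (mg : forall n, measurable (g n)) (c0 : 0 <= c).
Hypothesis mm : forall A, measurable A -> cmeasurable (m ^~ A).
Hypothesis mle : forall x A, measurable A -> normc (m x A) <= c * fine (K x A).
Hypothesis madd : forall x A B, measurable A -> measurable B -> A `&` B = set0 ->
  m x (A `|` B) = m x A + m x B.
Implicit Types (phi : seq bool -> C).

Local Notation step := (step K m g).
Local Notation energy := (energy K m g).
Local Notation mass x := (fine (K x setT)).

Let mstep n := step_cmeasurable K mg mm n.
Let stepc n z : normc (step n z) <= c := step_le mg c0 mle n z.

Lemma mass_fin x : K x setT = (mass x)%:E.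
Proof. by rewrite fineK//; exact: fker_fin_num. Qed.

Lemma Rintegral_cst_fker x a : Rintegral (K x) setT (fun=> a) = a * mass x.
Proof. by rewrite /Rintegral integral_cst//= mass_fin -EFinM. Qed.

Lemma energy_nondecreasing x : nondecreasing_seq (energy ^~ x).
Proof.
apply/nondecreasing_seqP => n; rewrite -subr_ge0 -[n.+1]add1n -(energy_diff mg c0 mm mle madd).
by apply: Rintegral_ge0 => y _; rewrite exprn_ge0// normc_ge0.
Qed.

Lemma energy_le n x : energy n x <= c ^+ 2 * mass x.
Proof.
rewrite -Rintegral_cst_fker; apply: le_Rintegral => //.
- by apply: (@sqr_step_integrable _ _ _ _ _ _ c) => //; exact: cmeasurable_section.
- by apply: (@fker_bounded_integrable _ _ _ _ _ _ `|c ^+ 2|).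
- by move=> y _; rewrite ler_pXn2r ?nnegrE ?normc_ge0.
Qed.

Definition total_energy x := limn (energy ^~ x).

Lemma energy_cvg x : energy n x @[n --> \oo] --> total_energy x.
Proof.
apply: nondecreasing_is_cvgn; first exact: energy_nondecreasing.
by exists (c ^+ 2 * mass x) => _ [n _ <-]; exact: energy_le.
Qed.

Lemma energy_le_total n x : energy n x <= total_energy x.
Proof.
apply: nondecreasing_cvgn_le; first exact: energy_nondecreasing.
by apply/cvg_ex; exists (total_energy x); exact: energy_cvg.
Qed.

Lemma measurable_energy n : measurable_fun setT (energy n).
Proof.
apply: (measurable_fun_Rintegral_kernel K (F := fun z => normc (step n z) ^+ 2)).
exact: measurable_funX (measurable_normc (mstep n)).
Qed.

Lemma measurable_total_energy : measurable_fun setT total_energy.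
Proof. by apply: (measurable_fun_cvg measurable_energy) => x _; exact: energy_cvg. Qed.

(** The rate 8^-k pays for the passage from L2 to L1, which costs a factor 2^k: the outcome 4^-k is
    still below 2^-k. *)
Definition nearly_total k x n := total_energy x - energy n x <= 8^-1 ^+ k.

Lemma ex_nearly_total k x : exists n, nearly_total k x n.
Proof.
have e0 : 0 < 8^-1 ^+ k :> R by rewrite exprn_gt0// invr_gt0.
have /cvgrPdist_le/(_ _ e0)[n _ h] := energy_cvg (x := x).
by exists n; rewrite /nearly_total (le_trans (ler_norm _))//; exact: h (leqnn n).
Qed.

(** The speed of convergence depends on x, and so must the subsequence; taking the least possible
    level makes the choice measurable in x. *)
Definition settling k x := ex_minn (ex_nearly_total k x).

Lemma settlingP k x : nearly_total k x (settling k x).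
Proof. by rewrite /settling; case: ex_minnP. Qed.

Lemma settling_le k x n : (settling k x <= n)%N = nearly_total k x n.
Proof.
apply/idP/idP => [le_n|]; last by rewrite /settling; case: ex_minnP => p _; exact.
by rewrite /nearly_total (le_trans _ (settlingP k x))// lerB//; exact: energy_nondecreasing.
Qed.

Lemma settling_mono k x : (settling k x <= settling k.+1 x)%N.
Proof.
rewrite settling_le /nearly_total (le_trans (settlingP k.+1 x))// exprS ler_piMl ?exprn_ge0 ?invr_ge0//.
by rewrite invf_le1// ler1n.
Qed.

Lemma measurable_settling_le k n : measurable [set x | (settling k x <= n)%N].
Proof.
rewrite (_ : [set x | _] = [set x | total_energy x - energy n x <= 8^-1 ^+ k]); last first.
  by apply/seteqP; split => x /=; rewrite settling_le.
have := @measurable_fun_ler _ E R setT (fun x => total_energy x - energy n x) (fun=> 8^-1 ^+ k).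
move=> /(_ (measurable_funB measurable_total_energy (measurable_energy n)) (measurable_cst _)).
by move=> /(_ measurableT [set true] I); rewrite setTI.
Qed.

Lemma measurable_settling k n : measurable [set x | settling k x = n].
Proof.
case: n => [|n].
  rewrite (_ : [set x | _] = [set x | (settling k x <= 0)%N]); first exact: measurable_settling_le.
  by apply/seteqP; split => x /=; rewrite leqn0 => /eqP.
rewrite (_ : [set x | _] = [set x | (settling k x <= n.+1)%N] `\` [set x | (settling k x <= n)%N]).
  by apply: measurableD; exact: measurable_settling_le.
apply/seteqP; split => x /=; first by move=> ->; rewrite leqnn ltnn.
by case=> h1 /negP; rewrite -ltnNge => h2; apply/eqP; rewrite eqn_leq h1.
Qed.

(* Adding [k] makes every atomic set eventually visible, even where the energy
   is already total at a finite level. *)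
Definition stopped k (z : E * E) : C := step (k + settling k z.1) z.

(** The space is a countable union of measurable pieces on which the level is constant, and there
    [stopped k] is a single [step]. *)
Lemma measurable_stopped_comp (P : C -> R) k : (forall n, measurable_fun setT (fun z => P (step n z))) ->
  measurable_fun setT (fun z => P (stopped k z)).
Proof.
move=> mP _ Y mY; rewrite setTI.
rewrite (_ : _ @^-1` Y = \bigcup_n ((fst @^-1` [set x | settling k x = n]) `&`
    ((fun z => P (step (k + n) z)) @^-1` Y))).
  apply: bigcup_measurable => n _; apply: measurableI.
    by rewrite -[X in measurable X]setTI; apply: measurable_fst => //; exact: measurable_settling.
  by rewrite -[X in measurable X]setTI; exact: mP.
apply/seteqP; split => z /=; first by move=> h; exists (settling k z.1).
by move=> [n _ [/= <-]].
Qed.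

Lemma stopped_cmeasurable k : cmeasurable (stopped k).
Proof. by split; apply: measurable_stopped_comp => n; case: (mstep n). Qed.

Lemma stopped_le k z : normc (stopped k z) <= c. Proof. exact: stepc. Qed.

Lemma stopped_section_cmeasurable k x : cmeasurable (fun y => stopped k (x, y)).
Proof. exact: cmeasurable_section (stopped_cmeasurable k). Qed.

Lemma stopped_diff_cmeasurable k x : cmeasurable (fun y => stopped k.+1 (x, y) - stopped k (x, y)).
Proof. by apply: cmeasurableB; exact: stopped_section_cmeasurable. Qed.

Lemma stopped_diff_le k x y : normc (stopped k.+1 (x, y) - stopped k (x, y)) <= c + c.
Proof. by rewrite (le_trans (ler_normcB _ _))// lerD// stopped_le. Qed.

(** Both levels are at least [settling k x], so the increment of energy is at most what was still
    missing there. *)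
Lemma stopped_diff_sqr k x :
  Rintegral (K x) setT (fun y => normc (stopped k.+1 (x, y) - stopped k (x, y)) ^+ 2) <= 8^-1 ^+ k.
Proof.
pose j := (k.+1 + settling k.+1 x - (k + settling k x))%N.
have jE : (k.+1 + settling k.+1 x = j + (k + settling k x))%N.
  by rewrite subnK//; apply: leq_add => //; exact: settling_mono.
have := energy_diff mg c0 mm mle madd j (k + settling k x) x; rewrite -jE => h.
rewrite /stopped/= h (le_trans _ (settlingP k x))// lerB ?energy_le_total//.
by apply: energy_nondecreasing; exact: leq_addl.
Qed.

(** Pointwise D <= 2^k D^2 + 2^-k: the second term covers D <= 2^-k, the first one the opposite
    case. *)
Lemma stopped_diff_L1 k x :
  Rintegral (K x) setT (fun y => normc (stopped k.+1 (x, y) - stopped k (x, y))) <= (1 + mass x) * 2^-1 ^+ k.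
Proof.
set D := fun y => normc _.
have mD : measurable_fun setT D := measurable_normc (stopped_diff_cmeasurable k x).
have D0 y : 0 <= D y by exact: normc_ge0.
have iD : (K x).-integrable setT (EFin \o D).
  by apply: (@fker_bounded_integrable _ _ _ _ _ _ (c + c)) => // y; rewrite ger0_norm// stopped_diff_le.
have iD2 : (K x).-integrable setT (EFin \o (fun y => D y ^+ 2)).
  by apply: (@sqr_step_integrable _ _ _ _ _ _ (c + c)); [exact: stopped_diff_cmeasurable|exact: stopped_diff_le].
have i2 : (K x).-integrable setT (EFin \o (fun y => 2 ^+ k * D y ^+ 2)).
  exact: (integrableZl measurableT (2 ^+ k) iD2).
have i1 : (K x).-integrable setT (EFin \o (fun y : E => 2^-1 ^+ k)).
  by apply: (@fker_bounded_integrable _ _ _ _ _ _ `|2^-1 ^+ k|).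
apply: (@le_trans _ _ (Rintegral (K x) setT (fun y => 2 ^+ k * D y ^+ 2 + 2^-1 ^+ k))).
  apply: le_Rintegral => //; first exact: (integrableD measurableT i2 i1).
  move=> y _; have p0 : 0 < 2 ^+ k :> R by rewrite exprn_gt0.
  rewrite exprVn; have [h|h] := leP (D y) (2 ^+ k)^-1.
    by rewrite (le_trans h)// lerDr mulr_ge0 ?exprn_ge0.
  rewrite (@le_trans _ _ (2 ^+ k * D y ^+ 2))// ?lerDl ?invr_ge0 ?exprn_ge0//.
  rewrite expr2 mulrA ler_peMl ?normc_ge0// -ler_pdivrMl// mulr1; exact: ltW.
rewrite RintegralD// RintegralZl// Rintegral_cst_fker mulrDl mul1r [mass x * _]mulrC lerD2r.
rewrite (le_trans (ler_wpM2l _ (stopped_diff_sqr k x))) ?exprn_ge0// -exprMn.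
by apply: lerXn2r; rewrite ?nnegrE ?invr_ge0//; lra.
Qed.

End MartingaleSubsequence.

(** * The limit density *)

Section MartingaleLimit.
Context {d : measure_display} {E : measurableType d} {R : realType}.
Local Notation C := R[i].
Local Notation normc := (@Normc.normc R).
Variables (K : R.-fker E ~> E) (m : E -> set E -> C) (c : R) (g : nat -> set E).
Hypotheses (mg : forall n, measurable (g n)) (c0 : 0 <= c).
Hypothesis mm : forall A, measurable A -> cmeasurable (m ^~ A).
Hypothesis mle : forall x A, measurable A -> normc (m x A) <= c * fine (K x A).
Hypothesis madd : forall x A B, measurable A -> measurable B -> A `&` B = set0 ->
  m x (A `|` B) = m x A + m x B.
Implicit Types (phi : seq bool -> C).

Local Notation itinerary := (itinerary g).
Local Notation atom := (atom g).
Local Notation stopped := (stopped mg c0 mm mle madd).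
Local Notation mass x := (fine (K x setT)).

Let mstopped k := stopped_cmeasurable mg c0 mm mle madd k.
Let stoppedc k z : normc (stopped k z) <= c := stopped_le mg c0 mm mle madd k z.

Lemma sum_half_le n : \sum_(0 <= k < n) 2^-1 ^+ k <= 2 :> R.
Proof.
have -> : \sum_(0 <= k < n) 2^-1 ^+ k = 2 - 2 * 2^-1 ^+ n :> R.
  elim: n => [|n IH]; first by rewrite big_nil expr0 mulr1 subrr.
  by rewrite big_nat_recr//= IH exprS; field.
by rewrite gerBl mulr_ge0// exprn_ge0// invr_ge0.
Qed.

(** The integral of the total variation is at most 2 (1 + mass), so the sum of the increments is
    finite almost everywhere. *)
Lemma stopped_series_ae x : {ae K x, forall y, cvgn (series (fun k => normc (stopped k.+1 (x, y) - stopped k (x, y))))}.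
Proof.
pose D k y := normc (stopped k.+1 (x, y) - stopped k (x, y)).
have D0 k y : 0 <= D k y by exact: normc_ge0.
have mD k : measurable_fun setT (D k) := measurable_normc (stopped_diff_cmeasurable mg c0 mm mle madd k x).
have meD k : measurable_fun setT (fun y => (D k y)%:E) by exact/measurable_EFinP.
pose f y := (\sum_(k <oo) (D k y)%:E)%E.
have iD k : (K x).-integrable setT (EFin \o D k).
  by apply: (@fker_bounded_integrable _ _ _ _ _ _ (c + c)) => // y; rewrite ger0_norm// stopped_diff_le.
have f0 y : (0 <= f y)%E by apply: nneseries_ge0 => k _ _; rewrite lee_fin.
have fint : (\int[K x]_y f y <= ((1 + mass x) * 2)%:E)%E.
  rewrite /f integral_nneseries//; last by move=> k y _; rewrite lee_fin.
  apply: lime_le; first by apply: is_cvg_nneseries => k _ _; apply: integral_ge0 => y _; rewrite lee_fin.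
  apply: nearW => n.
  rewrite (eq_bigr (fun k => (Rintegral (K x) setT (D k))%:E)); last first.
    by move=> k _; rewrite /Rintegral fineK//; exact: integrable_fin_num (iD k).
  rewrite sumEFin lee_fin.
  apply: (@le_trans _ _ (\sum_(0 <= k < n) (1 + mass x) * 2^-1 ^+ k)).
    by apply: ler_sum => k _; exact: stopped_diff_L1.
  by rewrite -big_distrr/= ler_wpM2l ?sum_half_le// addr_ge0// fine_ge0.
have mf : measurable_fun setT f.
  by apply: ge0_emeasurable_sum => // k y _ _; rewrite lee_fin.
have fI : (K x).-integrable setT f.
  apply/integrableP; split => //.
  by under eq_integral do rewrite gee0_abs//; exact: le_lt_trans fint (ltry _).
have := integrable_ae measurableT fI; apply: filterS => y /(_ I) fy.
apply: nondecreasing_is_cvgn.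
  by apply/nondecreasing_seqP => n; rewrite /series/= big_nat_recr//= lerDl normc_ge0.
exists (fine (f y)) => _ [n _ <-]; rewrite -lee_fin fineK// /series/= -sumEFin.
by apply: nneseries_lim_ge => k _ _; rewrite lee_fin normc_ge0.
Qed.

Lemma stopped_cvg_ae x : {ae K x, forall y,
  cvgn (fun k => complex.Re (stopped k (x, y))) /\ cvgn (fun k => complex.Im (stopped k (x, y)))}.
Proof.
have := stopped_series_ae x; apply: filterS => y cy.
have gen (P : C -> R) : (forall a b, `|P a - P b| <= normc (a - b)) -> cvgn (fun k => P (stopped k (x, y))).
  move=> PN; have : cvgn (series (fun k => P (stopped k.+1 (x, y)) - P (stopped k (x, y)))).
    apply: (@normed_cvg _ R^o); apply: (series_le_cvg _ _ _ cy) => n //=; first exact: normc_ge0.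
  rewrite (_ : series _ = fun k => P (stopped k (x, y)) - P (stopped 0 (x, y))).
    move=> h; pose p0 := P (stopped 0 (x, y)).
    have -> : (fun k => P (stopped k (x, y))) = (fun k => P (stopped k (x, y)) - p0) \+ cst p0.
      by apply/funext => k /=; rewrite subrK.
    exact: is_cvgD h (is_cvg_cst _).
  by apply/funext => n; rewrite /series/= telescope_sumr.
split; apply: gen => a b; first by rewrite -ReN -ReD le_Re_normc.
by rewrite -ImN -ImD le_Im_normc.
Qed.

(** Upper limits make sense at every point and are jointly measurable, whereas convergence is known
    for each x only almost everywhere in y. *)
Definition raw_density (z : E * E) : C :=
  (limn_sup (fun k => complex.Re (stopped k z)) +i* limn_sup (fun k => complex.Im (stopped k z)))%C.

(** The cut-off restores the bound [c] at every point: where there is no convergence, the two upper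
    limits may come from different subsequences. *)
Definition density (z : E * E) : C := if normc (raw_density z) <= c then raw_density z else 0.

Lemma raw_density_cmeasurable : cmeasurable raw_density.
Proof.
have ub (P : C -> R) z : (forall a, `|P a| <= normc a) ->
    has_ubound (range (fun k => P (stopped k z))) /\ has_lbound (range (fun k => P (stopped k z))).
  move=> PN; split; [exists c|exists (- c)] => _ [k _ <-].
    by rewrite (le_trans (ler_norm _))// (le_trans (PN _)).
  by have := le_trans (PN (stopped k z)) (stoppedc k z); rewrite ler_norml => /andP[].
split; apply: measurable_fun_limn_sup => [z _|z _|k].
- by have [] := ub (@complex.Re R) z (@le_Re_normc R).
- by have [] := ub (@complex.Re R) z (@le_Re_normc R).
- by case: (mstopped k).
- by have [] := ub (@complex.Im R) z (@le_Im_normc R).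
- by have [] := ub (@complex.Im R) z (@le_Im_normc R).
- by case: (mstopped k).
Qed.

Lemma density_cmeasurable : cmeasurable density.
Proof.
have [m1 m2] := raw_density_cmeasurable.
have mb : measurable_fun setT (fun z => normc (raw_density z) <= c).
  by apply: measurable_fun_ler => //; exact: measurable_normc raw_density_cmeasurable.
split.
  rewrite (_ : (fun z => _) = fun z => if normc (raw_density z) <= c then complex.Re (raw_density z) else 0).
    exact: measurable_fun_ifT.
  by apply/funext => z; rewrite /density; case: ifP.
rewrite (_ : (fun z => _) = fun z => if normc (raw_density z) <= c then complex.Im (raw_density z) else 0).
  exact: measurable_fun_ifT.
by apply/funext => z; rewrite /density; case: ifP.
Qed.

Lemma density_le z : normc (density z) <= c.
Proof. by rewrite /density; case: ifP => // _; rewrite Normc.normc0. Qed.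

(** Where the sequence converges, upper limits are limits and the bound [c] passes to them, so the
    cut-off changes nothing. *)
Lemma stopped_cvg_density_ae x : {ae K x, forall y,
  complex.Re (stopped k (x, y)) @[k --> \oo] --> complex.Re (density (x, y)) /\
  complex.Im (stopped k (x, y)) @[k --> \oo] --> complex.Im (density (x, y))}.
Proof.
have := stopped_cvg_ae x; apply: filterS => y [c1 c2].
have E1 : complex.Re (raw_density (x, y)) = limn (fun k => complex.Re (stopped k (x, y))).
  exact: cvg_limn_supE.
have E2 : complex.Im (raw_density (x, y)) = limn (fun k => complex.Im (stopped k (x, y))).
  exact: cvg_limn_supE.
rewrite /density ifT; first by rewrite E1 E2.
rewrite -(@ler_pXn2r _ 2) ?nnegrE ?normc_ge0// sqr_normcE E1 E2.
have cv : (fun k => complex.Re (stopped k (x, y)) ^+ 2 + complex.Im (stopped k (x, y)) ^+ 2) @ \oo -->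
    limn (fun k => complex.Re (stopped k (x, y))) ^+ 2 + limn (fun k => complex.Im (stopped k (x, y))) ^+ 2.
  by apply: cvgD; rewrite !expr2; apply: cvgM.
rewrite -(cvg_lim (@Rhausdorff R) cv); apply: limr_le; first by apply/cvg_ex; eexists; exact: cv.
apply: nearW => k; rewrite -sqr_normcE.
by rewrite ler_pXn2r ?nnegrE ?normc_ge0.
Qed.

Lemma Rintegral_cvg_ae x (u : nat -> E -> R) (v : E -> R) a :
  (forall k, measurable_fun setT (u k)) -> measurable_fun setT v ->
  (forall k y, `|u k y| <= a) -> (forall y, `|v y| <= a) ->
  {ae K x, forall y, u k y @[k --> \oo] --> v y} ->
  Rintegral (K x) setT (u k) @[k --> \oo] --> Rintegral (K x) setT v.
Proof.
move=> mu mv ua va uv; have ia := fker_bounded_integrable K x (ltac:(exact: measurable_cst) : measurable_fun setT (fun=> a)) (fun=> lexx _).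
have iv := fker_bounded_integrable K x mv va.
apply: fine_cvg; rewrite fineK; last exact: integrable_fin_num iv.
have m_ k : measurable_fun setT (EFin \o u k) by exact/measurable_EFinP.
have mv' : measurable_fun setT (EFin \o v) by exact/measurable_EFinP.
have cv : {ae K x, forall y, setT y -> (EFin \o u k) y @[k --> \oo] --> (EFin \o v) y}.
  by apply: filterS uv => y h _; apply: cvg_EFin; [exact: nearW|exact: h].
have dom : {ae K x, forall y (k : nat), setT y -> (`|(EFin \o u k) y| <= (EFin \o (fun=> a)) y)%E}.
  by apply: aeW => y k _; rewrite lee_fin.
by have [_ _ ?] := dominated_convergence measurableT m_ mv' cv ia dom.
Qed.

Lemma measure_atoms n x A : measurable A -> m x A = \sum_(s <- words n) m x (A `&` atom n s).
Proof.
move=> mA; elim: n => [|n IH].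
  by rewrite big_seq1 (_ : A `&` _ = A)//; apply/seteqP; split => y // -[].
rewrite IH sum_words; apply: eq_bigr => s _.
rewrite (atom_split g) setIUr madd//.
- by apply: measurableI => //; exact: measurable_atom.
- by apply: measurableI => //; exact: measurable_atom.
- by rewrite setIACA setIid (atom_split_disjoint g) setI0.
Qed.

Lemma measure_empty x : m x set0 = 0.
Proof.
apply: Normc.eq0_normc; apply/eqP; rewrite eq_le normc_ge0 andbT.
by have := mle x measurable0; rewrite measure0 mulr0.
Qed.

(** For a set of level n and k >= n, the level k + [settling] is at least n, so the integral of
    [stopped k] over the set is already m x A; dominated convergence keeps this value in the
    limit. *)
Lemma cintegral_density_atomic x A : atomic_sets g A ->
  cintegral (K x) (fun y => ((\1_A y : R)%:C)%C * density (x, y)) = m x A.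
Proof.
move=> [n [p ->]]; set A' := [set y | _].
have mA : measurable A' by exact: measurable_itinerary.
pose phi s : C := if p s then 1 else 0.
have phiE y : ((\1_A' y : R)%:C)%C = phi (itinerary n y).
  rewrite indicE /phi /A'; case e : (p _); first by rewrite mem_set.
  by rewrite memNset//= e.
have intE k : (n <= k)%N -> cintegral (K x) (fun y => ((\1_A' y : R)%:C)%C * stopped k (x, y)) = m x A'.
  move=> nk; rewrite (measure_atoms n)//.
  rewrite (eq_bigr (fun s => phi s * m x (atom n s))); last first.
    move=> s _; rewrite /phi; case e : (p s).
      by rewrite mul1r (_ : A' `&` _ = atom n s)//; apply/seteqP; split => [y []//|y ys]; split => //; rewrite /A' /= [itinerary n y]ys.
    rewrite mul0r (_ : A' `&` _ = set0) ?measure_empty//.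
    by apply/seteqP; split => // y [py ys]; move: py; rewrite /A' /= [itinerary n y]ys e.
  have le : (n <= k + settling mg c0 mm mle madd k x)%N by exact: leq_trans (leq_addr _ _).
  rewrite -(cintegral_itinerary_step mg mle madd (k + settling mg c0 mm mle madd k x - n)) subnK//.
  by apply: eq_cintegral => y; rewrite phiE.
have m1 : cmeasurable (fun y => ((\1_A' y : R)%:C)%C) by exact: indic_cmeasurable.
have mu k : cmeasurable (fun y => ((\1_A' y : R)%:C)%C * stopped k (x, y)).
  by apply: cmeasurableM => //; exact: stopped_section_cmeasurable.
have mv : cmeasurable (fun y => ((\1_A' y : R)%:C)%C * density (x, y)).
  by apply: cmeasurableM => //; exact: cmeasurable_section density_cmeasurable.
have bd y (z : C) : normc z <= c -> normc (((\1_A' y : R)%:C)%C * z) <= c.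
  move=> zc; rewrite Normc.normcM normc_real (le_trans _ zc)// ler_piMl ?normc_ge0//.
  exact: indic_norm_le1.
have lim_eq (P : C -> R) : (forall z, `|P z| <= normc z) ->
    (forall k, measurable_fun setT (fun y => P (((\1_A' y : R)%:C)%C * stopped k (x, y)))) ->
    measurable_fun setT (fun y => P (((\1_A' y : R)%:C)%C * density (x, y))) ->
    (forall (t : R) z, P ((t%:C)%C * z) = t * P z) ->
    {ae K x, forall y, P (stopped k (x, y)) @[k --> \oo] --> P (density (x, y))} ->
    forall l, (forall k, (n <= k)%N -> Rintegral (K x) setT (fun y => P (((\1_A' y : R)%:C)%C * stopped k (x, y))) = l) ->
    Rintegral (K x) setT (fun y => P (((\1_A' y : R)%:C)%C * density (x, y))) = l.
  move=> PN mPu mPv PZ cP l lE.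
  have cI : Rintegral (K x) setT (fun y => P (((\1_A' y : R)%:C)%C * stopped k (x, y))) @[k --> \oo] -->
            Rintegral (K x) setT (fun y => P (((\1_A' y : R)%:C)%C * density (x, y))).
    apply: (@Rintegral_cvg_ae _ _ _ c) => //.
    - by move=> k y; rewrite (le_trans (PN _))// bd// stoppedc.
    - by move=> y; rewrite (le_trans (PN _))// bd// density_le.
    - apply: filterS cP => y h; under eq_fun do rewrite PZ; rewrite PZ.
      by apply: cvgMr.
  have cl : Rintegral (K x) setT (fun y => P (((\1_A' y : R)%:C)%C * stopped k (x, y))) @[k --> \oo] --> l.
    by apply: cvg_near_cst; exists n => // k /= nk; exact: lE.
  exact: (cvg_unique _ cI cl).
have cv := stopped_cvg_density_ae x.
apply: complex_eq => /=.
  apply: (lim_eq (@complex.Re R)).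
  - exact: le_Re_normc.
  - by move=> k; case: (mu k).
  - by case: mv.
  - by move=> t [p' q'] /=; ring.
  - by apply: filterS cv => y [].
  - by move=> k nk; rewrite -(intE k nk).
apply: (lim_eq (@complex.Im R)).
- exact: le_Im_normc.
- by move=> k; case: (mu k).
- by case: mv.
- by move=> t [p' q'] /=; ring.
- by apply: filterS cv => y [].
- by move=> k nk; rewrite -(intE k nk).
Qed.

End MartingaleLimit.

(** * Densities of dominated families of functionals *)

Section FunctionalDensity.
Context {d : measure_display} {E : measurableType d} {R : realType}.
Local Notation C := R[i].
Local Notation normc := (@Normc.normc R).
Variable w : E -> R.
Hypotheses (w_ge1 : forall x, 1 <= w x) (w_meas : measurable_fun setT w).

Let w0 x : 0 < w x. Proof. exact: lt_le_trans (w_ge1 x). Qed.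
Let w0' x : 0 <= w x. Proof. exact: ltW. Qed.

(** Indices that are not hit by the injection of [G] into the integers receive the empty set, so
    finite and empty families are covered too. *)
Lemma countably_generated_sequence : countably_generated E ->
  exists2 g : nat -> set E, forall n, measurable (g n) & @measurable d E = <<s range g >>.
Proof.
move=> [G /countable_injP[f finj] GE].
pose g n := xget set0 [set A | G A /\ f A = n].
have gG n : g n = set0 \/ G (g n).
  by rewrite /g; case: xgetP => [A -> []|]; [right|left].
have Gg A : G A -> range g A.
  move=> GA; exists (f A) => //; rewrite /g; case: xgetP => [A' _ [GA' fA']|/(_ A) []//].
  by apply: finj; rewrite ?inE.
have mg n : measurable (g n).
  by have [->//|Gn] := gG n; rewrite GE; exact: sub_gen_smallest.
exists g => //; apply/seteqP; split.
  rewrite GE; apply: smallest_sub; first exact: smallest_sigma_algebra.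
  by move=> A /Gg; exact: sub_gen_smallest.
by apply: smallest_sub; [exact: sigma_algebra_measurable|move=> _ [n _ <-]].
Qed.

Variables (K : R.-fker E ~> E) (MK : R) (L : E -> (E -> R) -> C) (c : R).
Hypotheses (KM : kernel_dominated w K (fun=> 1) MK) (c0 : 0 <= c).
Hypothesis L_meas : forall A, measurable A -> cmeasurable (fun x => L x (\1_A)).
Hypothesis L_lin : forall x a g h M M', wbounded w M g -> wbounded w M' h ->
  L x (fun y => a * g y + h y) = (a%:C)%C * L x g + L x h.
Hypothesis L_le : forall x g M, wbounded w M g ->
  normc (L x g) <= c * Rintegral (K x) setT (fun y => `|g y|).

Lemma weight_integrable_kernel x : (K x).-integrable setT (EFin \o w).
Proof. exact: (weight_integrable w_ge1 w_meas KM x). Qed.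

Lemma Re_dominated_functional x : dominated_functional w (fun g => complex.Re (L x g)) /\
  dominated_functional w (fun g => complex.Im (L x g)).
Proof.
split; apply: (bounded_dominated_functional (c := c) (weight_integrable_kernel x)).
- by move=> a g h M M' bg bh; rewrite (L_lin x a bg bh); case: (L x g) (L x h) => p q [r s] /=; ring.
- by move=> g M bg; rewrite (le_trans (le_Re_normc _))//; exact: L_le bg.
- by move=> a g h M M' bg bh; rewrite (L_lin x a bg bh); case: (L x g) (L x h) => p q [r s] /=; ring.
- by move=> g M bg; rewrite (le_trans (le_Im_normc _))//; exact: L_le bg.
Qed.

Lemma density_dominated_functional x (t : E -> R) : measurable_fun setT t -> (forall y, `|t y| <= c) ->
  dominated_functional w (fun g => Rintegral (K x) setT (fun y => g y * t y)).
Proof.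
move=> mt tc; apply: Rintegral_dominated_functional => //.
apply: le_integrable (integrableZl measurableT c (weight_integrable_kernel x)) => //.
  by apply/measurable_EFinP/measurable_funM => //; exact: measurableT_comp.
move=> y _ /=; rewrite lee_fin !normrM normr_id (ger0_norm c0) ler_wpM2r//.
Qed.

(** The real and the imaginary parts of both sides are dominated functionals of [g]; they agree on
    the atomic sets, a pi-system that contains the whole space and generates the sigma-algebra. *)
Theorem functional_density : countably_generated E ->
  exists theta : E * E -> C, [/\ cmeasurable theta, forall z, normc (theta z) <= c &
    forall x g M, wbounded w M g -> L x g = cintegral (K x) (fun y => ((g y)%:C)%C * theta (x, y))].
Proof.
move=> /countably_generated_sequence[g mg gE].
pose m x A := L x (\1_A).
have mle x A : measurable A -> normc (m x A) <= c * fine (K x A).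
  move=> mA; apply: le_trans (L_le x (wbounded_indic w_ge1 mA)) _.
  rewrite le_eqVlt; apply/orP; left; apply/eqP; congr (c * fine _).
  rewrite -[X in K x X]setIT -integral_indic//; apply: eq_integral => y _.
  by rewrite ger0_norm// indicE.
have madd x A B : measurable A -> measurable B -> A `&` B = set0 -> m x (A `|` B) = m x A + m x B.
  move=> mA mB AB; rewrite /m.
  have -> : \1_(A `|` B) = (fun y => 1 * \1_A y + \1_B y) :> (E -> R).
    apply/funext => y; rewrite mul1r !indicE in_setU.
    have [yA|//] := boolP (y \in A); last by rewrite add0r.
    have [yB|_] := boolP (y \in B); last by rewrite addr0.
    have : (A `&` B) y by split; exact: set_mem.
    by rewrite AB.
  by rewrite (L_lin x _ (wbounded_indic w_ge1 mA) (wbounded_indic w_ge1 mB)) mul1r.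
pose theta := density mg c0 L_meas mle madd.
have mtheta : cmeasurable theta by exact: density_cmeasurable.
have thetac z : normc (theta z) <= c by exact: density_le.
exists theta; split => // x f M bf.
have [mt1 mt2] : cmeasurable (fun y => theta (x, y)) by exact: cmeasurable_section.
have [dR dI] := Re_dominated_functional x.
have at1 (A : set E) : atomic_sets g A -> measurable A.
  by move=> [n [p ->]]; exact: measurable_itinerary.
have key A : atomic_sets g A -> L x (\1_A) = cintegral (K x) (fun y => ((\1_A y : R)%:C)%C * theta (x, y)).
  by move=> aA; rewrite (cintegral_density_atomic mg c0 L_meas mle madd).
have aT : atomic_sets g setT.
  by exists 0%N, xpredT; apply/seteqP; split.
(* The map [P] stands for either the real or the imaginary part, so that the argument is written
   once. *)
have fin_ (P : C -> R) : (forall (t : R) z, P ((t%:C)%C * z) = t * P z) ->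
    (forall z, `|P z| <= normc z) -> measurable_fun setT (fun y => P (theta (x, y))) ->
    (forall F, Rintegral (K x) setT (fun y => P (F y)) = P (cintegral (K x) F)) ->
    dominated_functional w (fun g => P (L x g)) ->
    P (L x f) = Rintegral (K x) setT (fun y => f y * P (theta (x, y))).
  move=> PZ PN mP PI dP.
  have dJ := density_dominated_functional x mP (fun y => le_trans (PN _) (thetac (x, y))).
  have dD := dominated_functional_sub dP dJ.
  have z0 A : atomic_sets g A -> P (L x (\1_A)) - Rintegral (K x) setT (fun y => \1_A y * P (theta (x, y))) = 0.
    move=> aA; rewrite (key A aA) -PI; apply/eqP; rewrite subr_eq0; apply/eqP.
    by apply: eq_Rintegral => y _; rewrite PZ.
  have := dominated_functional_pi_system w_ge1 dD (measurable_atomic_sets mg gE) (@atomic_setI _ _ g) (z0 _ aT) z0.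
  move=> h; have := dominated_functional_eq0 w_ge1 dD h bf.
  by move/eqP; rewrite subr_eq0 => /eqP.
apply: complex_eq => /=.
  rewrite (fin_ (@complex.Re R)) //.
  - by apply: eq_Rintegral => y _; case: (theta _) => p q /=; ring.
  - by move=> t [p q] /=; ring.
  - exact: le_Re_normc.
rewrite (fin_ (@complex.Im R)) //.
- by apply: eq_Rintegral => y _; case: (theta _) => p q /=; ring.
- by move=> t [p q] /=; ring.
- exact: le_Im_normc.
Qed.

End FunctionalDensity.

(** * The essential spectral radius *)

Section IteratedWeights.
Context {d : measure_display} {E : measurableType d} {R : realType}.
Local Notation C := R[i].
Local Notation normc := (@Normc.normc R).
Variable w : E -> R.
Hypotheses (w_ge1 : forall x, 1 <= w x) (w_meas : measurable_fun setT w).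
Variables (Q : R.-fker E ~> E) (MQ : R).
Hypotheses (MQ0 : 0 <= MQ) (QM : kernel_dominated w Q (fun=> 1) MQ).
Variables (chi : E * E -> C) (c : R).
Hypotheses (mchi : cmeasurable chi) (c0 : 0 <= c) (chi_le : forall z, normc (chi z) <= c).
Implicit Types (f : E -> R[i]^o) (g h : E -> R).
Local Notation B := (wspace w).
Local Notation N := (wnorm w).
Local Notation T := (kernel_op_weight Q chi).

Let w0 x : 0 < w x. Proof. exact: lt_le_trans (w_ge1 x). Qed.
Let w0' x : 0 <= w x. Proof. exact: ltW. Qed.

Lemma weighted_op_blin : blin_on N B T.
Proof.
exact: (kernel_op_weight_blin w_ge1 w_meas mchi
  (theta_dominated w_ge1 w_meas QM mchi c0 chi_le) (mulr_ge0 c0 MQ0)).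
Qed.

Lemma wspace_split f : B f -> f = ('i)%C *: of_real (fun x => complex.Im (f x)) + of_real (fun x => complex.Re (f x)).
Proof.
by move=> _; apply/funext => x; apply: complex_eq; rewrite ReD || rewrite ImD;
  rewrite /of_real /=; case: (f x) => p q /=; ring.
Qed.

(** Evaluation at x of the n-th iterate is a functional dominated by c^n Q^n(x, .), and
    [functional_density] represents it by a jointly measurable function. *)
Lemma iter_weight_density n : countably_generated E ->
  exists theta : E * E -> C, [/\ cmeasurable theta, forall z, normc (theta z) <= c ^+ n &
    forall f, B f -> iter n T f = kernel_op_weight (kpow Q n) theta f].
Proof.
move=> cE; have cn0 : 0 <= c ^+ n by exact: exprn_ge0.
have [hT lT _] := blin_on_iter n weighted_op_blin.
pose L x g := iter n T (of_real g) x.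
have KM := kpow_dominated w_ge1 w_meas MQ0 QM n.
have L_meas A : measurable A -> cmeasurable (fun x => L x (\1_A)).
  by move=> mA; exact: (wspace_cmeasurable (hT _ (wbounded_wreal w_ge1 (wbounded_indic w_ge1 mA)))).
have L_lin x a g h M M' : wbounded w M g -> wbounded w M' h ->
    L x (fun y => a * g y + h y) = (a%:C)%C * L x g + L x h.
  move=> bg bh; rewrite /L (_ : of_real _ = (a%:C)%C *: of_real g + of_real h).
    by rewrite lT//; [exact: (wbounded_wreal w_ge1 bg)|exact: (wbounded_wreal w_ge1 bh)].
  by apply/funext => y; rewrite /of_real rmorphD rmorphM.
have L_le x g M : wbounded w M g -> normc (L x g) <= c ^+ n * Rintegral (kpow Q n x) setT (fun y => `|g y|).
  move=> bg; have wg := wbounded_wreal w_ge1 bg.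
  apply: le_trans (iter_kernel_op_weight_le w_ge1 w_meas n x MQ0 QM mchi chi_le c0 wg) _.
  rewrite (_ : (fun y => normc (of_real g y)) = fun y => `|g y|); last first.
    by apply/funext => y; rewrite normc_real.
  have ba : wbounded w M (fun y => `|g y|).
    by have [m1 m2] := bg; split; [exact: measurableT_comp|move=> y; rewrite normr_id].
  by rewrite (iter_real_op w_ge1 w_meas MQ0 QM n ba).
have [theta [mt tc tE]] := functional_density w_ge1 w_meas KM cn0 L_meas L_lin L_le cE.
exists theta; split => // f Bf.
have MQn0 : 0 <= MQ ^+ n by exact: exprn_ge0.
have [_ lK _] := kernel_op_weight_blin w_ge1 w_meas mt
  (theta_dominated w_ge1 w_meas KM mt cn0 tc) (mulr_ge0 cn0 MQn0).
have TK g M : wbounded w M g -> iter n T (of_real g) = kernel_op_weight (kpow Q n) theta (of_real g).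
  by move=> bg; apply/funext => x; exact: tE bg.
have bR := wspace_Re w_ge1 Bf; have bI := wspace_Im w_ge1 Bf.
have wR := wbounded_wreal w_ge1 bR; have wI := wbounded_wreal w_ge1 bI.
by rewrite (wspace_split Bf) lT// lK// (TK _ _ bR) (TK _ _ bI).
Qed.

(** For ell = 1 the density is [chi] itself; what remains is to identify [kpow Q 1], a composition
    with the Dirac kernel, with [Q]. *)
Lemma kpow1_op f : kernel_op_weight (kpow Q 1) chi f = T f.
Proof.
have e x (F : E -> R) : Rintegral (kpow Q 1 x) setT F = Rintegral (Q x) setT F.
  rewrite /Rintegral; congr fine; apply: eq_measure_integral => A mA _.
  transitivity (\int[Q x]_y (\1_A y)%:E)%E; first by apply: eq_integral => y _.
  by rewrite integral_indic// setIT.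
by apply/funext => x; rewrite /kernel_op_weight /cintegral !e.
Qed.

Variables (ell : nat) (nu : probability E R) (alpha : E * E -> R) (S : R.-fker E ~> E).
Hypothesis ell0 : (0 < ell)%N.
Hypothesis alpha_ui : unif_int_density w nu alpha.
Hypothesis KS : forall x A, measurable A -> kpow Q ell x A = (S x A + kernel_density nu alpha x A)%E.
Variable theta : E * E -> C.
Hypotheses (mtheta : cmeasurable theta) (theta_le : forall z, normc (theta z) <= c ^+ ell).
Hypothesis iter_theta : forall f, B f -> iter ell T f = kernel_op_weight (kpow Q ell) theta f.

Let KM : kernel_dominated w (kpow Q ell) (fun=> 1) (MQ ^+ ell).
Proof. exact: kpow_dominated. Qed.
Let MQl0 : 0 <= MQ ^+ ell. Proof. exact: exprn_ge0. Qed.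
Let SM : kernel_dominated w S (fun=> 1) (MQ ^+ ell) := remainder_dominated w_ge1 w_meas KM alpha_ui KS.
Let p0 : 0 <= c ^+ ell. Proof. exact: exprn_ge0. Qed.

Lemma iter_real_op_le_weight n h a x : wspace w (of_real h) -> (forall x, h x <= a * w x) ->
  iter n (real_op S) h x <= a * iter n (real_op S) w x.
Proof.
move=> wh ha; elim: n x => [//|n IH] x; rewrite !iterS.
have wn := wreal_iter w_ge1 w_meas MQl0 SM n (wreal_weight w_ge1 w_meas).
rewrite -[a * _](congr1 (fun F => F x) (real_opZ w_ge1 w_meas SM a wn)).
apply: (real_op_le w_ge1 w_meas SM) => //.
  exact: (wreal_iter w_ge1 w_meas MQl0 SM n wh).
exact: (wrealZ w_ge1 a wn).
Qed.

(** With p = c^ell, the n-th iterate of the weighted remainder at [f] is at most p^n N(f) S^n w, and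
    S^n w grows at every rate above r(S); the hypothesis says p r(S) < b^ell. *)
Lemma remainder_growth b : c * (wradius w S) `^ (ell%:R^-1) < b ->
  exists sg M, [/\ 0 <= M, 0 < sg, sg < b ^+ ell &
    forall n f, B f -> N (iter n (kernel_op_weight S theta) f) <= M * sg ^+ n * N f].
Proof.
set r := wradius w S; set p := c ^+ ell => tb.
have r0 : 0 <= r by exact: spectral_radius_ge0.
have t0 : 0 <= c * r `^ (ell%:R^-1) by rewrite mulr_ge0// powR_ge0.
have prb : p * r < b ^+ ell.
  have -> : p * r = (c * r `^ (ell%:R^-1)) ^+ ell.
    rewrite exprMn -(powR_mulrn ell (powR_ge0 r _)) -powRrM mulVf ?powRr1//.
    by rewrite pnatr_eq0 -lt0n.
  by rewrite ltr_pXn2r// ?nnegrE// (le_trans t0)// ltW.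
pose dl := b ^+ ell - p * r.
have dl0 : 0 < dl by rewrite subr_gt0.
(* Since p may be 0, the + 1 keeps the quotient meaningful, and the rate finally declared is p r +
   dl / 2, which is positive, instead of p s, which it dominates. *)
pose s := r + dl / (2 * (p + 1)).
have p1 : 0 < 2 * (p + 1) by rewrite mulr_gt0// ltr_wpDl.
have rs : r < s by rewrite ltrDl divr_gt0.
have [s0 [M M0 hM]] := positive_kernel_growth w_ge1 w_meas MQl0 SM rs.
have ps : p * s <= p * r + dl / 2.
  rewrite /s mulrDr lerD2l mulrA ler_pdivrMr// mulrC.
  rewrite (_ : dl / 2 * (2 * (p + 1)) = dl * (p + 1)); last by field.
  by rewrite ler_pM2l// lerDl.
have sb : p * r + dl / 2 < b ^+ ell by rewrite /dl; lra.
exists (p * r + dl / 2), M; split => //.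
  by rewrite ltr_wpDl ?mulr_ge0// divr_gt0.
move=> n f Bf; have Nf : 0 <= N f by exact: wnorm_ge0.
have ps0 : 0 <= p * s by rewrite mulr_ge0// ltW.
have q0 : 0 <= p * r + dl / 2 by exact: le_trans ps.
apply: wnorm_le => //; first by rewrite !mulr_ge0// exprn_ge0.
move=> x; apply: le_trans (iter_kernel_op_weight_le w_ge1 w_meas n x MQl0 SM mtheta theta_le p0 Bf) _.
have h1 := iter_real_op_le_weight n x (wspace_normc w_ge1 Bf) (fun y => normc_le_wnorm w_ge1 y Bf).
apply: (@le_trans _ _ (p ^+ n * (N f * (M * s ^+ n * w x)))).
  apply: ler_wpM2l; first exact: exprn_ge0.
  by rewrite (le_trans h1)// ler_wpM2l.
rewrite (_ : p ^+ n * _ = (p * s) ^+ n * (M * N f * w x)); last by rewrite exprMn; ring.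
rewrite (_ : M * _ * _ * _ = (p * r + dl / 2) ^+ n * (M * N f * w x)); last by ring.
by rewrite ler_wpM2r ?mulr_ge0//; apply: lerXn2r; rewrite ?nnegrE.
Qed.

(** The iterate T^ell integrates [theta] against Q^ell = S + alpha nu, hence is the weighted
    remainder plus the operator of density theta alpha, whose products are handled by
    [compact_product]. *)
Theorem weighted_ess_radius_le : ess_spectral_radius N B T <= c * (wradius w S) `^ (ell%:R^-1).
Proof.
have [K [K0 [dK fK]]] : exists K, 0 <= K /\
    (kernel_dominated w (kconst nu) (fun z => theta z * ((alpha z)%:C)%C) K /\
    forall a, fin_rank_limit_on N B (kernel_op_weight (kconst nu) (fun z => theta z * ((alpha z)%:C)%C) \o
      iter a (kernel_op_weight S theta) \o kernel_op_weight (kconst nu) (fun z => theta z * ((alpha z)%:C)%C))).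
  by have [K K0 h] := compact_product w_ge1 w_meas MQl0 SM mtheta p0 theta_le alpha_ui; exists K.
have malpha : measurable_fun setT alpha by case: alpha_ui.
have mda : cmeasurable (fun z => theta z * ((alpha z)%:C)%C).
  by apply: cmeasurableM => //; exact: cmeasurable_real.
apply: (ess_spectral_radius_on_le (wspace_complete_norm w_ge1) (wspace_subspace w_ge1)
  (S := kernel_op_weight S theta) (U := kernel_op_weight (kconst nu) (fun z => theta z * ((alpha z)%:C)%C)) (m := ell)) => //.
- by rewrite mulr_ge0// powR_ge0.
- exact: weighted_op_blin.
- exact: (St_blin w_ge1 w_meas MQl0 SM mtheta p0 theta_le).
- exact: (kernel_op_weight_blin w_ge1 w_meas mda dK K0).
- by move=> f Bf; rewrite iter_theta// (kernel_op_weight_decomposition w_ge1 w_meas KM MQl0 alpha_ui KS mtheta theta_le Bf).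
- by move=> b; exact: remainder_growth.
Qed.

End IteratedWeights.

(** Both parts are instances of [weighted_ess_radius_le]: (i) with chi and theta equal to 1 and c =
    1, (ii) with c the supremum of |chi| and theta either chi or the density of the iterate.
    Quasi-compactness then follows from the strict inequality assumed. *)
Theorem mainTheorem6 (R : realType) (d : measure_display) (E : measurableType d)
    (w : E -> R) (w_ge1 : forall x, 1 <= w x) (w_meas : measurable_fun setT w)
    (Q : R.-fker E ~> E) (Qw_bounded : weight_bounded w Q)
    (ell : nat) (ell_ge1 : (1 <= ell)%N)
    (nu : probability E R)
    (alpha : E * E -> R) (alpha_ui : unif_int_density w nu alpha)
    (S : R.-fker E ~> E)
    (S_ge0 : forall x A, measurable A ->
      (kernel_density nu alpha x A <= kernel_pow Q ell x A)%E)
    (S_def : forall x A, measurable A ->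
      S x A = (kernel_pow Q ell x A - kernel_density nu alpha x A)%E)
    (S_lt : (wradius w S) `^ (ell%:R^-1) < wradius w Q) :
  (quasi_compact (wnorm w) (wspace w) (kernel_op Q) /\
   ess_spectral_radius (wnorm w) (wspace w) (kernel_op Q)
     <= (wradius w S) `^ (ell%:R^-1)) /\
  (ell = 1%N \/ countably_generated E ->
   forall chi : E * E -> R[i], bounded_cmeasurable chi ->
     sup_norm chi * (wradius w S) `^ (ell%:R^-1)
       < spectral_radius (wnorm w) (wspace w) (kernel_op_weight Q chi) ->
     quasi_compact (wnorm w) (wspace w) (kernel_op_weight Q chi) /\
     ess_spectral_radius (wnorm w) (wspace w) (kernel_op_weight Q chi)
       <= sup_norm chi * (wradius w S) `^ (ell%:R^-1)).
Proof.
have w0 x : 0 < w x by exact: lt_le_trans (w_ge1 x).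
have [MQ MQ0 QM] : exists2 MQ, 0 <= MQ & kernel_dominated w Q (fun=> 1) MQ.
  have [M hM] := Qw_bounded; exists (Num.max M 0); first by rewrite le_max lexx orbT.
  apply/kernel_dominated1E => x; have := hM x; rewrite lee_pdivrMl// => /le_trans; apply.
  by rewrite -EFinM lee_fin mulrC ler_wpM2r ?le_max ?lexx// ltW.
(* The subtraction in [S_def] can be undone because the density part is finite, being below the
   finite measure [kpow Q ell x]. *)
have KS x A : measurable A -> kpow Q ell x A = (S x A + kernel_density nu alpha x A)%E.
  move=> mA; have Kfin : kpow Q ell x A \is a fin_num by exact: fker_fin_num.
  have [alpha0 _ _] := alpha_ui.
  have d0 : (0 <= kernel_density nu alpha x A)%E by apply: integral_ge0 => y _; rewrite lee_fin.
  rewrite S_def// -kpowE// subeK// ge0_fin_numE//.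
  by apply: le_lt_trans (S_ge0 x A mA) _; rewrite -kpowE// -ge0_fin_numE.
set r := wradius w S `^ _ in S_lt *.
have qc T t : ess_spectral_radius (wnorm w) (wspace w) T <= t -> t < spectral_radius (wnorm w) (wspace w) T ->
    quasi_compact (wnorm w) (wspace w) T /\ ess_spectral_radius (wnorm w) (wspace w) T <= t.
  by move=> h1 h2; split; [exact: (le_lt_trans h1 h2)|exact: h1].
split.
  apply: (qc _ _ _ S_lt); rewrite -[leRHS]mul1r -kernel_op_weight1.
  apply: (weighted_ess_radius_le w_ge1 w_meas MQ0 QM (cmeasurable_cst 1) ler01 _ ell_ge1 alpha_ui KS
    (theta := fun=> 1) (cmeasurable_cst 1)).
  - by move=> z; rewrite Normc.normc1.
  - by move=> z; rewrite expr1n Normc.normc1.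
  - by move=> f Bf; rewrite !kernel_op_weight1 (iter_kernel_op w_ge1 w_meas MQ0 QM).
move=> ell1 chi [mchi [M chiM]] rchi; apply: (qc _ _ _ rchi).
have chi_le z : Normc.normc (chi z) <= sup_norm chi.
  by apply: ub_le_sup; [exists M => _ [y _ <-]|exists z].
have c0 : 0 <= sup_norm chi.
  (* On an empty space the supremum is 0 by default. *)
  have [[z _]|nE] := pselect (exists z : E * E, True).
    exact: le_trans (normc_ge0 (chi z)) (chi_le z).
  by rewrite /sup_norm sup_out// => -[[_ [z _ _]] _]; apply: nE; exists z.
have [theta [mtheta theta_le thetaE]] : exists theta : E * E -> R[i], [/\ cmeasurable theta,
    forall z, Normc.normc (theta z) <= sup_norm chi ^+ ell &
    forall f, wspace w f -> iter ell (kernel_op_weight Q chi) f = kernel_op_weight (kpow Q ell) theta f].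
  case: ell1 => [->|cE]; last exact: (iter_weight_density w_ge1 w_meas MQ0 QM mchi c0 chi_le ell cE).
  by exists chi; split => // f Bf; rewrite kpow1_op.
exact: (weighted_ess_radius_le w_ge1 w_meas MQ0 QM mchi c0 chi_le ell_ge1 alpha_ui KS mtheta theta_le thetaE).
Qed.
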